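(* Suppose that: (i) the observed index set $\Omega\subseteq[n]$ is drawn by the Bernoulli model with probability $p$, i.e., each index $i\in[n]$ belongs to $\Omega$ independently with probability $p$; (ii) the rank-$r$ Hankel matrix $\mathcal{H}\mathbf{x}^\natural=\mathcal{G}\mathbf{z}^\natural\in\mathbb{C}^{n_1\times n_2}$ is $\mu$-incoherent, i.e., $\|\mathbf{U}^\natural\|_{2,\infty}\le\sqrt{\mu c_s r/n}$ and $\|\mathbf{V}^\natural\|_{2,\infty}\le\sqrt{\mu c_s r/n}$, where $\mathbf{U}^\natural\mathbf{\Sigma}^\natural\mathbf{V}^{\natural *}$ is its compact SVD and $c_s=\max\{n/n_1,n/n_2\}$; (iii) the observed outliers are $\alpha p$-sparse, i.e., $\|\Pi_\Omega\mathbf{s}^\natural\|_0=\|\Pi_\Omega\mathbf{w}^\natural\|_0\le\alpha p n$. Assume moreover $p\gtrsim\mathcal{O}((c_s^2\mu^2 r^2\log n)/n)$ and $\alpha\lesssim\mathcal{O}(1/(c_s\mu r\kappa^2))$. Choose the parameters $\lambda=1/16$, $\gamma_k\in[1+1/b_0,2]$ with some fixed $b_0\ge1$, and $\eta=\tilde c/\sigma_1^\natural$ with some sufficiently small constant $\tilde c$. If the initialization satisfies $d_0\lesssim\mathcal{O}(\sqrt{\sigma_r^\natural/\kappa})$, then with probability at least $1-6n^{-2}$, the iterations of HSGD satisfy $$d_{k+1}^2\le\Big(1-\frac{\eta\sigma_r^\natural}{64}\Big)^k d_0^2.$$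
   Context: Setting: $\mathcal{H}:\mathbb{C}^n\to\mathbb{C}^{n_1\times n_2}$ is the Hankel mapping $[\mathcal{H}\mathbf{x}]_{i,j}=x_{i+j-1}$, $n=n_1+n_2-1$. $\mathcal{D}:\mathbb{C}^n\to\mathbb{C}^n$ is $[\mathcal{D}\mathbf{x}]_i=\sqrt{\varsigma_i}x_i$ with $\varsigma_i$ the number of entries on the $i$-th antidiagonal of an $n_1\times n_2$ matrix, and $\mathcal{G}=\mathcal{H}\mathcal{D}^{-1}$. Data: $\mathbf{f}=\mathcal{D}\mathbf{y}=\mathbf{z}^\natural+\mathbf{s}^\natural$ with $\mathbf{z}^\natural=\mathcal{D}\mathbf{x}^\natural$ (low-rank Hankel part) and $\mathbf{s}^\natural=\mathcal{D}\mathbf{w}^\natural$ (sparse outliers); only $\Pi_\Omega\mathbf{f}$ is observed, where $[\Pi_\Omega\mathbf{v}]_i=v_i$ if $i\in\Omega$ and $0$ otherwise. $\sigma_i^\natural$ are the singular values of $\mathcal{H}\mathbf{x}^\natural$, $\kappa=\sigma_1^\natural/\sigma_r^\natural$. Loss: $\ell(\mathbf{L},\mathbf{R};\mathbf{s})=\frac{1}{2p}\|\Pi_\Omega(\mathcal{G}^*(\mathbf{L}\mathbf{R}^* )+\mathbf{s}-\mathbf{f})\|_2^2+\frac12\|(\mathcal{I}-\mathcal{G}\mathcal{G}^* )(\mathbf{L}\mathbf{R}^* )\|_F^2+\frac{\lambda}{4}\|\mathbf{L}^*\mathbf{L}-\mathbf{R}^*\mathbf{R}\|_F^2$. $\Gamma_{\tilde\alpha}(\mathbf{v})$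 keeps the $\tilde\alpha n$ largest-magnitude entries of $\mathbf{v}$ and zeros the rest. HSGD: initialization $\mathbf{s}^{(0)}=\mathcal{D}\Gamma_{\alpha p}(\mathcal{D}^{-1}\Pi_\Omega\mathbf{f})$; $\mathbf{U}^{(0)}\mathbf{\Sigma}^{(0)}\mathbf{V}^{(0)*}$ is the rank-$r$ truncated SVD of $p^{-1}\mathcal{G}(\Pi_\Omega\mathbf{f}-\mathbf{s}^{(0)})$; $\tilde{\mathbf{L}}^{(0)}=\mathbf{U}^{(0)}(\mathbf{\Sigma}^{(0)})^{1/2}$, $\tilde{\mathbf{R}}^{(0)}=\mathbf{V}^{(0)}(\mathbf{\Sigma}^{(0)})^{1/2}$; convex sets $\mathcal{L}=\{\mathbf{L}:\|\mathbf{L}\|_{2,\infty}^2\le\frac{2\mu r c_s}{n}\|\tilde{\mathbf{L}}^{(0)}\|_2^2\}$, $\mathcal{R}=\{\mathbf{R}:\|\mathbf{R}\|_{2,\infty}^2\le\frac{2\mu r c_s}{n}\|\tilde{\mathbf{R}}^{(0)}\|_2^2\}$; $\mathbf{L}^{(0)}=\Pi_{\mathcal{L}}\tilde{\mathbf{L}}^{(0)}$, $\mathbf{R}^{(0)}=\Pi_{\mathcal{R}}\tilde{\mathbf{R}}^{(0)}$. Iterations: $\mathbf{s}^{(k+1)}=\Gamma_{\gamma_k\alpha p}(\Pi_\Omega(\mathbf{f}-\mathcal{G}^*(\mathbf{L}^{(k)}\mathbf{R}^{(k)*})))$, $\mathbf{L}^{(k+1)}=\Pi_{\mathcal{L}}(\mathbf{L}^{(k)}-\eta\nabla_{\mathbf{L}}\ell(\mathbf{L}^{(k)},\mathbf{R}^{(k)};\mathbf{s}^{(k+1)}))$,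 $\mathbf{R}^{(k+1)}=\Pi_{\mathcal{R}}(\mathbf{R}^{(k)}-\eta\nabla_{\mathbf{R}}\ell(\mathbf{L}^{(k)},\mathbf{R}^{(k)};\mathbf{s}^{(k+1)}))$. Error: $d_k=\min_{\mathbf{Q}}\sqrt{\|\mathbf{L}^{(k)}-\mathbf{L}^\natural\mathbf{Q}\|_F^2+\|\mathbf{R}^{(k)}-\mathbf{R}^\natural\mathbf{Q}\|_F^2}$ over $r\times r$ rotation (unitary) matrices $\mathbf{Q}$, with $\mathbf{L}^\natural=\mathbf{U}^\natural\mathbf{\Sigma}^{\natural 1/2}$, $\mathbf{R}^\natural=\mathbf{V}^\natural\mathbf{\Sigma}^{\natural 1/2}$. *)

(* Defs.v *)
From HB Require Import structures.
From mathcomp Require Import all_boot all_order all_algebra.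
From mathcomp Require Import all_classical all_reals all_analysis.
From mathcomp Require Import complex Rstruct Rstruct_topology.
Set Implicit Arguments.
Unset Strict Implicit.
Unset Printing Implicit Defensive.
Import Order.TTheory GRing.Theory Num.Theory.
Local Open Scope ring_scope.
Local Open Scope classical_set_scope.

Notation RR := Rdefinitions.R.
Notation CC := (complex RR).

Definition toC (x : RR) : CC := Complex x 0.

Definition cabs (x : CC) : RR := complex.Re `|x|.

Definition adj m k (A : 'M[CC]_(m, k)) : 'M[CC]_(k, m) := (map_mx Num.conj A)^T.

Definition vnorm2 m (v : 'cV[CC]_m) : RR := \sum_i cabs (v i 0) ^+ 2.
Definition frob2 m k (A : 'M[CC]_(m, k)) : RR := \sum_i \sum_j cabs (A i j) ^+ 2.

Definition norm2inf m k (A : 'M[CC]_(m, k)) : RR :=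
  \big[Num.max/0]_i Num.sqrt (\sum_j cabs (A i j) ^+ 2).

Definition specnorm m k (A : 'M[CC]_(m, k)) : RR :=
  sup [set Num.sqrt (vnorm2 (A *m v)) | v in [set v : 'cV[CC]_k | vnorm2 v = 1]].

Definition rinner m k (A B : 'M[CC]_(m, k)) : RR := complex.Re (\tr (adj A *m B)).

Definition diagr a b (s : nat -> RR) : 'M[CC]_(a, b) :=
  \matrix_(i, j) if (i : nat) == j then toC (s i) else 0.

Definition sqrtf (s : nat -> RR) : nat -> RR := fun i => Num.sqrt (s i).

Section Hankel.
Variables n1 n2 : nat.
Local Notation N := (n1 + n2).-1.

Definition vsig (i : nat) : nat :=
  #|[set ab : 'I_n1 * 'I_n2 | (ab.1 + ab.2 == i)%N]|.

Definition sqvs (i : nat) : CC := toC (Num.sqrt (vsig i)%:R).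

Definition hankel (x : 'cV[CC]_N) : 'M[CC]_(n1, n2) :=
  \matrix_(i, j) \sum_(k < N | (k : nat) == (i + j)%N) x k 0.

Definition Dop (x : 'cV[CC]_N) : 'cV[CC]_N := \col_i (sqvs i * x i 0).
Definition Dinv (x : 'cV[CC]_N) : 'cV[CC]_N := \col_i (x i 0 / sqvs i).

Definition Gop (x : 'cV[CC]_N) : 'M[CC]_(n1, n2) := hankel (Dinv x).
Definition Gadj (M : 'M[CC]_(n1, n2)) : 'cV[CC]_N :=
  \col_i ((\sum_(a < n1) \sum_(b < n2 | (a + b == i)%N) M a b) / sqvs i).

Definition PiOm (Om : {set 'I_N}) (v : 'cV[CC]_N) : 'cV[CC]_N :=
  \col_i (if i \in Om then v i 0 else 0).

Definition loss r (p lam : RR) (Om : {set 'I_N}) (f s : 'cV[CC]_N)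
    (L : 'M[CC]_(n1, r)) (R : 'M[CC]_(n2, r)) : RR :=
  let X := L *m adj R in
  (2 * p)^-1 * vnorm2 (PiOm Om (Gadj X + s - f))
  + 2^-1 * frob2 (X - Gop (Gadj X))
  + lam / 4 * frob2 (adj L *m L - adj R *m R).

End Hankel.

Arguments vsig n1 n2 i : clear implicits.
Arguments sqvs n1 n2 i : clear implicits.
Arguments hankel n1 n2 x : clear implicits.
Arguments Dop n1 n2 x : clear implicits.
Arguments Dinv n1 n2 x : clear implicits.
Arguments Gop n1 n2 x : clear implicits.
Arguments Gadj n1 n2 M : clear implicits.
Arguments PiOm n1 n2 Om v : clear implicits.
Arguments loss n1 n2 r p lam Om f s L R : clear implicits.

Definition is_gradL m1 m2 k (F : 'M[CC]_(m1, k) -> 'M[CC]_(m2, k) -> RR)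
    L R (g : 'M[CC]_(m1, k)) :=
  forall E : 'M[CC]_(m1, k),
    is_derive (0 : RR^o) (1 : RR^o) (fun t : RR^o => (F (L + toC t *: E) R : RR^o)) (rinner g E : RR^o).
Definition is_gradR m1 m2 k (F : 'M[CC]_(m1, k) -> 'M[CC]_(m2, k) -> RR)
    L R (g : 'M[CC]_(m2, k)) :=
  forall E : 'M[CC]_(m2, k),
    is_derive (0 : RR^o) (1 : RR^o) (fun t : RR^o => (F L (R + toC t *: E) : RR^o)) (rinner g E : RR^o).

Definition is_proj m k (S : set 'M[CC]_(m, k)) (X Y : 'M[CC]_(m, k)) :=
  S Y /\ forall Z, S Z -> frob2 (X - Y) <= frob2 (X - Z).

Definition rowball m k (B : RR) : set 'M[CC]_(m, k) :=
  [set L | norm2inf L ^+ 2 <= B].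

(* w = Gamma_a(v): keeps the floor(a n) largest-magnitude entries of v
   (any admissible choice in case of ties), zeroes the others *)
Definition is_hthr n (a : RR) (v w : 'cV[CC]_n) :=
  exists T : {set 'I_n},
    #|T| = minn n (Num.truncn (a * n%:R)) /\
    (forall i j, i \in T -> j \notin T -> cabs (v j 0) <= cabs (v i 0)) /\
    w = \col_i (if i \in T then v i 0 else 0).

Definition full_svd m1 m2 (M : 'M[CC]_(m1, m2)) (Uf : 'M[CC]_m1) (Vf : 'M[CC]_m2)
    (s : nat -> RR) :=
  adj Uf *m Uf = 1%:M /\ adj Vf *m Vf = 1%:M /\
  (forall i, 0 <= s i) /\ (forall i j, (i <= j)%N -> s j <= s i) /\
  M = Uf *m diagr m1 m2 s *m adj Vf.

Definition trunc_svd m1 m2 r (M : 'M[CC]_(m1, m2)) (U : 'M[CC]_(m1, r))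
    (V : 'M[CC]_(m2, r)) (s : nat -> RR) :=
  exists Uf Vf, full_svd M Uf Vf s /\
    (forall i (k : 'I_r) (k' : 'I_m1), (k : nat) = k' -> U i k = Uf i k') /\
    (forall i (k : 'I_r) (k' : 'I_m2), (k : nat) = k' -> V i k = Vf i k').

Definition compact_svd m1 m2 r (M : 'M[CC]_(m1, m2)) (U : 'M[CC]_(m1, r))
    (V : 'M[CC]_(m2, r)) (sig : nat -> RR) :=
  adj U *m U = 1%:M /\ adj V *m V = 1%:M /\
  (forall i, (i < r)%N -> 0 < sig i) /\
  (forall i j, (i <= j < r)%N -> sig j <= sig i) /\
  M = U *m diagr r r sig *m adj V.

Definition dist m1 m2 r (Ln : 'M[CC]_(m1, r)) (Rn : 'M[CC]_(m2, r))
    (L : 'M[CC]_(m1, r)) (R : 'M[CC]_(m2, r)) : RR :=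
  Num.sqrt (inf [set frob2 (L - Ln *m Q) + frob2 (R - Rn *m Q)
                | Q in [set Q : 'M[CC]_r | adj Q *m Q = 1%:M]]).

Definition c_s n1 n2 : RR :=
  Num.max ((n1 + n2).-1%:R / n1%:R) ((n1 + n2).-1%:R / n2%:R).

Definition hsgd_run n1 n2 r (p alpha lam eta mu : RR) (gamma : nat -> RR)
    (Om : {set 'I_((n1 + n2).-1)}) (f : 'cV[CC]_((n1 + n2).-1))
    (L : nat -> 'M[CC]_(n1, r)) (R : nat -> 'M[CC]_(n2, r))
    (s : nat -> 'cV[CC]_((n1 + n2).-1)) :=
  let n := (n1 + n2).-1 in
  (exists w, is_hthr (alpha * p) (Dinv n1 n2 (PiOm n1 n2 Om f)) w /\ s 0%N = Dop n1 n2 w) /\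
  exists U0 V0 sig0,
    trunc_svd (toC p^-1 *: Gop n1 n2 (PiOm n1 n2 Om f - s 0%N)) U0 V0 sig0 /\
    let Lt := U0 *m diagr r r (sqrtf sig0) in
    let Rt := V0 *m diagr r r (sqrtf sig0) in
    let setL := @rowball n1 r (2 * mu * r%:R * c_s n1 n2 / n%:R * specnorm Lt ^+ 2) in
    let setR := @rowball n2 r (2 * mu * r%:R * c_s n1 n2 / n%:R * specnorm Rt ^+ 2) in
    is_proj setL Lt (L 0%N) /\ is_proj setR Rt (R 0%N) /\
    forall k,
      is_hthr (gamma k * alpha * p)
        (PiOm n1 n2 Om (f - Gadj n1 n2 (L k *m adj (R k)))) (s k.+1) /\
      exists gL gR,
        is_gradL (loss n1 n2 r p lam Om f (s k.+1)) (L k) (R k) gL /\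
        is_gradR (loss n1 n2 r p lam Om f (s k.+1)) (L k) (R k) gR /\
        is_proj setL (L k - toC eta *: gL) (L k.+1) /\
        is_proj setR (R k - toC eta *: gR) (R k.+1).

Definition bern_prob n (p : RR) (E : {set 'I_n} -> Prop) : RR :=
  \sum_(Om : {set 'I_n})
     (p ^+ #|Om| * (1 - p) ^+ (n - #|Om|)) * (if `[< E Om >] then 1 else 0).

(* Main.v *)
Require Import Defs.
From HB Require Import structures.
From mathcomp Require Import all_boot all_order all_algebra.
From mathcomp Require Import all_classical all_reals all_analysis.
From mathcomp Require Import complex Rstruct Rstruct_topology.
From mathcomp Require separable cyclic cyclotomic.
From mathcomp Require Import ring lra zify.
Set Implicit Arguments.
Unset Strict Implicit.
Unset Printing Implicit Defensive.
Import Order.TTheory GRing.Theory Num.Theory.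
Local Open Scope ring_scope.

(** Put [nu = mu c_s r / n] and [w_i = [i in Omega]/p - 1].  Three properties of [Omega]
    suffice, and they hold together with probability at least [1 - 6/n^2]:
    [sum_i w_i |(G^* T)_i|^2] is at most a small multiple of [|T|_F^2] for tangent [T] at
    [G z]; the Hankel matrix of [w_i x_i] has small spectral norm; and every interval [I] has
    at most [2 p |I| + 12 log n] samples.  All three follow from one Bernstein inequality for
    sums of independent matrices in the Frobenius norm, obtained from an exponential
    supermartingale.  It replaces the matrix Bernstein inequality because the tangent
    projections of the basis matrices have squared norm at most [2 nu], so that even the
    Hilbert-Schmidt norm of the sampling operator concentrates, and because a Hankel matrix is
    a corner of a circulant, so that its norm is governed by [n] scalar Fourier sums.

    On such an [Omega], align the iterate with the ground truth by the optimal rotation, which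
    makes the cross-Gram matrix Hermitian.  The tangent part of the error and the imbalance
    together then dominate [sigma_r d^2].  The remaining part is the product of the two factor
    errors; away from the ends of [[n]] its sampled energy is controlled by halving each
    antidiagonal and counting samples, and the few samples near the ends are controlled by
    incoherence.  Hard thresholding leaves a residual supported on at most [3 alpha p n] indices
    and dominated there by the current error, since each outlier it misses is matched with a
    larger entry it removes.  Hence the gradient correlates with the error and has norm of the
    same order, and projected gradient descent contracts.  The initialization enters only
    through the radii of the two balls: its top singular value lies between [sigma_1/2] and
    [3 sigma_1/2]. *)

(** * Complex matrices *)

(** The iterates depend on Omega, so every random estimate has to be uniform: over the tangent space
    at the truth, or over all pairs of factors. The product of the two factor errors lies in no
    fixed subspace, so the isometry does not reach it. It is handled through the weight 1/sqrt(v)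
    that G^* gives to an antidiagonal of length v. Each entry is charged to its row or to its column
    so that a row or column receives indices from three windows only, each no longer than the
    antidiagonals there; what remains is a count of samples per window. The additive log n in that
    count is harmless only if p times the window length dominates it, which is why the ends of [n]
    are set apart.

    With accuracy e = 1/100, the choice Cp = 32/e^2 gives exponents of 4 log n. Failure costs 2/n^4
    for the isometry, n times 2/n^4 for the Fourier sums and (n+1)^2 times 2/n^6 for the intervals.

    No closed form of the gradient occurs: its inner product with the error and its own squared norm
    are both values of one directional derivative. *)

Lemma cabs2 (z : CC) : cabs z ^+ 2 = complex.Re z ^+ 2 + complex.Im z ^+ 2.
Proof.
by case: z => a b; rewrite /cabs /= sqr_sqrtr // addr_ge0 ?sqr_ge0.
Qed.

Lemma cabs_ge0 (z : CC) : 0 <= cabs z.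
Proof. by case: z => a b; rewrite /cabs /= sqrtr_ge0. Qed.

Lemma cRe_mul (x y : CC) :
  complex.Re (x * y) = complex.Re x * complex.Re y - complex.Im x * complex.Im y.
Proof. by case: x; case: y. Qed.

Lemma cIm_mul (x y : CC) :
  complex.Im (x * y) = complex.Re x * complex.Im y + complex.Im x * complex.Re y.
Proof. by case: x => a b; case: y => c d /=; rewrite addrC [b * c]mulrC. Qed.

Lemma cRe_conj (x : CC) : complex.Re (Num.conj x) = complex.Re x.
Proof. by case: x. Qed.

Lemma cIm_conj (x : CC) : complex.Im (Num.conj x) = - complex.Im x.
Proof. by case: x. Qed.

Lemma cRe_sum I (r : seq I) (P : pred I) (F : I -> CC) :
  complex.Re (\sum_(i <- r | P i) F i) = \sum_(i <- r | P i) complex.Re (F i).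
Proof. exact: raddf_sum. Qed.

Lemma cIm_sum I (r : seq I) (P : pred I) (F : I -> CC) :
  complex.Im (\sum_(i <- r | P i) F i) = \sum_(i <- r | P i) complex.Im (F i).
Proof. exact: raddf_sum. Qed.

Lemma toC_is_real (x : RR) : toC x = x%:C%C. Proof. by []. Qed.

Lemma toCM x y : toC (x * y) = toC x * toC y.
Proof. by rewrite !toC_is_real rmorphM. Qed.

Lemma toCD x y : toC (x + y) = toC x + toC y.
Proof. by rewrite !toC_is_real rmorphD. Qed.

Lemma toCN x : toC (- x) = - toC x.
Proof. by rewrite !toC_is_real rmorphN. Qed.

Lemma conj_toC x : Num.conj (toC x) = toC x.
Proof. by rewrite /toC; apply/eqP; rewrite eq_complex /= oppr0 !eqxx. Qed.

Lemma complex_ext (x y : CC) :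
  complex.Re x = complex.Re y -> complex.Im x = complex.Im y -> x = y.
Proof. by case: x => a b; case: y => c d /= -> ->. Qed.

Lemma mul_conj (z : CC) : Num.conj z * z = toC (cabs z ^+ 2).
Proof.
by apply: complex_ext; rewrite ?cRe_mul ?cIm_mul cRe_conj cIm_conj ?cabs2 /=; ring.
Qed.

Lemma conj_mul (x y : CC) : Num.conj (x * y) = Num.conj x * Num.conj y.
Proof. exact: rmorphM. Qed.

Lemma conj_inv (x : CC) : Num.conj x^-1 = (Num.conj x)^-1.
Proof. exact: fmorphV. Qed.

Lemma cabsM (x y : CC) : cabs (x * y) = cabs x * cabs y.
Proof.
apply/eqP; rewrite -(@eqrXn2 _ 2) ?mulr_ge0 ?cabs_ge0 //; apply/eqP.
by rewrite exprMn !cabs2 cRe_mul cIm_mul; ring.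
Qed.

Lemma cabs_toC x : 0 <= x -> cabs (toC x) = x.
Proof.
by move=> x0; apply/eqP; rewrite -(@eqrXn2 _ 2) ?cabs_ge0 // cabs2 /= expr0n addr0.
Qed.

Lemma cabs0 : cabs 0 = 0.
Proof. exact: (cabs_toC (lexx 0)). Qed.

Lemma cabs_conj z : cabs (Num.conj z) = cabs z.
Proof.
apply/eqP; rewrite -(@eqrXn2 _ 2) ?cabs_ge0 //; apply/eqP.
by rewrite !cabs2 cRe_conj cIm_conj sqrrN.
Qed.

Lemma Re_le_cabs z : complex.Re z <= cabs z.
Proof.
have h := cabs2 z; have h0 := cabs_ge0 z.
by rewrite leNgt; apply/negP => lt; have := sqr_ge0 (complex.Im z); nra.
Qed.

Lemma cabsD x y : cabs (x + y) <= cabs x + cabs y.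
Proof. by have := ler_normD x y; rewrite lecE => /andP[_]; rewrite /cabs; case: `|x| => a b; case: `|y|. Qed.

Lemma cabs_sum I (r : seq I) (P : pred I) (F : I -> CC) :
  cabs (\sum_(i <- r | P i) F i) <= \sum_(i <- r | P i) cabs (F i).
Proof.
elim/big_ind2: _ => [|x a y b h1 h2|//]; first by rewrite cabs0.
exact: le_trans (cabsD _ _) (lerD h1 h2).
Qed.

Section RealInner.
Implicit Types m n k : nat.

Lemma adjE m n (A : 'M[CC]_(m, n)) i j : adj A i j = Num.conj (A j i).
Proof. by rewrite !mxE. Qed.

Lemma adjK m n (A : 'M[CC]_(m, n)) : adj (adj A) = A.
Proof. by apply/matrixP => i j; rewrite !adjE conjCK. Qed.

Lemma adjM m n k (A : 'M[CC]_(m, n)) (B : 'M[CC]_(n, k)) :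
  adj (A *m B) = adj B *m adj A.
Proof. by rewrite /adj map_mxM trmx_mul. Qed.

Lemma adjD m n (A B : 'M[CC]_(m, n)) : adj (A + B) = adj A + adj B.
Proof. by rewrite /adj map_mxD raddfD. Qed.

Lemma adjN m n (A : 'M[CC]_(m, n)) : adj (- A) = - adj A.
Proof. by rewrite /adj map_mxN raddfN. Qed.

Lemma adj_scale m n c (A : 'M[CC]_(m, n)) : adj (c *: A) = Num.conj c *: adj A.
Proof. by rewrite /adj map_mxZ linearZ. Qed.

Lemma adjB m n (A B : 'M[CC]_(m, n)) : adj (A - B) = adj A - adj B.
Proof. by rewrite adjD adjN. Qed.

Lemma adj0 m n : adj (0 : 'M[CC]_(m, n)) = 0.
Proof. by apply/matrixP => i j; rewrite !mxE conjC0. Qed.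

Lemma adj_id m : adj (1%:M : 'M[CC]_m) = 1%:M.
Proof. by apply/matrixP => i j; rewrite !mxE eq_sym conjC_nat. Qed.

Lemma rinnerE m n (A B : 'M[CC]_(m, n)) :
  rinner A B = \sum_i \sum_j complex.Re (Num.conj (A i j) * B i j).
Proof.
rewrite /rinner /mxtrace cRe_sum exchange_big /=; apply: eq_bigr => j _.
by rewrite mxE cRe_sum; apply: eq_bigr => i _; rewrite adjE.
Qed.

Lemma rinnerC m n (A B : 'M[CC]_(m, n)) : rinner A B = rinner B A.
Proof.
rewrite !rinnerE; apply: eq_bigr => i _; apply: eq_bigr => j _.
by rewrite !cRe_mul !cRe_conj !cIm_conj; ring.
Qed.

Lemma rinnerDr m n (A B C : 'M[CC]_(m, n)) :
  rinner A (B + C) = rinner A B + rinner A C.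
Proof. by rewrite /rinner mulmxDr !raddfD. Qed.

Lemma rinnerDl m n (A B C : 'M[CC]_(m, n)) :
  rinner (A + B) C = rinner A C + rinner B C.
Proof. by rewrite ![rinner _ C]rinnerC rinnerDr. Qed.

Lemma rinnerNr m n (A B : 'M[CC]_(m, n)) : rinner A (- B) = - rinner A B.
Proof. by rewrite /rinner mulmxN !raddfN. Qed.

Lemma rinnerNl m n (A B : 'M[CC]_(m, n)) : rinner (- A) B = - rinner A B.
Proof. by rewrite ![rinner _ B]rinnerC rinnerNr. Qed.

Lemma rinnerBr m n (A B C : 'M[CC]_(m, n)) :
  rinner A (B - C) = rinner A B - rinner A C.
Proof. by rewrite rinnerDr rinnerNr. Qed.

Lemma rinnerBl m n (A B C : 'M[CC]_(m, n)) :
  rinner (A - B) C = rinner A C - rinner B C.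
Proof. by rewrite rinnerDl rinnerNl. Qed.

Lemma rinnerZr m n c (A B : 'M[CC]_(m, n)) : rinner A (toC c *: B) = c * rinner A B.
Proof. by rewrite /rinner -scalemxAr linearZ /= cRe_mul /= mul0r subr0. Qed.

Lemma rinnerZl m n c (A B : 'M[CC]_(m, n)) : rinner (toC c *: A) B = c * rinner A B.
Proof. by rewrite ![rinner _ B]rinnerC rinnerZr. Qed.

Lemma rinner0r m n (A : 'M[CC]_(m, n)) : rinner A 0 = 0.
Proof. by rewrite /rinner mulmx0 raddf0. Qed.

Lemma rinner0l m n (A : 'M[CC]_(m, n)) : rinner 0 A = 0.
Proof. by rewrite rinnerC rinner0r. Qed.

Lemma rinner_sumr m n I (r : seq I) (P : pred I) (A : 'M[CC]_(m, n)) F :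
  rinner A (\sum_(i <- r | P i) F i) = \sum_(i <- r | P i) rinner A (F i).
Proof. by apply: (big_morph _ (rinnerDr A) (rinner0r A)). Qed.

Lemma rinner_suml m n I (r : seq I) (P : pred I) (A : 'M[CC]_(m, n)) F :
  rinner (\sum_(i <- r | P i) F i) A = \sum_(i <- r | P i) rinner (F i) A.
Proof. by rewrite rinnerC rinner_sumr; apply: eq_bigr => i _; rewrite rinnerC. Qed.

Lemma rinner_adj m n (A B : 'M[CC]_(m, n)) : rinner (adj A) (adj B) = rinner A B.
Proof.
rewrite !rinnerE exchange_big; apply: eq_bigr => i _; apply: eq_bigr => j _.
by rewrite !adjE conjCK !cRe_mul !cRe_conj !cIm_conj; ring.
Qed.

Lemma rinner_mull m n k (A : 'M[CC]_(m, k)) (B : 'M[CC]_(m, n)) (C : 'M[CC]_(n, k)) :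
  rinner A (B *m C) = rinner (adj B *m A) C.
Proof. by rewrite /rinner adjM adjK mulmxA. Qed.

Lemma rinner_mulr m n k (A : 'M[CC]_(m, k)) (B : 'M[CC]_(m, n)) (C : 'M[CC]_(n, k)) :
  rinner A (B *m C) = rinner (A *m adj C) B.
Proof. by rewrite -rinner_adj adjM rinner_mull -[RHS]rinner_adj adjM. Qed.

Lemma frob2E m n (A : 'M[CC]_(m, n)) : frob2 A = rinner A A.
Proof.
rewrite rinnerE; apply: eq_bigr => i _; apply: eq_bigr => j _.
by rewrite cabs2 cRe_mul cRe_conj cIm_conj; ring.
Qed.

Lemma vnorm2E n (v : 'cV[CC]_n) : vnorm2 v = frob2 v.
Proof. by apply: eq_bigr => i _; rewrite big_ord1. Qed.

Lemma frob2_ge0 m n (A : 'M[CC]_(m, n)) : 0 <= frob2 A.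
Proof. by apply: sumr_ge0 => i _; apply: sumr_ge0 => j _; rewrite sqr_ge0. Qed.

Lemma frob2_entry m n (A : 'M[CC]_(m, n)) i j : cabs (A i j) ^+ 2 <= frob2 A.
Proof.
rewrite /frob2 (bigD1 i) //= (bigD1 j) //= -addrA lerDl addr_ge0 //.
  by apply: sumr_ge0 => k _; rewrite sqr_ge0.
by apply: sumr_ge0 => k _; apply: sumr_ge0 => l _; rewrite sqr_ge0.
Qed.

Lemma cabs_eq0 z : cabs z = 0 -> z = 0.
Proof.
move=> h; have := cabs2 z; rewrite h expr0n /= => /eqP.
rewrite eq_sym paddr_eq0 ?sqr_ge0 // !sqrf_eq0; case: z {h} => a b /=.
by move=> /andP[/eqP-> /eqP->].
Qed.

Lemma frob2_eq0 m n (A : 'M[CC]_(m, n)) : frob2 A = 0 -> A = 0.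
Proof.
move=> A0; apply/matrixP => i j; rewrite mxE; apply: cabs_eq0; apply/eqP.
by rewrite -sqrf_eq0 eq_le sqr_ge0 andbT -A0 frob2_entry.
Qed.

Lemma frob20 m n : frob2 (0 : 'M[CC]_(m, n)) = 0.
Proof. by rewrite frob2E rinner0r. Qed.

Lemma frob2D m n (A B : 'M[CC]_(m, n)) :
  frob2 (A + B) = frob2 A + 2 * rinner A B + frob2 B.
Proof. by rewrite !frob2E rinnerDl !rinnerDr [rinner B A]rinnerC; ring. Qed.

Lemma frob2N m n (A : 'M[CC]_(m, n)) : frob2 (- A) = frob2 A.
Proof. by rewrite !frob2E rinnerNl rinnerNr opprK. Qed.

Lemma frob2B m n (A B : 'M[CC]_(m, n)) :
  frob2 (A - B) = frob2 A - 2 * rinner A B + frob2 B.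
Proof. by rewrite frob2D frob2N rinnerNr; ring. Qed.

Lemma frob2Z m n c (A : 'M[CC]_(m, n)) : frob2 (toC c *: A) = c ^+ 2 * frob2 A.
Proof. by rewrite !frob2E rinnerZl rinnerZr; ring. Qed.

Lemma frob2_adj m n (A : 'M[CC]_(m, n)) : frob2 (adj A) = frob2 A.
Proof. by rewrite !frob2E rinner_adj. Qed.

Lemma frob2D_le m n (A B : 'M[CC]_(m, n)) : frob2 (A + B) <= 2 * (frob2 A + frob2 B).
Proof. by have := frob2_ge0 (A - B); rewrite frob2B frob2D; lra. Qed.

Lemma frob2B_le m n (A B : 'M[CC]_(m, n)) : frob2 (A - B) <= 2 * (frob2 A + frob2 B).
Proof. by have := frob2_ge0 (A + B); rewrite frob2B frob2D; lra. Qed.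

Lemma rinner_ge m n (A B : 'M[CC]_(m, n)) c : 0 < c ->
  - (c * frob2 A + (4 * c)^-1 * frob2 B) <= rinner A B.
Proof.
move=> c0; have := frob2_ge0 (toC (2 * c) *: A + B).
rewrite frob2D frob2Z rinnerZl => h.
have e : 4 * c * (c * frob2 A + (4 * c)^-1 * frob2 B + rinner A B) =
   (2 * c) ^+ 2 * frob2 A + 2 * (2 * c * rinner A B) + frob2 B by field; lra.
rewrite -e in h; move: h; rewrite pmulr_rge0; last by lra.
lra.
Qed.

Lemma rinner_CS m n (A B : 'M[CC]_(m, n)) : rinner A B ^+ 2 <= frob2 A * frob2 B.
Proof.
have [b0|b0] := eqVneq (frob2 B) 0.
  by rewrite (frob2_eq0 b0) rinner0r frob20 mulr0 expr0n.
have bp : 0 < frob2 B by rewrite lt_def b0 frob2_ge0.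
have := frob2_ge0 (toC (frob2 B) *: A - toC (rinner A B) *: B).
rewrite frob2B !frob2Z rinnerZl rinnerZr => h.
have {}h : 0 <= frob2 B * (frob2 A * frob2 B - rinner A B ^+ 2) by nra.
by move: h; rewrite pmulr_rge0 // subr_ge0.
Qed.

Lemma rinner_le_sqrt m n (A B : 'M[CC]_(m, n)) :
  rinner A B <= Num.sqrt (frob2 A) * Num.sqrt (frob2 B).
Proof.
rewrite -sqrtrM ?frob2_ge0 // (le_trans (ler_norm _)) // -sqrtr_sqr.
by rewrite ler_wsqrtr // rinner_CS.
Qed.

Lemma sum_CS (I : finType) (P : pred I) (F G : I -> RR) :
  (\sum_(i | P i) F i * G i) ^+ 2 <=
  (\sum_(i | P i) F i ^+ 2) * (\sum_(i | P i) G i ^+ 2).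
Proof.
set a := \sum_(i | P i) F i ^+ 2; set b := \sum_(i | P i) G i ^+ 2.
set c := \sum_(i | P i) F i * G i.
have b0 : 0 <= b by apply: sumr_ge0 => i _; rewrite sqr_ge0.
have h x y : 0 <= x ^+ 2 * a - 2 * x * y * c + y ^+ 2 * b.
  rewrite [leRHS](_ : _ = \sum_(i | P i) (x * F i - y * G i) ^+ 2).
    by apply: sumr_ge0 => i _; rewrite sqr_ge0.
  rewrite !mulr_sumr -sumrN -!big_split /=; apply: eq_bigr => i _; ring.
have [bz|bz] := eqVneq b 0; last first.
  have bp : 0 < b by rewrite lt_def bz.
  have := h b c => {}h.
  have : 0 <= b * (a * b - c ^+ 2) by nra.
  by rewrite pmulr_rge0 // subr_ge0.
have a0 : 0 <= a by apply: sumr_ge0 => i _; rewrite sqr_ge0.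
have := h c (a + 1); rewrite bz !mulr0 addr0 => {}h.
have : c ^+ 2 * (a + 2) <= 0 by nra.
by rewrite pmulr_lle0 //; lra.
Qed.

Lemma cabs_sum_CS (I : finType) (P : pred I) (F G : I -> CC) :
  cabs (\sum_(i | P i) F i * G i) ^+ 2 <=
  (\sum_(i | P i) cabs (F i) ^+ 2) * (\sum_(i | P i) cabs (G i) ^+ 2).
Proof.
apply: le_trans (sum_CS P (fun i => cabs (F i)) (fun i => cabs (G i))).
rewrite lerXn2r ?nnegrE ?cabs_ge0 ?sumr_ge0 //; first by move=> i _; rewrite mulr_ge0 ?cabs_ge0.
by rewrite (le_trans (cabs_sum _ _ _)) //; apply: ler_sum => i _; rewrite cabsM.
Qed.

Lemma frob2M m n k (A : 'M[CC]_(m, n)) (B : 'M[CC]_(n, k)) :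
  frob2 (A *m B) <= frob2 A * frob2 B.
Proof.
rewrite /frob2 mulr_suml; apply: ler_sum => i _.
rewrite [X in _ * X]exchange_big mulr_sumr /=; apply: ler_sum => j _.
by rewrite mxE; apply: cabs_sum_CS.
Qed.

Lemma frob2_isoM m n k (U : 'M[CC]_(m, n)) (A : 'M[CC]_(n, k)) :
  adj U *m U = 1%:M -> frob2 (U *m A) = frob2 A.
Proof. by move=> h; rewrite frob2E rinner_mull mulmxA h mul1mx frob2E. Qed.

Lemma frob2_Miso m n k (V : 'M[CC]_(m, n)) (A : 'M[CC]_(k, n)) :
  adj V *m V = 1%:M -> frob2 (A *m adj V) = frob2 A.
Proof. by move=> h; rewrite -frob2_adj adjM adjK frob2_isoM // frob2_adj. Qed.

End RealInner.

(** * The Hankel map *)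

Section HankelBasics.
Variables n1 n2 : nat.
Hypotheses (n1_gt0 : (0 < n1)%N) (n2_gt0 : (0 < n2)%N).
Local Notation N := (n1 + n2).-1.
Local Notation onanti i := (fun ab : 'I_n1 * 'I_n2 => (ab.1 + ab.2 == i :> nat)%N).
Implicit Types (x y : 'cV[CC]_N) (M Z : 'M[CC]_(n1, n2)) (i : 'I_N).

Lemma vsigE (i : nat) : vsig n1 n2 i = #|onanti i|.
Proof.
apply: eq_card => ab; rewrite [RHS]unfold_in.
by apply/idP/idP; rewrite in_setE.
Qed.

Lemma sum_antidiag (V : nmodType) (i : nat) (F : 'I_n1 -> 'I_n2 -> V) :
  \sum_(a < n1) \sum_(b < n2 | (a + b == i)%N) F a b =
  \sum_(ab | onanti i ab) F ab.1 ab.2.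
Proof. by rewrite pair_big_dep. Qed.

Lemma sum_antidiags (V : nmodType) (F : 'I_n1 -> 'I_n2 -> V) :
  \sum_(i < N) \sum_(ab | onanti i ab) F ab.1 ab.2 = \sum_a \sum_b F a b.
Proof.
rewrite pair_big /= (exchange_big_dep xpredT) //=; apply: eq_bigr => -[a b] _ /=.
have lt : (a + b < N)%N by case: a b => a /= ? [b /= ?]; lia.
by rewrite (big_pred1 (Ordinal lt)).
Qed.

Lemma vsig_gt0 i : (0 < vsig n1 n2 i)%N.
Proof.
rewrite vsigE; apply/card_gt0P.
have h1 : (minn i n1.-1 < n1)%N by case: i => i /=; lia.
have h2 : (i - minn i n1.-1 < n2)%N by case: i {h1} => i /=; lia.
exists (Ordinal h1, Ordinal h2); rewrite unfold_in /=; apply/eqP.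
by case: i {h1 h2} => i /=; lia.
Qed.

Lemma vsigR_gt0 i : 0 < (vsig n1 n2 i)%:R :> RR.
Proof. by rewrite ltr0n vsig_gt0. Qed.

Lemma sqvs_conj (i : nat) : Num.conj (sqvs n1 n2 i) = sqvs n1 n2 i.
Proof. exact: conj_toC. Qed.

Lemma sqvs_sqr (i : nat) : sqvs n1 n2 i * sqvs n1 n2 i = toC (vsig n1 n2 i)%:R.
Proof. by rewrite /sqvs -toCM -expr2 sqr_sqrtr. Qed.

Lemma sqvs_neq0 i : sqvs n1 n2 i != 0.
Proof.
apply/eqP => h; have := sqvs_sqr i; rewrite h mul0r => /(congr1 (@complex.Re RR)) /= /eqP.
by rewrite eq_sym gt_eqF // vsigR_gt0.
Qed.

Lemma cabs_divsq i (z : CC) : cabs (z / sqvs n1 n2 i) ^+ 2 = cabs z ^+ 2 / (vsig n1 n2 i)%:R.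
Proof.
apply: (canRL (mulfK _)); first by rewrite gt_eqF // vsigR_gt0.
have e : cabs (sqvs n1 n2 i) ^+ 2 = (vsig n1 n2 i)%:R.
  by rewrite cabs_toC ?sqrtr_ge0 // sqr_sqrtr.
by rewrite -e -exprMn -cabsM divfK // sqvs_neq0.
Qed.

Lemma ord_sumP (a : 'I_n1) (b : 'I_n2) : (a + b < N)%N.
Proof. by case: a b => a ? [b ?] /=; lia. Qed.

Lemma hankelE x a b : hankel n1 n2 x a b = x (Ordinal (ord_sumP a b)) 0.
Proof.
by rewrite mxE (big_pred1 (Ordinal (ord_sumP a b))).
Qed.

Lemma rinner_hankel x M :
  rinner (hankel n1 n2 x) M =
  \sum_i complex.Re (Num.conj (x i 0) * \sum_(ab | onanti i ab) M ab.1 ab.2).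
Proof.
rewrite rinnerE -sum_antidiags; apply: eq_bigr => i _.
rewrite mulr_sumr cRe_sum; apply: eq_bigr => -[a b] /= /eqP e.
by rewrite hankelE; congr (complex.Re (Num.conj (x _ _) * _)); apply: val_inj.
Qed.

Lemma GadjE M i : Gadj n1 n2 M i 0 = (\sum_(ab | onanti i ab) M ab.1 ab.2) / sqvs n1 n2 i.
Proof. by rewrite mxE sum_antidiag. Qed.

Lemma rinner_Gop x M : rinner (Gop n1 n2 x) M = rinner x (Gadj n1 n2 M).
Proof.
rewrite /Gop rinner_hankel [RHS]rinnerE; apply: eq_bigr => i _.
rewrite big_ord1 GadjE mxE; congr (complex.Re _).
by rewrite conj_mul conj_inv sqvs_conj -!mulrA [X in _ * X]mulrC.
Qed.

(** Antidiagonal i has [vsig i] entries, each x_i / sqrt(vsig i), and [Gadj] divides their sum by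
    sqrt(vsig i) once more. So G is an isometry, and [nonhankel] is the orthogonal projector onto
    the complement of the Hankel matrices. *)
Lemma Gadj_Gop x : Gadj n1 n2 (Gop n1 n2 x) = x.
Proof.
apply/colP => i; rewrite GadjE /Gop.
rewrite (eq_bigr (fun=> x i 0 / sqvs n1 n2 i)); last first.
  move=> [a b] /= /eqP e; rewrite hankelE mxE.
  have -> : Ordinal (ord_sumP a b) = i by apply: val_inj.
  by [].
rewrite sumr_const -vsigE -mulr_natr -mulrA -mulrA mulrC -[X in _ = X]mul1r; congr (_ * _).
have -> : (vsig n1 n2 i)%:R = sqvs n1 n2 i * sqvs n1 n2 i.
  by rewrite sqvs_sqr toC_is_real rmorph_nat.
by field; rewrite sqvs_neq0.
Qed.

Lemma DinvD x y : Dinv n1 n2 (x + y) = Dinv n1 n2 x + Dinv n1 n2 y.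
Proof. by apply/colP => i; rewrite !mxE mulrDl. Qed.

Lemma DopK x : Dinv n1 n2 (Dop n1 n2 x) = x.
Proof. by apply/colP => i; rewrite !mxE mulrC mulKf // sqvs_neq0. Qed.

Lemma Gop_Dop x : Gop n1 n2 (Dop n1 n2 x) = hankel n1 n2 x.
Proof. by rewrite /Gop DopK. Qed.

Lemma hankelD x y : hankel n1 n2 (x + y) = hankel n1 n2 x + hankel n1 n2 y.
Proof. by apply/matrixP => a b; rewrite [RHS]mxE !hankelE mxE. Qed.

Lemma hankelZ c x : hankel n1 n2 (c *: x) = c *: hankel n1 n2 x.
Proof. by apply/matrixP => a b; rewrite [RHS]mxE !hankelE mxE. Qed.

Lemma GopD x y : Gop n1 n2 (x + y) = Gop n1 n2 x + Gop n1 n2 y.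
Proof. by rewrite /Gop DinvD hankelD. Qed.

Lemma DinvZ c x : Dinv n1 n2 (c *: x) = c *: Dinv n1 n2 x.
Proof. by apply/colP => i; rewrite !mxE mulrA. Qed.

Lemma GopZ c x : Gop n1 n2 (c *: x) = c *: Gop n1 n2 x.
Proof. by rewrite /Gop DinvZ hankelZ. Qed.

Lemma GadjD M Z : Gadj n1 n2 (M + Z) = Gadj n1 n2 M + Gadj n1 n2 Z.
Proof.
apply/colP => i; rewrite [RHS]mxE !GadjE -mulrDl -big_split /=; congr (_ / _).
by apply: eq_bigr => ab _; rewrite mxE.
Qed.

Lemma GadjZ c M : Gadj n1 n2 (c *: M) = c *: Gadj n1 n2 M.
Proof.
apply/colP => i; rewrite [RHS]mxE !GadjE mulrA mulr_sumr; congr (_ / _).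
by apply: eq_bigr => ab _; rewrite mxE.
Qed.

Lemma GadjN M : Gadj n1 n2 (- M) = - Gadj n1 n2 M.
Proof. by rewrite -scaleN1r GadjZ scaleN1r. Qed.

Lemma GadjB M Z : Gadj n1 n2 (M - Z) = Gadj n1 n2 M - Gadj n1 n2 Z.
Proof. by rewrite GadjD GadjN. Qed.

Lemma GopN x : Gop n1 n2 (- x) = - Gop n1 n2 x.
Proof. by rewrite -scaleN1r GopZ scaleN1r. Qed.

Lemma Gadj_sum_cabs M i :
  cabs (Gadj n1 n2 M i 0) ^+ 2 <=
  (\sum_(ab | onanti i ab) cabs (M ab.1 ab.2)) ^+ 2 / (vsig n1 n2 i)%:R.
Proof.
rewrite GadjE cabs_divsq ler_wpM2r ?invr_ge0 ?ler0n //.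
rewrite lerXn2r ?nnegrE ?cabs_ge0 ?sumr_ge0 //; last exact: cabs_sum.
by move=> ab _; exact: cabs_ge0.
Qed.

Lemma Gadj_entry_le M i :
  cabs (Gadj n1 n2 M i 0) ^+ 2 <= \sum_(ab | onanti i ab) cabs (M ab.1 ab.2) ^+ 2.
Proof.
apply: le_trans (Gadj_sum_cabs M i) _; rewrite ler_pdivrMr ?vsigR_gt0 //.
have := sum_CS (onanti i) (fun ab => cabs (M ab.1 ab.2)) (fun=> 1).
rewrite (eq_bigr (fun ab : 'I_n1 * 'I_n2 => cabs (M ab.1 ab.2))); last by move=> *; rewrite mulr1.
by rewrite [X in _ <= _ * X]sumr_const expr1n -vsigE.
Qed.

Definition nonhankel M := M - Gop n1 n2 (Gadj n1 n2 M).

Lemma rinner_nonhankel M Z :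
  rinner (nonhankel M) (nonhankel Z) = rinner M Z - rinner (Gadj n1 n2 M) (Gadj n1 n2 Z).
Proof.
rewrite /nonhankel !rinnerBl !rinnerBr !rinner_Gop Gadj_Gop.
by rewrite [rinner M (Gop _ _ _)]rinnerC rinner_Gop [X in _ - X - _]rinnerC; ring.
Qed.

Lemma frob2_nonhankel M : frob2 (nonhankel M) = frob2 M - frob2 (Gadj n1 n2 M).
Proof. by rewrite !frob2E rinner_nonhankel. Qed.

Lemma nonhankelD M Z : nonhankel (M + Z) = nonhankel M + nonhankel Z.
Proof. by rewrite /nonhankel GadjD GopD opprD addrACA. Qed.

Lemma nonhankelN M : nonhankel (- M) = - nonhankel M.
Proof. by rewrite /nonhankel GadjN GopN opprD. Qed.

Lemma nonhankelZ c M : nonhankel (c *: M) = c *: nonhankel M.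
Proof. by rewrite /nonhankel GadjZ GopZ scalerBr. Qed.

Lemma nonhankel_hankel x : nonhankel (hankel n1 n2 x) = 0.
Proof. by rewrite /nonhankel -Gop_Dop Gadj_Gop subrr. Qed.

Definition gvec i : 'M[CC]_(n1, n2) := Gop n1 n2 (delta_mx i 0).

Lemma gvecE i a b : gvec i a b = if (a + b == i :> nat)%N then (sqvs n1 n2 i)^-1 else 0.
Proof.
rewrite /gvec /Gop hankelE !mxE eqxx andbT.
have -> : (Ordinal (ord_sumP a b) == i) = (a + b == i :> nat)%N by [].
by case: eqP => [/= ->|_]; rewrite ?mul1r ?mul0r.
Qed.

Lemma Gadj_gvec M i : Gadj n1 n2 M i 0 = \tr (adj (gvec i) *m M).
Proof.
rewrite GadjE /mxtrace mulr_suml -(sum_antidiag i (fun a b => M a b / sqvs n1 n2 i)) (exchange_big_dep xpredT) //=.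
apply: eq_bigr => b _; rewrite mxE big_mkcond /=; apply: eq_bigr => a _.
rewrite adjE gvecE; case: ifP => _; last by rewrite conjC0 mul0r.
by rewrite conj_inv sqvs_conj mulrC.
Qed.

End HankelBasics.

(** * A Bernstein inequality in the Frobenius norm *)

Lemma ler_of_derive_ge0 (f g : RR -> RR) :
  (forall x, is_derive (x : RR^o) (1 : RR^o) (f : RR^o -> RR^o) (g x)) ->
  (forall x, 0 <= x -> 0 <= g x) ->
  forall x y, 0 <= x -> x <= y -> f x <= f y.
Proof.
move=> fg g0 x y x0 xy.
apply: (@ger0_derive1_ndecry _ f 0) => // [z|].
- by rewrite in_itv /= andbT => /ltW z0; rewrite derive1E (@derive_val _ _ _ _ _ _ _ (fg z)) g0.
- by apply: derivable_within_continuous => z _; have [] := fg z.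
Qed.

Definition chx (x : RR) : RR := (expR x + expR (- x)) / 2.
Definition shx (x : RR) : RR := (expR x - expR (- x)) / 2.

Lemma chxD x y : chx (x + y) = chx x * chx y + shx x * shx y.
Proof. by rewrite /chx /shx opprD !exp.expRD; field. Qed.

Lemma chxB x y : chx (x - y) = chx x * chx y - shx x * shx y.
Proof. by rewrite /chx /shx opprD !exp.expRD opprK; field. Qed.

Lemma chxN x : chx (- x) = chx x.
Proof. by rewrite /chx opprK addrC. Qed.

Lemma chx_norm x : chx `|x| = chx x.
Proof. by case: (ger0P x) => _; rewrite ?chxN. Qed.

Lemma shx_ge0 x : 0 <= x -> 0 <= shx x.
Proof.
by move=> x0; rewrite /shx divr_ge0 // subr_ge0 ler_expR; lra.
Qed.

Lemma chx_ge1 x : 1 <= chx x.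
Proof.
rewrite /chx; have := expR_ge1Dx x; have := expR_ge1Dx (- x); lra.
Qed.

Lemma shx_le_chx x : shx x <= chx x.
Proof. by rewrite /shx /chx; have := expR_gt0 (- x); lra. Qed.

Lemma chx_shx x : chx x + shx x = expR x.
Proof. by rewrite /shx /chx; field. Qed.

Lemma expR_half_le_chx x : expR x / 2 <= chx x.
Proof. by rewrite /chx; have := expR_gt0 (- x); lra. Qed.

Lemma is_derive_shx (x : RR) : is_derive (x : RR^o) (1 : RR^o) (shx : RR^o -> RR^o) (chx x).
Proof.
rewrite /shx /chx.
have -> : (fun x : RR^o => (expR x - expR (- x)) / 2 : RR^o) =
  (fun x : RR^o => (2^-1 : RR) *: (expR x - (expR \o (fun y => - y)) x)).
  by apply/funext => y /=; rewrite mulrC.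
apply: is_derive_eq; rewrite /= /GRing.scale /=; by field.
Qed.

Lemma is_derive_chx (x : RR) : is_derive (x : RR^o) (1 : RR^o) (chx : RR^o -> RR^o) (shx x).
Proof.
rewrite /shx /chx.
have -> : (fun x : RR^o => (expR x + expR (- x)) / 2 : RR^o) =
  (fun x : RR^o => (2^-1 : RR) *: (expR x + (expR \o (fun y => - y)) x)).
  by apply/funext => y /=; rewrite mulrC.
apply: is_derive_eq; rewrite /= /GRing.scale /=; by field.
Qed.

Lemma shx_ge x : 0 <= x -> x <= shx x.
Proof.
move=> x0; rewrite -subr_ge0.
have -> : 0 = shx 0 - 0 :> RR by rewrite subr0 /shx oppr0 subrr mul0r.
apply: (@ler_of_derive_ge0 (fun t => shx t - t) (fun t => chx t - 1)) => // [y|y _].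
  by have := is_derive_shx y => ?; apply: is_derive_eq.
by rewrite subr_ge0 chx_ge1.
Qed.

Lemma shx_le_mul_chx x : 0 <= x -> shx x <= x * chx x.
Proof.
move=> x0; rewrite -subr_ge0.
have -> : 0 = 0 * chx 0 - shx 0 :> RR by rewrite mul0r /shx oppr0 subrr mul0r subr0.
apply: (@ler_of_derive_ge0 (fun t => t * chx t - shx t) (fun t => t * shx t)) => // [y|y y0].
  have := is_derive_shx y => ?; have := is_derive_chx y => ?.
  by apply: is_derive_eq; rewrite /GRing.scale /=; ring.
by rewrite mulr_ge0 // shx_ge0.
Qed.

(** Write y = x + h, expand sinh (x + h), and use sinh h >= h and sinh x <= x cosh x. In quotient
    form this is the monotonicity of sinh x / x. *)
Lemma shx_ratio x y : 0 <= x -> x <= y -> shx x * y <= shx y * x.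
Proof.
move=> x0 xy; have [h h0 ->] : exists2 h, 0 <= h & y = x + h.
  by exists (y - x); [lra | ring].
have -> : shx (x + h) = shx x * chx h + chx x * shx h.
  by rewrite /shx /chx opprD !exp.expRD; field.
have := shx_ge h0; have := chx_ge1 h; have := chx_ge1 x.
have := shx_le_mul_chx x0; have := shx_ge0 x0 => h1 h2 h3 h4 h5.
have : shx x * h <= x * chx x * h by rewrite ler_wpM2r.
have : shx x * x * 1 <= shx x * x * chx h by rewrite ler_wpM2l // mulr_ge0.
have : chx x * x * h <= chx x * x * shx h by rewrite ler_wpM2l // mulr_ge0 //; lra.
lra.
Qed.

(** Since cosh t - cosh x = 2 sinh ((t + x)/2) sinh ((t - x)/2) and sinh u / u increases, cosh has
    increasing chord slopes as a function of the square of its argument. It is thus convex in that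
    variable, which is what suits squared norms. *)
Lemma chx_chord x z y : 0 <= x -> x <= z -> z <= y ->
  (chx z - chx x) * (y ^+ 2 - x ^+ 2) <= (chx y - chx x) * (z ^+ 2 - x ^+ 2).
Proof.
move=> x0 xz zy.
have e t : chx t - chx x = 2 * shx ((t + x) / 2) * shx ((t - x) / 2).
  rewrite -[t in LHS](_ : (t + x) / 2 + (t - x) / 2 = t); last by field.
  rewrite -[x in X in _ - X](_ : (t + x) / 2 - (t - x) / 2 = x); last by field.
  by rewrite chxB chxD; ring.
rewrite !e.
have h1 := @shx_ratio ((z + x) / 2) ((y + x) / 2) ltac:(lra) ltac:(lra).
have h2 := @shx_ratio ((z - x) / 2) ((y - x) / 2) ltac:(lra) ltac:(lra).
have h3 : 0 <= shx ((z + x) / 2) by apply: shx_ge0; lra.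
have h4 : 0 <= shx ((z - x) / 2) by apply: shx_ge0; lra.
have := ler_pM (mulr_ge0 h3 _) (mulr_ge0 h4 _) h1 h2 => /(_ ltac:(lra) ltac:(lra)) h.
have e1 : y ^+ 2 - x ^+ 2 = 4 * ((y + x) / 2 * ((y - x) / 2)) by field.
have e2 : z ^+ 2 - x ^+ 2 = 4 * ((z + x) / 2 * ((z - x) / 2)) by field.
rewrite e1 e2; lra.
Qed.

Lemma expR_le_quadratic (b : RR) : 0 <= b <= 1 / 2 -> expR b - b <=  1 + 2 * b ^+ 2.
Proof.
move=> /andP[b0 b1].
have := expR_ge1Dx (- b); rewrite expRN => h.
have : expR b * (1 - b) <= 1.
  rewrite -[leRHS](@mulfV _ (expR b)) ?gt_eqF ?expR_gt0 // ler_wpM2l //.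
have := expR_gt0 b; move: (expR b) h => e h e0 h1.
have : (1 - b) * (e - b - 1 - 2 * b ^+ 2) <= 0 by nra.
by rewrite pmulr_rle0; lra.
Qed.

(** Here z^2 is affine in r and runs from (a - b)^2 to (a + b)^2, so convexity in z^2 puts cosh z
    below the chord cosh a cosh b + sinh a sinh b r / (a b). Replacing sinh b by b in the linear
    term costs at most cosh a (sinh b - b), and cosh b + sinh b - b = e^b - b <= 1 + 2 b^2. *)
Lemma chx_increment_real (a b z r : RR) :
  0 <= a -> 0 <= b -> b <= 1 / 2 -> 0 <= z ->
  z ^+ 2 = a ^+ 2 + 2 * r + b ^+ 2 -> `|r| <= a * b ->
  chx z <= chx a * (1 + 2 * b ^+ 2) + shx a / a * r.
Proof.
move=> a0 b0 b1 z0 z2 rab.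
have [rl ru] : - (a * b) <= r /\ r <= a * b by move: rab; rewrite ler_norml => /andP[].
have cha := chx_ge1 a.
have eb : expR b - b <= 1 + 2 * b ^+ 2 by apply: expR_le_quadratic; rewrite b0 b1.
rewrite -chx_shx in eb.
have sa := shx_ge0 a0; have sc := shx_le_chx a; have sb := shx_ge b0.
(* The chord degenerates when a or b vanishes. For a = 0 the slope [shx a / a] is 0 because division
   by zero yields 0, and r = 0. *)
have [az|an] := eqVneq a 0.
  have zb : z = b.
    apply/eqP; rewrite -(@eqrXn2 _ 2) // z2 az; apply/eqP.
    have : r = 0 by move: rl ru; rewrite az mul0r; lra.
    by move=> ->; rewrite expr0n mulr0 !add0r.
  rewrite zb az invr0 mulr0 mul0r addr0.
  have -> : chx 0 = 1 by rewrite /chx oppr0 exp.expR0; field.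
  by move: sb eb; lra.
have ap : 0 < a by rewrite lt_def an.
have [bz|bn] := eqVneq b 0.
  have rz : r = 0 by move: rl ru; rewrite bz mulr0; lra.
  have -> : z = a.
    by apply/eqP; rewrite -(@eqrXn2 _ 2) // z2 bz rz expr0n mulr0 !addr0.
  by rewrite bz rz expr0n !mulr0 !addr0 mulr1.
have bp : 0 < b by rewrite lt_def bn.
have lo : `|a - b| <= z.
  by rewrite -(@ler_pXn2r _ 2) ?nnegrE // real_normK ?num_real // z2; nra.
have hi : z <= a + b.
  by rewrite -(@ler_pXn2r _ 2) ?nnegrE ?addr_ge0 // z2; nra.
have := chx_chord (normr_ge0 _) lo hi; rewrite chx_norm real_normK ?num_real // z2.
rewrite (chxD a b) (chxB a b) => h.
have ab : 0 < a * b by rewrite mulr_gt0.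
have h2 : chx z * (a * b) <= chx a * chx b * (a * b) + shx a * shx b * r by nra.
have key : shx a * (shx b - b) * r <= chx a * (shx b - b) * (a * b).
  have t0 : 0 <= shx b - b by lra.
  have : shx a * (shx b - b) * r <= shx a * (shx b - b) * (a * b).
    by rewrite ler_wpM2l // mulr_ge0.
  by move=> /le_trans; apply; rewrite ler_wpM2r ?(ltW ab) // ler_wpM2r.
have fin : chx a * (chx b + shx b - b) * (a * b) <= chx a * (1 + 2 * b ^+ 2) * (a * b).
  by rewrite ler_wpM2r ?(ltW ab) // ler_wpM2l //; lra.
rewrite -(ler_pM2r ab).
have -> : (chx a * (1 + 2 * b ^+ 2) + shx a / a * r) * (a * b) =
  chx a * (1 + 2 * b ^+ 2) * (a * b) + shx a * b * r by field.
lra.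
Qed.

(* The slope sinh |s| / |s| makes the correction linear in x, so that it
   averages out when x is a centred random increment (Pinelis). *)
Lemma chx_increment m n (s x : 'M[CC]_(m, n)) :
  Num.sqrt (frob2 x) <= 1 / 2 ->
  chx (Num.sqrt (frob2 (s + x))) <=
  chx (Num.sqrt (frob2 s)) * (1 + 2 * frob2 x)
  + shx (Num.sqrt (frob2 s)) / Num.sqrt (frob2 s) * rinner s x.
Proof.
move=> b1; rewrite -[X in 2 * X](sqr_sqrtr (frob2_ge0 x)).
apply: chx_increment_real; rewrite ?sqrtr_ge0 //.
  by rewrite !sqr_sqrtr ?frob2_ge0 // frob2D.
rewrite -(@ler_pXn2r _ 2) ?nnegrE ?mulr_ge0 ?sqrtr_ge0 //.
by rewrite real_normK ?num_real // exprMn !sqr_sqrtr ?frob2_ge0 // rinner_CS.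
Qed.

Lemma norm_inv_sub1 (p : RR) : 0 < p <= 1 -> `|1 / p - 1| <= p^-1.
Proof.
case/andP=> p0 p1; have : 1 <= p^-1 by rewrite invf_ge1.
by rewrite div1r => h; rewrite ger0_norm; lra.
Qed.

Lemma normN1_inv (p : RR) : 0 < p <= 1 -> `|- 1| <= p^-1.
Proof. by case/andP=> p0 p1; rewrite normrN1 invf_ge1. Qed.

(** The coin with value 1/p - 1 with probability p and -1 otherwise has mean 0, which removes the
    term in r, and variance (1 - p)/p, which is at most 1/p. *)
Lemma bernoulli_mix (p C F S r a0 a1 : RR) : 0 < p <= 1 -> 1 <= C -> 0 <= F ->
  a0 <= C * (1 + 2 * ((- 1) ^+ 2 * F)) + S * (- 1 * r) ->
  a1 <= C * (1 + 2 * ((1 / p - 1) ^+ 2 * F)) + S * ((1 / p - 1) * r) ->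
  p * a1 + (1 - p) * a0 <= C * (1 + 2 / p * F).
Proof.
case/andP=> p0 p1 C1 F0 h0 h1; have q0 : 0 <= 1 - p by lra.
apply: le_trans (lerD (ler_wpM2l (ltW p0) h1) (ler_wpM2l q0 h0)) _.
rewrite -subr_ge0 [leRHS](_ : _ = 2 * C * F); last by field; rewrite gt_eqF.
by rewrite !mulr_ge0 //; lra.
Qed.

Lemma ler_lincomb (p q x y a b P : RR) : 0 <= p -> 0 <= q ->
  x <= a * P -> y <= b * P -> p * x + q * y <= (p * a + q * b) * P.
Proof.
by move=> p0 q0 hx hy; rewrite mulrDl -!mulrA lerD // ler_wpM2l.
Qed.

Section Bernoulli.
Variables (I : finType) (p : RR).
Hypothesis p01 : 0 < p <= 1.

(** The index set J is a parameter so that expectations over the random subset can be treated one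
    coin at a time, by induction on the size of J. *)
Definition bexp_on (J : {set I}) (f : {set I} -> RR) : RR :=
  \sum_(A : {set I} | A \subset J) p ^+ #|A| * (1 - p) ^+ (#|J| - #|A|) * f A.

Lemma bexp_on0 f : bexp_on finset.set0 f = f finset.set0.
Proof.
rewrite /bexp_on (big_pred1 finset.set0); first by rewrite !cards0 !expr0 !mul1r.
by move=> A; rewrite finset.subset0.
Qed.

(** Conditioning on the coin of j; independence of the samples enters through this identity. *)
Lemma bexp_onU1 j (J : {set I}) f : j \notin J ->
  bexp_on (j |: J) f = p * bexp_on J (fun A => f (j |: A)) + (1 - p) * bexp_on J f.
Proof.
move=> jJ; rewrite /bexp_on (bigID (fun A : {set I} => j \in A)) /=; congr (_ + _).
  rewrite (reindex_onto (fun A : {set I} => j |: A) (fun A : {set I} => A :\ j)) /=; last first.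
    by move=> A /andP[_ jA]; rewrite finset.setD1K.
  rewrite mulr_sumr; apply: eq_big => [A|A /andP[/andP[AJ _] /eqP e]].
    rewrite finset.setU11 andbT; apply/andP/idP => [[AJ /eqP e]|AJ].
      rewrite -e finset.subDset; exact: AJ.
    by rewrite finset.setUS // finset.setU1K //; apply: contra jJ => /(fintype.subsetP AJ).
  have jA : j \notin A by rewrite -e finset.setD11.
  by rewrite !cardsU1 jA jJ /= !add1n subSS exprS !mulrA.
rewrite mulr_sumr; apply: eq_big => [A|A /andP[AJ jA]].
  apply/andP/idP => [[AJ jA]|AJ].
    by apply/fintype.subsetP => x xA; have := fintype.subsetP AJ _ xA; rewrite !inE => /orP[/eqP xj|//]; rewrite -xj xA in jA.
  split; first by rewrite (fintype.subset_trans AJ) // finset.subsetUr.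
  by apply: contra jJ => /(fintype.subsetP AJ).
have AJ' : A \subset J.
  by apply/fintype.subsetP => x xA; have := fintype.subsetP AJ _ xA; rewrite !inE => /orP[/eqP xj|//]; rewrite -xj xA in jA.
rewrite cardsU1 jJ /= add1n subSn ?subset_leq_card // exprS; ring.
Qed.

Lemma eq_bexp_on (J : {set I}) (f g : {set I} -> RR) : (forall A : {set I}, A \subset J -> f A = g A) ->
  bexp_on J f = bexp_on J g.
Proof. by move=> fg; apply: eq_bigr => A AJ; rewrite fg. Qed.

Definition bw (A : {set I}) (i : I) : RR := (i \in A)%:R / p - 1.

(** Conditioning on one coin j moves the starting point s by w_j X_j; the induction holds for every
    start, and averaging over the coin cancels the linear correction of [chx_increment]. As |w_j| <=
    1/p, the bound p/2 on the norms keeps each increment below 1/2. *)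
Lemma bexp_chx m n (X : I -> 'M[CC]_(m, n)) (J : {set I}) (s : 'M[CC]_(m, n)) :
  (forall i, Num.sqrt (frob2 (X i)) <= p / 2) ->
  bexp_on J (fun A => chx (Num.sqrt (frob2 (s + \sum_(i in J) toC (bw A i) *: X i)))) <=
  chx (Num.sqrt (frob2 s)) * \prod_(i in J) (1 + 2 / p * frob2 (X i)).
Proof.
case/andP: p01 => p0 p1 Xb; move: {2}#|J| (erefl #|J|) => k.
elim: k J s => [|k IH] J s cJ.
  by rewrite (cards0_eq cJ) bexp_on0 !big_set0 addr0 mulr1.
have [j jJ] : exists j, j \in J by apply/card_gt0P; rewrite cJ.
have jD : j \notin J :\ j by rewrite finset.setD11.
have cD : #|J :\ j| = k by apply/eqP; rewrite -eqSS -cJ (cardsD1 j J) jJ.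
pose Y1 := toC (1 / p - 1) *: X j; pose Y0 := toC (- 1) *: X j.
have e1 (A : {set I}) : s + \sum_(i in J) toC (bw (j |: A) i) *: X i =
    s + Y1 + \sum_(i in J :\ j) toC (bw A i) *: X i.
  rewrite (big_setD1 j jJ) /= addrA /Y1 {1}/bw finset.setU11; congr (_ + _).
  apply: eq_bigr => i; rewrite !inE => /andP[ij _].
  by rewrite /bw !inE (negbTE ij).
have e0 (A : {set I}) : A \subset J :\ j ->
    s + \sum_(i in J) toC (bw A i) *: X i =
    s + Y0 + \sum_(i in J :\ j) toC (bw A i) *: X i.
  move=> AJ; have jA : j \notin A by apply: contra jD => /(fintype.subsetP AJ).
  by rewrite (big_setD1 j jJ) /= addrA /Y0 {1}/bw (negbTE jA) mul0r sub0r.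
pose f1 A := chx (Num.sqrt (frob2 (s + Y1 + \sum_(i in J :\ j) toC (bw A i) *: X i))).
pose f0 A := chx (Num.sqrt (frob2 (s + Y0 + \sum_(i in J :\ j) toC (bw A i) *: X i))).
set f := fun A => _.
have -> : bexp_on J f = p * bexp_on (J :\ j) f1 + (1 - p) * bexp_on (J :\ j) f0.
  have E1 : bexp_on (J :\ j) (fun A => f (j |: A)) = bexp_on (J :\ j) f1.
    by apply: eq_bexp_on => A _; rewrite /f e1.
  have E0 : bexp_on (J :\ j) f = bexp_on (J :\ j) f0.
    by apply: eq_bexp_on => A AJ; rewrite /f e0.
  apply: etrans (congr2 (fun x y => p * x + (1 - p) * y) E1 E0).
  exact: etrans (congr1 (bexp_on^~ f) (esym (finset.setD1K jJ))) (bexp_onU1 f jD).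
rewrite (big_setD1 j jJ) /=.
have h1 : bexp_on (J :\ j) f1 <= _ := IH _ (s + Y1) cD.
have h0 : bexp_on (J :\ j) f0 <= _ := IH _ (s + Y0) cD.
set P := \prod_(i in J :\ j) _ in h1 h0 *.
have P0 : 0 <= P.
  by apply: prodr_ge0 => i _; rewrite addr_ge0 // mulr_ge0 ?frob2_ge0 // divr_ge0 // ltW.
have inc c : `|c| <= p^-1 -> chx (Num.sqrt (frob2 (s + toC c *: X j))) <=
    chx (Num.sqrt (frob2 s)) * (1 + 2 * (c ^+ 2 * frob2 (X j))) +
    shx (Num.sqrt (frob2 s)) / Num.sqrt (frob2 s) * (c * rinner s (X j)).
  move=> cp; rewrite -frob2Z -rinnerZr; apply: chx_increment.
  rewrite frob2Z sqrtrM ?sqr_ge0 // sqrtr_sqr.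
  apply: le_trans (ler_pM (normr_ge0 _) (sqrtr_ge0 _) cp (Xb j)) _.
  by rewrite mulrA mulVf ?gt_eqF // div1r mul1r.
have := inc (1 / p - 1) (norm_inv_sub1 p01); have := inc (- 1) (normN1_inv p01).
move=> /(bernoulli_mix p01 (chx_ge1 (Num.sqrt (frob2 s))) (frob2_ge0 (X j))) mix /mix {mix}.
move=> /(ler_wpM2r P0) mix; rewrite mulrA; apply: le_trans mix.
have q0 : 0 <= 1 - p by rewrite subr_ge0.
exact: (ler_lincomb (ltW p0) q0 h1 h0).
Qed.

Lemma bexp_mono J (f g : {set I} -> RR) :
  (forall A, f A <= g A) -> bexp_on J f <= bexp_on J g.
Proof.
case/andP: p01 => p0 p1 fg; apply: ler_sum => A _; rewrite ler_wpM2l //.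
by rewrite mulr_ge0 ?exprn_ge0 //; lra.
Qed.

Lemma bexpZ J c (f : {set I} -> RR) : bexp_on J (fun A => c * f A) = c * bexp_on J f.
Proof. by rewrite /bexp_on mulr_sumr; apply: eq_bigr => A _; ring. Qed.

Lemma bexpD J (f g : {set I} -> RR) :
  bexp_on J (fun A => f A + g A) = bexp_on J f + bexp_on J g.
Proof. by rewrite /bexp_on -big_split; apply: eq_bigr => A _ /=; ring. Qed.

Lemma bexp1 J : bexp_on J (fun=> 1) = 1.
Proof.
move: {2}#|J| (erefl #|J|) => k; elim: k J => [|k IH] J cJ.
  by rewrite (cards0_eq cJ) bexp_on0.
have [j jJ] : exists j, j \in J by apply/card_gt0P; rewrite cJ.
have cD : #|J :\ j| = k by apply/eqP; rewrite -eqSS -cJ (cardsD1 j J) jJ.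
by rewrite -(finset.setD1K jJ) bexp_onU1 ?finset.setD11 // IH // !mulr1 addrC subrK.
Qed.

Definition bad (E : {set I} -> Prop) : RR := bexp_on [set: I] (fun A => if `[< E A >] then 1 else 0).

Lemma bad_sub (E F : {set I} -> Prop) : (forall A, E A -> F A) -> bad E <= bad F.
Proof.
move=> EF; apply: bexp_mono => A; case: (asboolP (E A)) => h.
  by rewrite (asboolT (EF _ h)).
by case: ifP.
Qed.

Lemma bad_or (E F : {set I} -> Prop) : bad (fun A => E A \/ F A) <= bad E + bad F.
Proof.
rewrite /bad -bexpD; apply: bexp_mono => A.
case: (asboolP (E A)) => h; case: (asboolP (F A)) => h'; case: asboolP => h''; try lra.
by case: h''.
Qed.

Lemma bad_exists (K : finType) (E : K -> {set I} -> Prop) c :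
  (forall k, bad (E k) <= c) -> bad (fun A => exists k, E k A) <= #|K|%:R * c.
Proof.
move=> h; apply: (@le_trans _ _ (\sum_k bad (E k))); last first.
  by rewrite mulr_natl -sumr_const; apply: ler_sum.
rewrite /bad /bexp_on exchange_big /=; apply: ler_sum => A _.
rewrite -mulr_sumr ler_wpM2l //.
  by case/andP: p01 => p0 p1; rewrite mulr_ge0 ?exprn_ge0 //; lra.
case: asboolP => [[k Ek]|_].
  by rewrite (bigD1 k) //= (asboolT Ek) lerDl; apply: sumr_ge0 => i _; case: ifP.
by apply: sumr_ge0 => i _; case: ifP.
Qed.

Lemma bad_not (E : {set I} -> Prop) :
  bexp_on [set: I] (fun A => if `[< E A >] then 1 else 0) = 1 - bad (fun A => ~ E A).
Proof.
apply/eqP; rewrite -subr_eq0 opprB addrA subr_eq0 -bexpD -[X in _ == X](bexp1 [set: I]); apply/eqP.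
by apply: eq_bexp_on => A _; rewrite asbool_neg; case: asboolP => _ /=; rewrite ?addr0 ?add0r.
Qed.

(** Markov's inequality for cosh (lam |S|), which is at least e^(lam t)/2 on the event; the factors
    1 + u of the supermartingale are bounded by e^u. The dimensions m and n do not enter the bound,
    so very large matrices are allowed. *)
Lemma bernstein_matrix m n (X : I -> 'M[CC]_(m, n)) (lam t V : RR) :
  0 < lam -> (forall i, lam * Num.sqrt (frob2 (X i)) <= p / 2) ->
  \sum_i frob2 (X i) <= V ->
  bad (fun A => t < Num.sqrt (frob2 (\sum_i toC (bw A i) *: X i))) <=
  2 * expR (- (lam * t) + 2 / p * lam ^+ 2 * V).
Proof.
case/andP: p01 => p0 p1 l0 Xb XV.
have := @bexp_chx m n (fun i => toC lam *: X i) [set: I] 0.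
have hb i : Num.sqrt (frob2 (toC lam *: X i)) <= p / 2.
  by rewrite frob2Z sqrtrM ?sqr_ge0 // sqrtr_sqr ger0_norm ?(ltW l0).
move=> /(_ hb); rewrite frob20 sqrtr0.
have -> : chx 0 = 1 by rewrite /chx oppr0 exp.expR0; field.
rewrite mul1r => h.
have hP : \prod_(i in [set: I]) (1 + 2 / p * frob2 (toC lam *: X i)) <= expR (2 / p * lam ^+ 2 * V).
  apply: (@le_trans _ _ (\prod_(i in [set: I]) expR (2 / p * lam ^+ 2 * frob2 (X i)))).
    apply: ler_prod => i _; rewrite frob2Z mulrA expR_ge1Dx andbT addr_ge0 //.
    by rewrite mulr_ge0 ?frob2_ge0 // mulr_ge0 ?sqr_ge0 // divr_ge0 // ltW.
  rewrite -expR_sum -mulr_sumr ler_expR ler_wpM2l //.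
    by rewrite mulr_ge0 ?sqr_ge0 // divr_ge0 // ltW.
  by rewrite (eq_bigl xpredT) // => i; rewrite inE.
have h3 := le_trans h hP.
rewrite exp.expRD.
rewrite [leRHS](_ : _ = (2 * expR (- (lam * t))) * expR (2 / p * lam ^+ 2 * V)); last by rewrite mulrA.
apply: (@le_trans _ _ ((2 * expR (- (lam * t))) * bexp_on [set: I] (fun A => chx (Num.sqrt (frob2 (0 + \sum_(i in [set: I]) toC (bw A i) *: (toC lam *: X i))))))); last first.
  by rewrite ler_wpM2l // mulr_ge0 // ltW // expR_gt0.
rewrite -bexpZ; apply: bexp_mono => A.
have -> : 0 + \sum_(i in [set: I]) toC (bw A i) *: (toC lam *: X i) = toC lam *: \sum_i toC (bw A i) *: X i.
  rewrite add0r scaler_sumr; apply: eq_big => [i|i _]; first by rewrite inE.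
  by rewrite !scalerA mulrC.
rewrite frob2Z sqrtrM ?sqr_ge0 // sqrtr_sqr ger0_norm ?(ltW l0) //.
set Z := Num.sqrt _; case: asboolP => tz; last first.
  by rewrite !mulr_ge0 ?(ltW (expR_gt0 _)) // (le_trans ler01 (chx_ge1 _)).
apply: (@le_trans _ _ (2 * expR (- (lam * t)) * (expR (lam * Z) / 2))).
  have -> : 2 * expR (- (lam * t)) * (expR (lam * Z) / 2) = expR (- (lam * t) + lam * Z).
    by rewrite exp.expRD; field.
  rewrite -[leLHS](@exp.expR0 RR) ler_expR -mulrN -mulrDr mulr_ge0 ?(ltW l0) //.
  by rewrite addrC subr_ge0 ltW.
by rewrite ler_wpM2l ?expR_half_le_chx // mulr_ge0 // ltW // expR_gt0.
Qed.

End Bernoulli.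

Lemma bern_probE n p (E : {set 'I_n} -> Prop) :
  bern_prob p E = bexp_on p [set: 'I_n] (fun A => if `[< E A >] then 1 else 0).
Proof.
rewrite /bern_prob /bexp_on cardsT card_ord; apply: eq_bigl => A.
by rewrite finset.subsetT.
Qed.

(** * Products of factors along antidiagonals *)

Lemma sum_le_inj (I J : finType) (Q : pred J) (P : pred I) (f : J -> I) (F : I -> RR) :
  (forall i, 0 <= F i) -> {in Q &, injective f} -> (forall j, Q j -> P (f j)) ->
  \sum_(j | Q j) F (f j) <= \sum_(i | P i) F i.
Proof.
move=> F0 inj QP; rewrite (partition_big f P) //; apply: ler_sum => i Pi.
have [j /andP[Qj /eqP fj]|no] := pickP (fun j => Q j && (f j == i)); last first.
  by rewrite big_pred0.
rewrite (big_pred1 j) ?fj // => j' /=; apply/andP/eqP => [[Qj' /eqP fj']|->]; last by rewrite fj eqxx.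
by apply: inj; rewrite ?fj ?fj'.
Qed.

Lemma sqr_sum_split_le (u v : RR) : (u + v) ^+ 2 <= 2 * (u ^+ 2 + v ^+ 2).
Proof. by have := sqr_ge0 (u - v); nra. Qed.

(** The rule that charges entry (a, b) to its row (first group) or its column (second group). Near a
    corner, one of the two distances to it is at least half of their sum, and the entry goes to that
    index. In the middle it goes to the index of the longer side, whose partner takes only m values.
    The literals [true] stand for membership in [Om] and in [inner], so that the formula matches the
    predicates of the counting section. *)
Lemma halves_cover (n1 n2 a b : nat) : (a < n1)%N -> (b < n2)%N ->
  let N := (n1 + n2).-1 in let m := minn n1 n2 in let i := (a + b)%N in
  [|| [&& true, true, i.+1 <= m, a <= i & i <= 2 * a],
      [&& true, true, N - i <= m, n1.-1 - a <= N.-1 - i & N.-1 - i <= 2 * (n1.-1 - a)] |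
      [&& true, m <= i.+1, m <= N - i, n2 == m, a <= i & i < a + m]]%N ||
  [|| [&& true, true, i.+1 <= m, b <= i & i <= 2 * b],
      [&& true, true, N - i <= m, n2.-1 - b <= N.-1 - i & N.-1 - i <= 2 * (n2.-1 - b)] |
      [&& true, m <= i.+1, m <= N - i, n1 == m, b <= i & i < b + m]]%N.
Proof.
move=> ha hb; cbv zeta.
have [lo|lo] := boolP ((a + b).+1 <= minn n1 n2)%N.
  have [h|h] := boolP (a + b <= 2 * a)%N; apply/orP; [left|right]; apply/or3P; apply: Or31.
    by apply/and5P; split=> //; lia.
  by apply/and5P; split=> //; lia.
have [hi|hi] := boolP ((n1 + n2).-1 - (a + b) <= minn n1 n2)%N.
  have [h|h] := boolP ((n1 + n2).-1.-1 - (a + b) <= 2 * (n1.-1 - a))%N;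
    apply/orP; [left|right]; apply/or3P; apply: Or32.
    by apply/and5P; split=> //; lia.
  by apply/and5P; split=> //; lia.
have [hn|hn] := boolP (n1 <= n2)%N; apply/orP; [right|left]; apply/or3P; apply: Or33.
  by apply/and5P; split=> //; try lia; apply/andP; split; lia.
by apply/and5P; split=> //; try lia; apply/andP; split; lia.
Qed.

Lemma halves_const (p x y : RR) :
  2 * x * (11 * p * y) + 2 * y * (11 * p * x) <= 44 * p * (y * x).
Proof. by rewrite [leLHS](_ : _ = 44 * p * (y * x)) //; ring. Qed.

Section Counting.
Variables n1 n2 : nat.
Hypotheses (n1_gt0 : (0 < n1)%N) (n2_gt0 : (0 < n2)%N).
Local Notation N := (n1 + n2).-1.
Local Notation onanti i := (fun ab : 'I_n1 * 'I_n2 => (ab.1 + ab.2 == i :> nat)%N).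
Implicit Types (i : 'I_N).

Lemma vsig_ge (D : nat) i :
  (D <= i.+1)%N -> (D <= n1)%N -> (D <= n2)%N -> (D <= N - i)%N -> (D <= vsig n1 n2 i)%N.
Proof.
move=> h1 h2 h3 h4; rewrite vsigE.
case: D h1 h2 h3 h4 => [//|D] h1 h2 h3 h4.
(* Truncated subtraction: a0 = max (0, i - (n2 - 1)) is the first row that antidiagonal i meets, and
   D consecutive rows from there stay inside the matrix. *)
pose a0 := (i - n2.-1)%N.
have ha (t : 'I_D.+1) : (a0 + t < n1)%N by rewrite /a0; case: t => t /=; lia.
have hb (t : 'I_D.+1) : (i - (a0 + t) < n2)%N by rewrite /a0; case: t => t /=; lia.
pose f (t : 'I_D.+1) : 'I_n1 * 'I_n2 := (Ordinal (ha t), Ordinal (hb t)).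
have inj : injective f by move=> t t' [] /addnI e _; apply: val_inj.
rewrite -[X in (X <= _)%N](card_ord D.+1) -(card_codom inj); apply: subset_leq_card.
apply/fintype.subsetP => x /codomP[t ->]; rewrite unfold_in /= /a0.
by apply/eqP; case: t => t /=; lia.
Qed.

Definition rown2 m r (A : 'M[CC]_(m, r)) (a : 'I_m) : RR := \sum_k cabs (A a k) ^+ 2.

Lemma rown2_ge0 m r (A : 'M[CC]_(m, r)) a : 0 <= rown2 A a.
Proof. by apply: sumr_ge0 => k _; rewrite sqr_ge0. Qed.

Lemma prod_entry_le r (H : 'M[CC]_(n1, r)) (K : 'M[CC]_(n2, r)) a b :
  cabs ((H *m adj K) a b) ^+ 2 <= rown2 H a * rown2 K b.
Proof.
rewrite mxE; apply: le_trans (cabs_sum_CS _ _ _) _.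
rewrite [X in _ * X](_ : _ = rown2 K b) //.
by apply: eq_bigr => k _; rewrite adjE cabs_conj.
Qed.

Lemma onanti_inj1 i : {in onanti i &, injective (@fst 'I_n1 'I_n2)}.
Proof.
move=> [a b] [a' b']; rewrite !unfold_in /= => /eqP e1 /eqP e2 e.
by congr (_, _) => //; apply: val_inj => /=; move: e1 e2; rewrite e; lia.
Qed.

Lemma onanti_inj2 i : {in onanti i &, injective (@snd 'I_n1 'I_n2)}.
Proof.
move=> [a b] [a' b']; rewrite !unfold_in /= => /eqP e1 /eqP e2 e.
by congr (_, _) => //; apply: val_inj => /=; move: e1 e2; rewrite e; lia.
Qed.

(** A row index occurs at most once on an antidiagonal, so after Cauchy-Schwarz the row bound on K
    factors out and the rows of H add up to at most its full norm. *)
Lemma Gadj_prod_le_l r (H : 'M[CC]_(n1, r)) (K : 'M[CC]_(n2, r)) B i :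
  (forall b, rown2 K b <= B) ->
  cabs (Gadj n1 n2 (H *m adj K) i 0) ^+ 2 <= B * frob2 H.
Proof.
move=> KB; apply: le_trans (Gadj_entry_le n1_gt0 n2_gt0 _ _) _.
have B0 : 0 <= B by apply: le_trans (KB (Ordinal n2_gt0)); exact: rown2_ge0.
apply: (@le_trans _ _ (\sum_(ab | onanti i ab) B * rown2 H ab.1)).
  apply: ler_sum => ab _; apply: le_trans (prod_entry_le _ _ _ _) _.
  by rewrite mulrC ler_wpM2r ?rown2_ge0.
rewrite -mulr_sumr ler_wpM2l //.
apply: (sum_le_inj (P := xpredT) (F := rown2 H)) => //; first exact: rown2_ge0.
exact: onanti_inj1.
Qed.

Lemma Gadj_prod_le_r r (H : 'M[CC]_(n1, r)) (K : 'M[CC]_(n2, r)) B i :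
  (forall a, rown2 H a <= B) ->
  cabs (Gadj n1 n2 (H *m adj K) i 0) ^+ 2 <= B * frob2 K.
Proof.
move=> HB; apply: le_trans (Gadj_entry_le n1_gt0 n2_gt0 _ _) _.
have B0 : 0 <= B by apply: le_trans (HB (Ordinal n1_gt0)); exact: rown2_ge0.
apply: (@le_trans _ _ (\sum_(ab | onanti i ab) B * rown2 K ab.2)).
  apply: ler_sum => ab _; apply: le_trans (prod_entry_le _ _ _ _) _.
  by rewrite ler_wpM2r ?rown2_ge0.
rewrite -mulr_sumr ler_wpM2l //.
apply: (sum_le_inj (P := xpredT) (F := rown2 K)) => //; first exact: rown2_ge0.
exact: onanti_inj2.
Qed.

(** The antidiagonal is cut into the entries with [PA] and the others, which satisfy [PB].
    Cauchy-Schwarz on each part restricts the sum over one factor and lets the other run over all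
    its rows. The factor 1/vsig is kept, for it is what the counting pays with. *)
Lemma Gadj_prod_split r (H : 'M[CC]_(n1, r)) (K : 'M[CC]_(n2, r)) i
    (PA : pred 'I_n1) (PB : pred 'I_n2) :
  (forall (a : 'I_n1) (b : 'I_n2), (a + b = i :> nat)%N -> PA a || PB b) ->
  cabs (Gadj n1 n2 (H *m adj K) i 0) ^+ 2 <=
  2 * (frob2 K * (\sum_(a | PA a) rown2 H a) + frob2 H * (\sum_(b | PB b) rown2 K b))
    / (vsig n1 n2 i)%:R.
Proof.
move=> cover; apply: le_trans (Gadj_sum_cabs n1_gt0 n2_gt0 _ _) _.
rewrite ler_wpM2r ?invr_ge0 ?ler0n //.
pose h a := Num.sqrt (rown2 H a); pose k b := Num.sqrt (rown2 K b).
have h2 a : h a ^+ 2 = rown2 H a by rewrite sqr_sqrtr // rown2_ge0.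
have k2 b : k b ^+ 2 = rown2 K b by rewrite sqr_sqrtr // rown2_ge0.
have hk0 a b : 0 <= h a * k b by rewrite mulr_ge0 ?sqrtr_ge0.
apply: (@le_trans _ _ ((\sum_(ab | onanti i ab) h ab.1 * k ab.2) ^+ 2)).
  rewrite lerXn2r ?nnegrE ?sumr_ge0 //; first by move=> ab _; exact: cabs_ge0.
  apply: ler_sum => -[a b] _ /=.
  by rewrite -(@ler_pXn2r _ 2) ?nnegrE ?cabs_ge0 // exprMn h2 k2 prod_entry_le.
rewrite (bigID (fun ab => PA ab.1)) /=.
apply: le_trans (sqr_sum_split_le _ _) _; rewrite ler_wpM2l //; apply: lerD.
  apply: le_trans (sum_CS _ (fun ab => h ab.1) (fun ab => k ab.2)) _.
  rewrite mulrC; apply: ler_pM; rewrite ?sumr_ge0 //; try by move=> *; rewrite sqr_ge0.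
    apply: (@le_trans _ _ (\sum_b rown2 K b)); last by [].
    rewrite (eq_bigr (fun ab : 'I_n1 * 'I_n2 => rown2 K ab.2)); last by move=> ab _; exact: k2.
    apply: (sum_le_inj (F := rown2 K)) => //; first exact: rown2_ge0.
    by move=> x y /andP[hx _] /andP[hy _]; apply: (onanti_inj2 hx hy).
  rewrite (eq_bigr (fun ab : 'I_n1 * 'I_n2 => rown2 H ab.1)); last by move=> ab _; exact: h2.
  apply: (sum_le_inj (F := rown2 H)) => //; first exact: rown2_ge0.
    by move=> x y /andP[hx _] /andP[hy _]; apply: (onanti_inj1 hx hy).
  by move=> ab /andP[].
apply: le_trans (sum_CS _ (fun ab => h ab.1) (fun ab => k ab.2)) _.
apply: ler_pM; rewrite ?sumr_ge0 //; try by move=> *; rewrite sqr_ge0.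
  apply: (@le_trans _ _ (\sum_a rown2 H a)); last by [].
  rewrite (eq_bigr (fun ab : 'I_n1 * 'I_n2 => rown2 H ab.1)); last by move=> ab _; exact: h2.
  apply: (sum_le_inj (F := rown2 H)) => //; first exact: rown2_ge0.
  by move=> x y /andP[hx _] /andP[hy _]; apply: (onanti_inj1 hx hy).
rewrite (eq_bigr (fun ab : 'I_n1 * 'I_n2 => rown2 K ab.2)); last by move=> ab _; exact: k2.
apply: (sum_le_inj (F := rown2 K)) => //; first exact: rown2_ge0.
  by move=> x y /andP[hx _] /andP[hy _]; apply: (onanti_inj2 hx hy).
by move=> ab /andP[/eqP e /negbTE nP]; have := cover _ _ e; rewrite nP.
Qed.

Variables (p tau : RR) (Om : {set 'I_N}).
Hypotheses (p_gt0 : 0 < p) (tau_ge0 : 0 <= tau).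
Hypothesis counts : forall l u : nat, (l <= u)%N ->
  #|[set i in Om | (l <= i < u)%N]|%:R <= 2 * p * (u - l)%:R + tau.
Hypothesis tau_le : tau <= p * (minn n1 n2)%:R.

(** Away from both ends by at least tau/p: windows of that length have an expected number of samples
    that dominates the additive error tau of [counts]. *)
Definition inner i : bool := (tau <= p * i.+1%:R) && (tau <= p * (N - i)%:R).

(** A window of length at most D holds at most 2 p D + tau <= (2 + M) p D samples, and each weighs
    at most 1/D. *)
Lemma weight_count (P : pred 'I_N) (D l u M : nat) :
  (forall i, P i -> [&& i \in Om, l <= i < u & D <= vsig n1 n2 i]%N) ->
  (0 < D)%N -> (u - l <= D)%N -> (l <= u)%N ->
  (forall i, P i -> tau <= p * (M * D)%:R) ->
  \sum_(i | P i) (vsig n1 n2 i)%:R^-1 <= (2 + M%:R) * p.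
Proof.
move=> hP D0 luD lu hM.
have [i0 Pi0|P0] := pickP P; last first.
  by rewrite big_pred0 // mulr_ge0 ?ltW // addr_ge0.
have DR : 0 < D%:R :> RR by rewrite ltr0n.
have {}hM := hM _ Pi0; rewrite natrM in hM.
apply: (@le_trans _ _ (\sum_(i in [set i in Om | (l <= i < u)%N]) D%:R^-1)).
  rewrite [leRHS](bigID P) /=.
  apply: (@le_trans _ _ (\sum_(i in [set i in Om | (l <= i < u)%N] | P i) D%:R^-1)).
    rewrite [leRHS](eq_bigl P) => [|i]; last first.
      apply/andP/idP => [[]//|Pi]; split => //; rewrite inE.
      by have /and3P[-> ->] := hP _ Pi.
    apply: ler_sum => i Pi; have /and3P[_ _ Di] := hP _ Pi.
    by rewrite lef_pV2 ?posrE ?ltr0n ?ler_nat // (leq_trans D0).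
  by rewrite lerDl sumr_ge0 // => i _; rewrite invr_ge0 ltW.
rewrite sumr_const -[leLHS]mulr_natl ler_pdivrMr //.
apply: le_trans (counts lu) _.
have : (u - l)%:R <= D%:R :> RR by rewrite ler_nat.
move=> h; have : p * (u - l)%:R <= p * D%:R by rewrite ler_pM2l.
lra.
Qed.

Let m := minn n1 n2.
(** The sampled indices charged to a row or column: [P1] near the first corner and [P2] near the
    last, with k the distance to that corner, and [P3] in the middle, where every antidiagonal has
    length m. *)
Let P1 (k : nat) i := [&& i \in Om, inner i, (i.+1 <= m)%N, (k <= i)%N & (i <= 2 * k)%N].
Let P2 (k : nat) i := [&& i \in Om, inner i, (N - i <= m)%N, (k <= N.-1 - i)%N & (N.-1 - i <= 2 * k)%N].
Let P3 (s : nat) (k : nat) i :=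
  [&& i \in Om, (m <= i.+1)%N, (m <= N - i)%N, s == m, (k <= i)%N & (i < k + m)%N].

Lemma count_lower k : \sum_(i | P1 k i) (vsig n1 n2 i)%:R^-1 <= 4 * p.
Proof.
have -> : 4 = 2 + 2%:R :> RR by rewrite -natrD.
(* The window [k, 2k] has k + 1 indices, and its antidiagonals have length at least k + 1. Being
   inner gives tau <= p (i + 1) <= 2 p (k + 1), hence M = 2. *)
apply: (@weight_count (P1 k) k.+1 k (2 * k).+1 2) => //; try lia.
  move=> i /and5P[-> _ him hk hk2]; rewrite /= hk ltnS hk2 /= vsig_ge //; rewrite /m in him; lia.
move=> i /and5P[_ /andP[h _] _ _ hk2]; apply: le_trans h _.
by rewrite ler_pM2l // ler_nat; lia.
Qed.

Lemma count_upper k : \sum_(i | P2 k i) (vsig n1 n2 i)%:R^-1 <= 4 * p.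
Proof.
have -> : 4 = 2 + 2%:R :> RR by rewrite -natrD.
apply: (@weight_count (P2 k) k.+1 (N.-1 - 2 * k) (N.-1 - k).+1 2) => //; try lia.
  move=> i /and5P[-> _ him hk hk2]; have := ltn_ord i => iN; rewrite /=.
  rewrite vsig_ge; rewrite /m in him; lia.
move=> i /and5P[_ /andP[_ h] _ _ hk2]; apply: le_trans h _.
by have := ltn_ord i => iN; rewrite ler_pM2l // ler_nat; lia.
Qed.

Lemma count_middle s k : \sum_(i | P3 s k i) (vsig n1 n2 i)%:R^-1 <= 3 * p.
Proof.
have -> : 3 = 2 + 1%:R :> RR by rewrite -[1%:R]/(1%:R) -natrD.
apply: (@weight_count (P3 s k) m k (k + m) 1) => //; rewrite /m; try lia.
  move=> i /and5P[-> h1 h2 h3 /andP[h4 h5]]; rewrite h4 h5 /= vsig_ge //; rewrite /m in h1 h2; lia.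
by move=> i _; rewrite mul1n.
Qed.

Let PP (s k k' : nat) i := [|| P1 k i, P2 k' i | P3 s k i].

Lemma count_all s k k' : \sum_(i | PP s k k' i) (vsig n1 n2 i)%:R^-1 <= 11 * p.
Proof.
have h1 := count_lower k; have h2 := count_upper k'; have h3 := count_middle s k.
apply: le_trans (_ : _ <= \sum_(i | P1 k i) (vsig n1 n2 i)%:R^-1 +
   (\sum_(i | P2 k' i) (vsig n1 n2 i)%:R^-1 + \sum_(i | P3 s k i) (vsig n1 n2 i)%:R^-1)) _.
  rewrite [\sum_(i | PP s k k' i) _]big_mkcond [\sum_(i | P1 k i) _]big_mkcond.
  rewrite [\sum_(i | P2 k' i) _]big_mkcond [\sum_(i | P3 s k i) _]big_mkcond.
  rewrite -!big_split /=; apply: ler_sum => i _.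
  have v0 : 0 <= (vsig n1 n2 i)%:R^-1 :> RR by rewrite invr_ge0.
  by rewrite /PP; move: (P1 k i) (P2 k' i) (P3 s k i) => [] [] [] /=; lra.
lra.
Qed.

(** After exchanging sums, each row of H and of K is weighted by the total of 1/vsig over the
    indices charged to it, at most (4 + 4 + 3) p. The estimate is uniform in H and K, so it applies
    to errors that depend on the sample. *)
Lemma Gadj_prod_inner r (H : 'M[CC]_(n1, r)) (K : 'M[CC]_(n2, r)) :
  \sum_(i in Om | inner i) cabs (Gadj n1 n2 (H *m adj K) i 0) ^+ 2 <=
  44 * p * (frob2 H * frob2 K).
Proof.
pose PA i (a : 'I_n1) := PP n2 a (n1.-1 - a) i.
pose PB i (b : 'I_n2) := PP n1 b (n2.-1 - b) i.
have cover i (a : 'I_n1) (b : 'I_n2) : i \in Om -> inner i -> (a + b = i :> nat)%N -> PA i a || PB i b.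
  move=> iO ii e; rewrite /PA /PB /PP /P1 /P2 /P3 iO ii -e.
  exact: halves_cover (ltn_ord a) (ltn_ord b).
apply: (@le_trans _ _ (\sum_(i in Om | inner i) 2 * (frob2 K * (\sum_(a | PA i a) rown2 H a) + frob2 H * (\sum_(b | PB i b) rown2 K b)) / (vsig n1 n2 i)%:R)).
  by apply: ler_sum => i /andP[iO ii]; apply: Gadj_prod_split => a b; exact: cover.
have key n r' (A : 'M[CC]_(n, r')) (Q : 'I_N -> pred 'I_n) :
    (forall a, \sum_(i | Q i a) (vsig n1 n2 i)%:R^-1 <= 11 * p) ->
    \sum_(i in Om | inner i) (\sum_(a | Q i a) rown2 A a) / (vsig n1 n2 i)%:R <= 11 * p * frob2 A.
  move=> hQ; apply: (@le_trans _ _ (\sum_i \sum_(a | Q i a) rown2 A a / (vsig n1 n2 i)%:R)).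
    rewrite [leLHS]big_mkcond; apply: ler_sum => i _; rewrite mulr_suml; case: ifP => // _.
    by apply: sumr_ge0 => a _; rewrite divr_ge0 ?rown2_ge0.
  rewrite (exchange_big_dep xpredT) //= mulr_sumr; apply: ler_sum => a _.
  by rewrite -mulr_sumr mulrC ler_wpM2r ?rown2_ge0 // hQ.
have kA := key _ _ H PA (fun a => count_all _ _ _).
have kB := key _ _ K PB (fun b => count_all _ _ _).
rewrite (eq_bigr (fun i => 2 * frob2 K * ((\sum_(a | PA i a) rown2 H a) / (vsig n1 n2 i)%:R) +
   2 * frob2 H * ((\sum_(b | PB i b) rown2 K b) / (vsig n1 n2 i)%:R))); last by move=> i _; ring.
rewrite big_split /= -!mulr_sumr.
have K0 := frob2_ge0 K; have H0 := frob2_ge0 H.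
apply: le_trans (lerD (ler_wpM2l _ kA) (ler_wpM2l _ kB)) _; rewrite ?mulr_ge0 //.
by rewrite halves_const.
Qed.

(** The remaining indices lie in two intervals of length at most tau/p, one at each end, and each
    holds at most 2 tau + tau samples. *)
Lemma card_edge : tau <= p * N%:R -> #|[set i in Om | ~~ inner i]|%:R <= 6 * tau.
Proof.
move=> tN.
pose l := Num.truncn (tau / p).
have tp : 0 <= tau / p by rewrite divr_ge0 // ltW.
have lt : l%:R <= tau / p by rewrite truncn_le.
have lp : p * l%:R <= tau by rewrite mulrC -ler_pdivlMr.
have lN : (l <= N)%N.
  by rewrite -(ler_nat RR) (le_trans lt) // ler_pdivrMr // mulrC.
have sub : [set i in Om | ~~ inner i] \subset [set i in Om | (0 <= i < l)%N] :|: [set i in Om | (N - l <= i < N)%N].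
  apply/fintype.subsetP => i; rewrite !inE => /andP[-> /=]; rewrite /inner negb_and -!ltNge.
  rewrite -!ltr_pdivlMl // ![_^-1 * _]mulrC => h; have iN := ltn_ord i; rewrite iN andbT.
  have hl (j : nat) : j%:R < tau / p -> (j <= l)%N.
    by move=> jt; rewrite truncn_ge_nat // ltW.
  by case/orP: h => /hl; lia.
apply: (@le_trans _ _ (#|[set i in Om | (0 <= i < l)%N]|%:R + #|[set i in Om | (N - l <= i < N)%N]|%:R)).
  by rewrite -natrD ler_nat (leq_trans (subset_leq_card sub)) // cardsU leq_subr.
have c1 := counts (leq0n l); have c2 := counts (leq_subr l N).
rewrite subn0 in c1; rewrite subKn // in c2; lra.
Qed.

End Counting.

(** * Restricted isometry and the Fourier bound *)

Section Tangent.
Variables n1 n2 r : nat.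
Hypotheses (n1_gt0 : (0 < n1)%N) (n2_gt0 : (0 < n2)%N).
Local Notation N := (n1 + n2).-1.
Variables (U : 'M[CC]_(n1, r)) (V : 'M[CC]_(n2, r)) (nu : RR).
Hypotheses (UU : adj U *m U = 1%:M) (VV : adj V *m V = 1%:M).
Hypotheses (U_row : forall a, rown2 U a <= nu) (V_row : forall b, rown2 V b <= nu).
Implicit Types (Z T : 'M[CC]_(n1, n2)) (i : 'I_N).

(** Orthogonal projector onto the tangent space of the rank-r matrices at a point with column space
    U and row space V, that is, onto the matrices H V^* + U K^*. *)
Definition PT Z := U *m (adj U *m Z) + (Z - U *m (adj U *m Z)) *m (V *m adj V).

Lemma PT_tangent (H : 'M[CC]_(n1, r)) (K : 'M[CC]_(n2, r)) :
  PT (H *m adj V + U *m adj K) = H *m adj V + U *m adj K.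
Proof.
have e : U *m (adj U *m (H *m adj V + U *m adj K)) = U *m (adj U *m H) *m adj V + U *m adj K.
  by rewrite !mulmxDr !mulmxA -(mulmxA U (adj U) U) UU mulmx1.
rewrite /PT e opprD addrACA subrr addr0.
have -> : H *m adj V - U *m (adj U *m H) *m adj V = (H - U *m (adj U *m H)) *m adj V.
  by rewrite mulmxBl.
have e2 (X : 'M[CC]_(n1, r)) : X *m adj V *m (V *m adj V) = X *m adj V.
  by rewrite mulmxA -(mulmxA X) VV mulmx1.
by rewrite e2 mulmxBl addrC addrA subrK.
Qed.

Lemma tr_PT Z T : \tr (adj (PT Z) *m T) = \tr (adj Z *m PT T).
Proof.
rewrite /PT !(mulmxA U); set PU := U *m adj U; set PV := V *m adj V.
have hU : adj PU = PU by rewrite adjM adjK.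
have hV : adj PV = PV by rewrite adjM adjK.
rewrite adjD adjM (adjM _ PV) adjB adjM hU hV mulmxDl [in RHS]mulmxDr !mxtraceD; congr (_ + _).
  by rewrite mulmxA.
rewrite -mulmxA mxtrace_mulC [in RHS]mulmxA; congr (mxtrace (_ *m PV)).
by rewrite mulmxBl mulmxBr (mulmxA (adj Z) PU T).
Qed.

Lemma frob2_PT Z : frob2 (PT Z) <= frob2 (adj U *m Z) + frob2 (Z *m V).
Proof.
set W := Z - U *m (adj U *m Z).
have UW : adj U *m W = 0 by rewrite /W mulmxBr (mulmxA (adj U) U) UU mul1mx subrr.
have orth A : rinner (U *m (adj U *m Z)) (W *m A) = 0.
  by rewrite rinnerC rinner_mull mulmxA UW mul0mx rinner0l.
have eW : frob2 (W *m V) <= frob2 (Z *m V).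
  have e : Z *m V = U *m (adj U *m Z) *m V + W *m V by rewrite -mulmxDl addrC subrK.
  rewrite [X in _ <= frob2 X]e frob2D.
  have -> : rinner (U *m (adj U *m Z) *m V) (W *m V) = 0.
    by rewrite rinnerC rinner_mulr -mulmxA rinnerC orth.
  by rewrite mulr0 addr0 lerDr frob2_ge0.
rewrite /PT -/W frob2D orth mulr0 addr0 frob2_isoM // lerD2l.
by rewrite mulmxA frob2_Miso.
Qed.

Lemma rinner_gvec i Z : rinner (gvec i) Z = complex.Re (Gadj n1 n2 Z i 0).
Proof. by rewrite Gadj_gvec. Qed.

Lemma self_bound (x : RR) : 0 <= x -> 0 <= nu -> x ^+ 2 <= nu * x -> x <= nu.
Proof.
move=> x0 nu0 h; have [->//|xn] := eqVneq x 0.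
have xp : 0 < x by rewrite lt_def xn.
by rewrite -(ler_pM2r xp); move: h; rewrite expr2.
Qed.

Lemma Re_sqr_le (z : CC) : complex.Re z ^+ 2 <= cabs z ^+ 2.
Proof. by rewrite cabs2 lerDl sqr_ge0. Qed.

Lemma nu_ge0 : 0 <= nu.
Proof. by apply: le_trans (U_row (Ordinal n1_gt0)); exact: rown2_ge0. Qed.

(** A self-bounding argument: x = |U^* g|^2 is the i-th coordinate of G^* applied to U K^* for K the
    adjoint of U^* g, and the row bound on U makes its square at most nu |K|^2 = nu x. *)
Lemma frob2_gvec_l i : frob2 (adj U *m gvec i) <= nu.
Proof.
apply: self_bound; rewrite ?frob2_ge0 ?nu_ge0 //.
have e : frob2 (adj U *m gvec i) = rinner (gvec i) (U *m adj (adj (adj U *m gvec i))).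
  by rewrite adjK rinner_mull frob2E.
rewrite [X in X ^+ 2]e rinner_gvec; apply: le_trans (Re_sqr_le _) _.
apply: le_trans (Gadj_prod_le_r n1_gt0 n2_gt0 _ _ U_row) _.
by rewrite frob2_adj.
Qed.

Lemma frob2_gvec_r i : frob2 (gvec i *m V) <= nu.
Proof.
apply: self_bound; rewrite ?frob2_ge0 ?nu_ge0 //.
have -> : frob2 (gvec i *m V) ^+ 2 = rinner (gvec i) ((gvec i *m V) *m adj V) ^+ 2.
  by rewrite rinner_mulr adjK frob2E.
rewrite rinner_gvec; apply: le_trans (Re_sqr_le _) _.
exact: Gadj_prod_le_l.
Qed.

Lemma frob2_PT_gvec i : frob2 (PT (gvec i)) <= 2 * nu.
Proof.
apply: le_trans (frob2_PT _) _.
by have := frob2_gvec_l i; have := frob2_gvec_r i; lra.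
Qed.

Lemma frob2_mxvec m n (A : 'M[CC]_(m, n)) : frob2 (mxvec A) = frob2 A.
Proof.
rewrite /frob2 big_ord1 pair_big /= (reindex _ (curry_mxvec_bij m n)) /=.
by apply: eq_bigr => -[a b] _ /=; rewrite mxvecE.
Qed.

Lemma mxvec_adj_tr m n (A B : 'M[CC]_(m, n)) :
  (mxvec B *m adj (mxvec A)) 0 0 = \tr (adj A *m B).
Proof.
rewrite mxE (reindex _ (curry_mxvec_bij m n)) /= /mxtrace.
transitivity (\sum_(i < m) \sum_(j < n) B i j * Num.conj (A i j)).
  by rewrite pair_big /=; apply: eq_bigr => -[a b] _ /=; rewrite adjE !mxvecE.
rewrite exchange_big /=; apply: eq_bigr => j _; rewrite mxE; apply: eq_bigr => i _.
by rewrite adjE mulrC.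
Qed.

(** The rank-one operator Z -> <PT g_i, Z> PT g_i, written as a matrix on vectorised matrices. The
    isometry then becomes concentration of a sum of such matrices in Frobenius norm, each of norm at
    most 2 nu. *)
Definition rip_atom i : 'M[CC]_(n1 * n2) := adj (mxvec (PT (gvec i))) *m mxvec (PT (gvec i)).

Lemma frob2_rip_atom i : frob2 (rip_atom i) <= (2 * nu) ^+ 2.
Proof.
apply: le_trans (frob2M _ _) _; rewrite frob2_adj frob2_mxvec -expr2.
by rewrite lerXn2r ?nnegrE ?frob2_ge0 ?frob2_PT_gvec // mulr_ge0 // nu_ge0.
Qed.

Lemma cabs_Gadj_le T i : PT T = T -> cabs (Gadj n1 n2 T i 0) ^+ 2 <= 2 * nu * frob2 T.
Proof.
move=> hT.
have -> : Gadj n1 n2 T i 0 = (mxvec T *m adj (mxvec (PT (gvec i)))) 0 0.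
  by rewrite mxvec_adj_tr tr_PT hT Gadj_gvec.
apply: le_trans (frob2_entry _ 0 0) _; apply: le_trans (frob2M _ _) _.
by rewrite frob2_adj !frob2_mxvec mulrC ler_wpM2r ?frob2_ge0 ?frob2_PT_gvec.
Qed.

Lemma rinner_rip_atom T i : PT T = T ->
  rinner (rip_atom i) (adj (mxvec T) *m mxvec T) = cabs (Gadj n1 n2 T i 0) ^+ 2.
Proof.
move=> hT; rewrite rinner_mull adjK /rip_atom mulmxA rinnerC rinner_mulr -frob2E.
by rewrite /frob2 !big_ord1 mxvec_adj_tr tr_PT hT -Gadj_gvec.
Qed.

(** The weighted energy of a tangent T is the inner product of the sum of atoms with the rank-one
    operator of T, whose Frobenius norm is at most |T|^2; Cauchy-Schwarz finishes. *)
Lemma rip_of_norm (w : 'I_N -> RR) (e : RR) :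
  Num.sqrt (frob2 (\sum_i toC (w i) *: rip_atom i)) <= e ->
  forall T, PT T = T ->
  `|\sum_i w i * cabs (Gadj n1 n2 T i 0) ^+ 2| <= e * frob2 T.
Proof.
move=> he T hT.
have e0 : 0 <= e by apply: le_trans he; exact: sqrtr_ge0.
have -> : \sum_i w i * cabs (Gadj n1 n2 T i 0) ^+ 2 =
    rinner (\sum_i toC (w i) *: rip_atom i) (adj (mxvec T) *m mxvec T).
  rewrite rinner_suml; apply: eq_bigr => i _.
  by rewrite rinnerZl rinner_rip_atom.
rewrite -(@ler_pXn2r _ 2) ?nnegrE ?mulr_ge0 ?frob2_ge0 // real_normK ?num_real //.
apply: le_trans (rinner_CS _ _) _; rewrite exprMn; apply: ler_pM; rewrite ?frob2_ge0 //.
  by rewrite -(sqr_sqrtr (frob2_ge0 _)) lerXn2r ?nnegrE ?sqrtr_ge0.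
by apply: le_trans (frob2M _ _) _; rewrite frob2_adj frob2_mxvec expr2.
Qed.

End Tangent.

(** * The discrete Fourier transform and the spectral norm of a Hankel matrix *)

Section DFT.

(** The polynomial X^N - 1 splits over an algebraically closed field and is separable in
    characteristic 0, so it has N distinct roots, and a full set of N-th roots of unity contains a
    primitive one. *)
Lemma prim_root_exists N : (0 < N)%N -> {w : CC | N.-primitive_root w}.
Proof.
move=> N0; have N0' : N%:R != 0 :> CC by rewrite pnatr_eq0 -lt0n.
pose p : {poly CC} := 'X^N - 1.
have [rs prs] := closed_field_poly_normal p.
have lp : lead_coef p = 1 by apply/monicP; exact: monicXnsubC.
rewrite lp scale1r in prs.
have u : uniq rs by rewrite -separable.separable_prod_XsubC -prs; exact: cyclotomic.separable_Xn_sub_1.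
have sz : size rs = N.
  by have := size_XnsubC (1 : CC) N0; rewrite -/p prs size_prod_XsubC => -[].
have al : all N.-unity_root rs.
  by apply/allP => z zr; rewrite /root_of_unity -/p prs root_prod_XsubC.
have /hasP/sig2W[w _ pw] := cyclic.has_prim_root N0 al u (eq_leq (esym sz)).
by exists w.
Qed.

Variables (N : nat) (w : CC).
Hypothesis wN : N.-primitive_root w.

Lemma cabs_prim_root : cabs w = 1.
Proof.
have N0 := prim_order_gt0 wN.
have e n : cabs (w ^+ n) = cabs w ^+ n.
  elim: n => [|n IH]; first exact: (cabs_toC ler01).
  by rewrite !exprS cabsM IH.
have h : cabs w ^+ N = 1 by rewrite -e (prim_expr_order wN); exact: (cabs_toC ler01).
by apply/eqP; rewrite -(pexpr_eq1 N0) ?cabs_ge0 // h.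
Qed.

Lemma mul_conj_prim : Num.conj w * w = 1.
Proof.
by rewrite mul_conj cabs_prim_root expr1n.
Qed.

Lemma dft_orth (a b : nat) : (a < N)%N -> (b < N)%N ->
  \sum_(k < N) Num.conj w ^+ (a * k) * w ^+ (b * k) = if a == b then N%:R else 0.
Proof.
move=> aN bN; set z := Num.conj w ^+ a * w ^+ b.
rewrite (eq_bigr (fun k : 'I_N => z ^+ k)); last first.
  by move=> k _; rewrite /z exprMn -!exprM.
case: eqVneq => [ab|ab].
  rewrite (eq_bigr (fun=> 1)) ?sumr_const ?card_ord // => k _.
  by rewrite /z ab -exprMn mul_conj_prim !expr1n.
have zN : z ^+ N = 1.
  rewrite /z exprMn -!exprM ![(_ * N)%N]mulnC !exprM (prim_expr_order wN) expr1n mulr1.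
  by rewrite -[X in X ^+ a](_ : 1 = _) ?expr1n // -[LHS]conjC1 -(prim_expr_order wN) rmorphXn.
have z1 : z != 1.
  apply: contra ab => /eqP z1; have : w ^+ b = w ^+ a.
    by rewrite -[LHS]mul1r -(expr1n _ a) -mul_conj_prim exprMn [_ ^+ a * _]mulrC -mulrA -/z z1 mulr1.
  move=> /eqP; rewrite (eq_prim_root_expr wN) !modn_small //.
  by rewrite eq_sym.
have := subrX1 z N; rewrite zN subrr => /esym/eqP; rewrite mulf_eq0 subr_eq0 (negbTE z1) /=.
by move=> /eqP.
Qed.

Definition dft (m : nat) : 'M[CC]_(m, N) := \matrix_(a, k) Num.conj w ^+ (a * k).

Lemma conj_pow k : Num.conj (Num.conj w ^+ k) = w ^+ k.
Proof. by rewrite -[RHS]conjCK; congr (Num.conj _); rewrite rmorphXn. Qed.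

Lemma dft_adj m : (m <= N)%N -> dft m *m adj (dft m) = (N%:R)%:M.
Proof.
move=> mN; apply/matrixP => a b; rewrite mxE mxE.
rewrite (eq_bigr (fun k : 'I_N => Num.conj w ^+ (a * k) * w ^+ (b * k))); last first.
  by move=> k _; rewrite adjE !mxE conj_pow.
by rewrite dft_orth ?(leq_trans (ltn_ord _) mN) // -val_eqE /=; case: eqP.
Qed.

Lemma frob2_dft_l m (u : 'cV[CC]_m) : (m <= N)%N ->
  frob2 (adj (dft m) *m u) = N%:R * frob2 u.
Proof.
move=> mN; rewrite frob2E rinner_mull adjK mulmxA dft_adj // mul_scalar_mx.
by rewrite -[N%:R in LHS](_ : toC N%:R = _) ?rinnerZl ?frob2E // toC_is_real rmorph_nat.
Qed.

Lemma frob2_dft_r m (v : 'cV[CC]_m) : (m <= N)%N ->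
  frob2 ((dft m)^T *m v) = N%:R * frob2 v.
Proof.
move=> mN.
have cK n k (A : 'M[CC]_(n, k)) : frob2 (map_mx Num.conj A) = frob2 A.
  by apply: eq_bigr => i _; apply: eq_bigr => j _; rewrite mxE cabs_conj.
have e : map_mx Num.conj (dft m)^T = adj (dft m) by apply/matrixP => i j; rewrite !mxE.
by rewrite -[LHS]cK map_mxM e frob2_dft_l // cK.
Qed.

End DFT.

Lemma frob2_diag m (d : 'rV[CC]_m) (v : 'cV[CC]_m) (M : RR) :
  (forall k, cabs (d 0 k) <= M) -> frob2 (diag_mx d *m v) <= M ^+ 2 * frob2 v.
Proof.
move=> dM; rewrite /frob2 mulr_sumr; apply: ler_sum => i _; rewrite !big_ord1.
rewrite mul_diag_mx mxE cabsM exprMn ler_wpM2r ?sqr_ge0 // lerXn2r ?nnegrE ?cabs_ge0 //.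
exact: le_trans (cabs_ge0 _) (dM i).
Qed.

(** N times the Hankel matrix factors as F_1 diag (d) F_2^T, with F_1 and F_2 the first n1 and n2
    rows of the N-point Fourier matrix and d the Fourier sums of y. All a + b are below N, so there
    is no wrap-around. Both outer factors have norm sqrt N, so the norm of the Hankel matrix is at
    most max |d_k|. *)
Lemma hankel_dft_bound n1 n2 (n1_gt0 : (0 < n1)%N) (n2_gt0 : (0 < n2)%N)
    (w : CC) (wN : (n1 + n2).-1.-primitive_root w)
    (y : 'cV[CC]_((n1 + n2).-1)) (M : RR) :
  0 <= M -> (forall k : 'I_((n1 + n2).-1), cabs (\sum_i y i 0 * w ^+ (i * k)) <= M) ->
  forall (u : 'cV[CC]_n1) (v : 'cV[CC]_n2),
  rinner (u *m adj v) (hankel n1 n2 y) <= M * Num.sqrt (frob2 u) * Num.sqrt (frob2 v).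
Proof.
move=> M0; set N := (n1 + n2).-1 => hM u v.
have N0 : (0 < N)%N by rewrite /N; lia.
have NR : 0 < N%:R :> RR by rewrite ltr0n.
pose d : 'rV[CC]_N := \row_k \sum_i y i 0 * w ^+ (i * k).
have e : toC N%:R *: hankel n1 n2 y = dft N w n1 *m (diag_mx d *m (dft N w n2)^T).
  apply/matrixP => a b; rewrite [LHS]mxE hankelE [RHS]mxE.
  set j := Ordinal _.
  transitivity (\sum_(k < N) \sum_(i < N) y i 0 * (Num.conj w ^+ (j * k) * w ^+ (i * k))); last first.
    apply: eq_bigr => k _; rewrite mul_diag_mx !mxE mulrCA mulr_suml; apply: eq_bigr => i _.
    by rewrite -exprD -mulnDl -mulrA [w ^+ _ * _]mulrC.
  rewrite exchange_big (bigD1 j) // -mulr_sumr (dft_orth wN (ltn_ord j) (ltn_ord j)) eqxx.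
  rewrite big1 => [|i ij]; last first.
    rewrite -mulr_sumr (dft_orth wN (ltn_ord j) (ltn_ord i)).
    by rewrite val_eqE eq_sym (negbTE ij) mulr0.
  by rewrite [RHS]addr0 mulrC toC_is_real rmorph_nat.
have n1N : (n1 <= N)%N by rewrite /N; lia.
have n2N : (n2 <= N)%N by rewrite /N; lia.
rewrite -(ler_pM2l NR) -rinnerZr e rinner_mulr.
have -> : u *m adj v *m adj (diag_mx d *m (dft N w n2)^T) = u *m adj (diag_mx d *m ((dft N w n2)^T *m v)).
  by rewrite -mulmxA -adjM mulmxA.
rewrite -rinner_mulr rinner_mull.
apply: le_trans (rinner_le_sqrt _ _) _.
rewrite frob2_dft_l // sqrtrM ?ler0n //.
have : Num.sqrt (frob2 (diag_mx d *m ((dft N w n2)^T *m v))) <= M * (Num.sqrt N%:R * Num.sqrt (frob2 v)).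
  rewrite -sqrtrM ?ler0n // -[M in leRHS]ger0_norm // -sqrtr_sqr -sqrtrM ?sqr_ge0 //.
  rewrite ler_wsqrtr // -(frob2_dft_r wN v n2N); apply: frob2_diag => k.
  by rewrite mxE hM.
move=> /(ler_wpM2l (mulr_ge0 (sqrtr_ge0 N%:R) (sqrtr_ge0 (frob2 u)))) /le_trans; apply.
have := sqr_sqrtr (ltW NR); set s := Num.sqrt N%:R => <-.
by rewrite le_eqVlt; apply/orP; left; apply/eqP; ring.
Qed.

(** * Random sampling *)

Lemma bad_le (I : finType) (p : RR) (E : {set I} -> Prop) (F : {set I} -> Prop) c :
  0 < p <= 1 -> (forall A, E A -> F A) -> bad p F <= c -> bad p E <= c.
Proof. by move=> p01 EF; apply: le_trans; exact: bad_sub. Qed.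

Lemma expR_lnX (n k : nat) : (0 < n)%N -> expR (- (k%:R * ln n%:R)) = (n%:R ^+ k)^-1 :> RR.
Proof.
by move=> n0; rewrite expRN expRM_natl lnK // posrE ltr0n.
Qed.

(** Endpoints are clipped at N, so a union bound over (N + 1)^2 pairs covers all intervals. *)
Lemma counts_extend (N : nat) (p L : RR) (Om : {set 'I_N}) : 0 < p <= 1 ->
  (forall l u : 'I_N.+1, #|[set i in Om | (l <= i < u)%N]|%:R <= 2 * p * (u - l)%:R + 12 * L) ->
  forall l u : nat, (l <= u)%N ->
  #|[set i in Om | (l <= i < u)%N]|%:R <= 2 * p * (u - l)%:R + 12 * L.
Proof.
move=> /andP[p0 p1] h l u lu.
have hl : (minn l N < N.+1)%N by rewrite ltnS geq_minr.
have hu : (minn u N < N.+1)%N by rewrite ltnS geq_minr.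
have := h (Ordinal hl) (Ordinal hu) => /= {}h.
rewrite (_ : [set i in Om | (l <= i < u)%N] = [set i in Om | (minn l N <= i < minn u N)%N]); last first.
  apply/setP => i; rewrite !inE; congr (_ && _).
  by have := ltn_ord i => iN; apply/idP/idP; lia.
apply: le_trans h _; rewrite lerD2r ler_wpM2l ?mulr_ge0 ?(ltW p0) // ler_nat; lia.
Qed.

Lemma toC_sum I (r : seq I) (P : pred I) (F : I -> RR) :
  toC (\sum_(i <- r | P i) F i) = \sum_(i <- r | P i) toC (F i).
Proof. exact: (big_morph toC toCD (erefl _)). Qed.

Lemma card_sum_bool (I : finType) (P : pred I) :
  (\sum_i (P i : nat) = #|[set i | P i]|)%N.
Proof.
by rewrite -sum1_card [RHS]big_mkcond; apply: eq_bigr => i _; rewrite inE; case: (P i).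
Qed.

(** Bernstein for one-by-one matrices with lam = p/2, the largest value allowed, and deviation d +
    12 L / p, where d is the number of indices in the interval. The variance term p d / 2 then
    cancels exactly and -6 L remains; the exponent 6 absorbs the union over all intervals. *)
Lemma count_concentration (N : nat) (p L : RR) (l u : nat) : 0 < p <= 1 ->
  bad p (fun Om : {set 'I_N} => 2 * p * (u - l)%:R + 12 * L < #|[set i in Om | (l <= i < u)%N]|%:R) <=
  2 * expR (- (6%:R * L)).
Proof.
move=> p01; case/andP: (p01) => p0 p1.
pose X (i : 'I_N) : 'M[CC]_1 := if (l <= i < u)%N then 1%:M else 0.
have f1 : frob2 (1%:M : 'M[CC]_1) = 1.
  by rewrite /frob2 !big_ord1 mxE (_ : cabs _ = 1) ?expr1n //; exact: (cabs_toC ler01).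
have fX i : frob2 (X i) = (l <= i < u)%N%:R.
  by rewrite /X; case: ifP; rewrite ?f1 ?frob20.
have cardle : (#|[set i : 'I_N | (l <= i < u)%N]| <= u - l)%N.
  rewrite cardE -(size_map (@nat_of_ord N)) -[leqRHS](size_iota l).
  apply: uniq_leq_size; first by rewrite map_inj_uniq ?enum_uniq //; exact: val_inj.
  move=> _ /seq.mapP[i ii ->]; move: ii; rewrite mem_enum inE mem_iota => /andP[h1 h2].
  by rewrite h1 /=; lia.
have sumX : \sum_i frob2 (X i) = #|[set i : 'I_N | (l <= i < u)%N]|%:R.
  rewrite (eq_bigr (fun i : 'I_N => ((l <= i < u)%N : nat)%:R)); last by move=> i _; rewrite fX.
  rewrite -natr_sum -sum1_card big_mkcond /=; congr (_%:R).
  by rewrite [in RHS]big_mkcond; apply: eq_bigr => i _; rewrite inE; case: ifP.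
set d := #|[set i : 'I_N | (l <= i < u)%N]| in cardle sumX.
apply: (@bad_le _ _ _ (fun Om => d%:R + 12 * L / p < Num.sqrt (frob2 (\sum_i toC (bw p Om i) *: X i)))) => //.
  move=> Om h.
  have eX : \sum_i toC (bw p Om i) *: X i = (toC (#|[set i in Om | (l <= i < u)%N]|%:R / p - d%:R))%:M.
    apply/matrixP => a b; rewrite !ord1 summxE mxE eqxx mulr1n.
    rewrite (eq_bigr (fun i : 'I_N => toC (((i \in Om) && (l <= i < u)%N)%:R / p - (l <= i < u)%N%:R))); last first.
      move=> i _; rewrite mxE /X /bw; case: (l <= i < u)%N; rewrite ?andbT ?andbF mxE.
        by rewrite eqxx mulr1.
      by rewrite mulr0 mul0r subrr.
    rewrite -toC_sum; congr toC.
    rewrite sumrB -mulr_suml -!natr_sum; congr (_%:R / p - _%:R).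
      exact: card_sum_bool.
    exact: card_sum_bool.
  rewrite eX /frob2 !big_ord1 mxE eqxx mulr1n sqrtr_sqr ger0_norm ?cabs_ge0 //.
  apply: lt_le_trans (Re_le_cabs _); rewrite /= ltrBrDr.
  rewrite -(ltr_pM2r p0) mulfVK ?gt_eqF // !mulrDl mulfVK ?gt_eqF //.
  apply: le_lt_trans h; rewrite -mulrA.
  have : p * d%:R <= p * (u - l)%:R by rewrite ler_pM2l // ler_nat.
  lra.
apply: le_trans (@bernstein_matrix _ _ p01 _ _ X (p / 2) _ d%:R _ _ _) _.
- by rewrite divr_gt0.
- move=> i; rewrite fX; case: (l <= i < u)%N; rewrite ?sqrtr1 ?sqrtr0 ?mulr1 // mulr0.
  by rewrite divr_ge0 // ltW.
- by rewrite sumX.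
rewrite ler_wpM2l // ler_expR.
have -> : - (p / 2 * (d%:R + 12 * L / p)) + 2 / p * (p / 2) ^+ 2 * d%:R = - (6%:R * L).
  by field; rewrite gt_eqF.
by [].
Qed.

Section Concentration.
Variables (N : nat) (p nu L cp e : RR).
Hypotheses (p01 : 0 < p <= 1) (nu_gt0 : 0 < nu) (L_gt0 : 0 < L).
Hypotheses (Nnu : 1 <= N%:R * nu) (cp0 : 0 < cp).
Hypotheses (e01 : 0 < e <= 1) (cp_ge : 32 <= cp * e ^+ 2).
Hypothesis p_ge : cp * (N%:R * nu ^+ 2 * L) <= p.

Lemma sampling_rate : cp * (nu * L) <= p.
Proof.
have h0 : 0 <= cp * (nu * L) by rewrite !mulr_ge0 // ltW.
have E : cp * (N%:R * nu ^+ 2 * L) = cp * (nu * L) * (N%:R * nu) by ring.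
have := ler_wpM2l h0 Nnu; rewrite mulr1 -E => h; exact: le_trans h p_ge.
Qed.

Lemma concentration m k (X : 'I_N -> 'M[CC]_(m, k)) (b : RR) :
  0 < b -> (forall i, frob2 (X i) <= (b * nu) ^+ 2) ->
  bad p (fun A => b * e < Num.sqrt (frob2 (\sum_i toC (bw p A i) *: X i))) <=
  2 * expR (- (4%:R * L)).
Proof.
case/andP: (p01) => p0 p1 b0 hX.
case/andP: (e01) => e0 e1.
(* With lam = th L / b the exponent is at most - th e L + 2 th^2 L / cp, which is minimal at th = cp
   e / 4. Its value there is - cp e^2 L / 8 <= - 4 L. *)
pose th := cp * e / 4.
have th0 : 0 < th by rewrite divr_gt0 // mulr_gt0.
have hl : 0 < th * L / b by rewrite divr_gt0 // mulr_gt0.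
have hXs i : Num.sqrt (frob2 (X i)) <= b * nu.
  rewrite -[leRHS]ger0_norm; last by rewrite mulr_ge0 // ltW.
  by rewrite -sqrtr_sqr ler_wsqrtr.
have sr := sampling_rate.
apply: (@le_trans _ _ (2 * expR (- (th * L / b * (b * e)) + 2 / p * (th * L / b) ^+ 2 * (N%:R * (b * nu) ^+ 2)))).
  apply: bernstein_matrix => //.
    move=> i; apply: le_trans (ler_wpM2l (ltW hl) (hXs i)) _.
    have -> : th * L / b * (b * nu) = e * (cp * (nu * L)) / 4.
      by rewrite /th; field; rewrite gt_eqF.
    have s0 : 0 <= cp * (nu * L) by rewrite !mulr_ge0 // ltW.
    by move: sr s0; move: (cp * (nu * L)) => y sr s0; nra.
  apply: le_trans (ler_sum _ (fun i _ => hX i)) _.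
  by rewrite sumr_const card_ord mulr_natl.
rewrite ler_wpM2l // ler_expR.
have -> : th * L / b * (b * e) = cp * e ^+ 2 * L / 4 by rewrite /th; field; rewrite gt_eqF.
have -> : 2 / p * (th * L / b) ^+ 2 * (N%:R * (b * nu) ^+ 2) =
   (cp * (N%:R * nu ^+ 2 * L)) / p * (cp * e ^+ 2 * L / 8).
  by rewrite /th; field; rewrite !gt_eqF.
have h1 : cp * (N%:R * nu ^+ 2 * L) / p <= 1 by rewrite ler_pdivrMr // mul1r.
have h3 : 32 * L <= cp * e ^+ 2 * L by rewrite ler_wpM2r // ltW.
have cL : 0 <= cp * e ^+ 2 * L / 8.
  by rewrite divr_ge0 // !mulr_ge0 ?sqr_ge0 // ltW.
have := ler_wpM2r cL h1; move: h3; lra.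
Qed.

End Concentration.

Section GoodEvent.
Variables (n1 n2 r : nat).
Hypotheses (n1_gt0 : (0 < n1)%N) (n2_gt0 : (0 < n2)%N).
Local Notation N := (n1 + n2).-1.
Variables (U : 'M[CC]_(n1, r)) (V : 'M[CC]_(n2, r)) (x : 'cV[CC]_N).
Variables (p nu s1 cp e : RR).
Local Notation L := (ln (N%:R : RR)).
Hypotheses (UU : adj U *m U = 1%:M) (VV : adj V *m V = 1%:M).
Hypotheses (U_row : forall a, rown2 U a <= nu) (V_row : forall b, rown2 V b <= nu).
Hypotheses (x_le : forall i, cabs (x i 0) <= s1 * nu) (s1_gt0 : 0 < s1).
Hypotheses (p01 : 0 < p <= 1) (nu_gt0 : 0 < nu) (N_ge2 : (2 <= N)%N).
Hypotheses (Nnu : 1 <= N%:R * nu) (cp0 : 0 < cp).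
Hypotheses (e01 : 0 < e <= 1) (cp_ge : 32 <= cp * e ^+ 2).
Hypothesis p_ge : cp * (N%:R * nu ^+ 2 * L) <= p.

(** This is the rescaled sample of x minus x itself, so its Hankel matrix is the sampling error in
    the initial estimate. *)
Definition reweighted (Om : {set 'I_N}) : 'cV[CC]_N := \col_i (toC (bw p Om i) * x i 0).

Definition good (Om : {set 'I_N}) : Prop :=
  [/\ forall T, PT U V T = T ->
        `|\sum_i bw p Om i * cabs (Gadj n1 n2 T i 0) ^+ 2| <= 2 * e * frob2 T,
      forall (u : 'cV[CC]_n1) (v : 'cV[CC]_n2),
        rinner (u *m adj v) (hankel n1 n2 (reweighted Om)) <=
        s1 * e * Num.sqrt (frob2 u) * Num.sqrt (frob2 v)
    & forall l u : nat, (l <= u)%N ->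
        #|[set i in Om | (l <= i < u)%N]|%:R <= 2 * p * (u - l)%:R + 12 * L].

Lemma L_gt0 : 0 < L.
Proof. by apply: ln_gt0; rewrite ltr1n. Qed.

Lemma good_prob (E : {set 'I_N} -> Prop) :
  (forall Om, good Om -> E Om) -> 1 - 6 / N%:R ^+ 2 <= bern_prob p E.
Proof.
move=> gE; have N0 : (0 < N)%N by rewrite ltnW.
have [w wN] := prim_root_exists N0.
have Lp := L_gt0.
rewrite bern_probE bad_not // lerD2l lerN2.
pose Xk (k i : 'I_N) : 'M[CC]_1 := (x i 0 * w ^+ (i * k))%:M.
pose E1 (Om : {set 'I_N}) := 2 * e < Num.sqrt (frob2 (\sum_i toC (bw p Om i) *: rip_atom U V i)).
pose E2 (k : 'I_N) (Om : {set 'I_N}) := s1 * e < Num.sqrt (frob2 (\sum_i toC (bw p Om i) *: Xk k i)).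
pose E3 (lu : 'I_N.+1 * 'I_N.+1) (Om : {set 'I_N}) :=
  2 * p * (lu.2 - lu.1)%:R + 12 * L < #|[set i in Om | (lu.1 <= i < lu.2)%N]|%:R.
have cov Om : ~ E Om -> E1 Om \/ ((exists k, E2 k Om) \/ (exists lu, E3 lu Om)).
  move=> nE; apply: contrapT => /not_orP[n1' /not_orP[/forallNP n2' /forallNP n3']].
  apply: nE; apply: gE; split.
  - move=> T; apply: rip_of_norm => //.
    by rewrite leNgt; apply/negP => h; apply: n1'.
  - apply: (hankel_dft_bound n1_gt0 n2_gt0 wN); first by case/andP: e01 => e0 _; rewrite mulr_ge0 // ltW.
    move=> k; have /negP := n2' k; rewrite -leNgt => h.
    apply: le_trans h.
    have -> : \sum_i toC (bw p Om i) *: Xk k i = (\sum_i reweighted Om i 0 * w ^+ (i * k))%:M.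
      rewrite raddf_sum /=; apply: eq_bigr => i _.
      by rewrite /Xk scale_scalar_mx mxE mulrA.
    by rewrite /frob2 !big_ord1 mxE eqxx mulr1n sqrtr_sqr ger0_norm ?cabs_ge0.
  - apply: (counts_extend p01) => l u; have /negP := n3' (l, u).
    by rewrite -leNgt.
apply: (bad_le p01 cov).
have b1 : bad p E1 <= 2 * expR (- (4%:R * L)).
  apply: (concentration p01 nu_gt0 Lp Nnu cp0 e01 cp_ge p_ge) => // i.
  exact: frob2_rip_atom.
have b2 k : bad p (E2 k) <= 2 * expR (- (4%:R * L)).
  apply: (concentration p01 nu_gt0 Lp Nnu cp0 e01 cp_ge p_ge) => // i.
  rewrite /Xk /frob2 !big_ord1 mxE eqxx mulr1n cabsM.
  have -> : cabs (w ^+ (i * k)) = 1.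
    elim: (i * k)%N => [|j IH]; first exact: (cabs_toC ler01).
    by rewrite exprS cabsM IH (cabs_prim_root wN) mulr1.
  by rewrite mulr1 lerXn2r ?nnegrE ?cabs_ge0 // (mulr_ge0 (ltW s1_gt0) (ltW nu_gt0)).
have b3 (lu : 'I_N.+1 * 'I_N.+1) : bad p (E3 lu) <= 2 * expR (- (6%:R * L)).
  exact: (@count_concentration _ _ _ lu.1 lu.2 p01).
have := bad_exists p01 b2; have := bad_exists p01 b3.
rewrite card_prod !card_ord => B3 B2.
apply: le_trans (bad_or p01 _ _) _; apply: le_trans (lerD b1 (le_trans (bad_or p01 _ _) (lerD B2 B3))) _.
(* With s = 1/N <= 1/2 the three failure bounds are 2 s^4, 2 s^3 and 2 s^4 (1 + s)^2, and their sum
   is at most 6 s^2. *)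
rewrite !expR_lnX // natrM -!(addn1 N) natrD.
have : 2 <= N%:R :> RR by rewrite ler_nat.
move: (N%:R) => t t2; have t0 : 0 < t by lra.
have s0 : 0 < t^-1 by rewrite invr_gt0.
have st : t^-1 <= 1 / 2 by rewrite div1r lef_pV2 ?posrE.
have ts : t * t^-1 = 1 by rewrite mulfV // gt_eqF.
rewrite -!exprVn; move: (t^-1) s0 st ts => s s0 st ts.
have e1 : t * (2 * s ^+ 4) = 2 * s ^+ 3 by rewrite -[RHS]mulr1 -ts; ring.
have e2 : (t + 1) * (t + 1) * (2 * s ^+ 6) = 2 * s ^+ 4 * (1 + s) ^+ 2.
  have -> : 2 * s ^+ 4 * (1 + s) ^+ 2 = 2 * s ^+ 4 * (t * s + s) ^+ 2 by rewrite ts.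
  by ring.
rewrite e1 e2.
have s2 : 0 < s ^+ 2 by rewrite exprn_gt0.
have -> : 2 * s ^+ 4 + (2 * s ^+ 3 + 2 * s ^+ 4 * (1 + s) ^+ 2) = s ^+ 2 * (2 * s ^+ 2 + 2 * s + 2 * s ^+ 2 * (1 + s) ^+ 2) by ring.
rewrite [leRHS]mulrC ler_wpM2l ?ltW //.
have : s * s <= 1 / 4 by nra.
have : (s * (1 + s)) ^+ 2 <= 1 by rewrite expr_le1 //; nra.
rewrite exprMn; nra.
Qed.

End GoodEvent.

(** * Procrustes alignment *)

(* Real-arithmetic tactics compare atoms up to conversion, which is very slow on matrices. *)
Ltac gen_atoms :=
  repeat match goal with
  | |- context [rinner ?A ?B] => move: (rinner A B)
  | |- context [frob2 ?A] => move: (frob2 A)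
  end; intros.

Section Continuity.
Variable T : topologicalType.

Lemma continuous_addR (f g : T -> RR) :
  continuous f -> continuous g -> continuous (fun t => f t + g t).
Proof. by move=> cf cg t; apply: (@cvgD RR RR^o); [exact: cf | exact: cg]. Qed.

Lemma continuous_oppR (f : T -> RR) : continuous f -> continuous (fun t => - f t).
Proof. by move=> cf t; apply: (@cvgN RR RR^o); exact: cf. Qed.

Lemma continuous_mulR (f g : T -> RR) :
  continuous f -> continuous g -> continuous (fun t => f t * g t).
Proof. by move=> cf cg t; apply: cvgM; [exact: cf | exact: cg]. Qed.

Lemma continuous_sumR I (r : seq I) (P : pred I) (F : I -> T -> RR) :
  (forall i, continuous (F i)) -> continuous (fun t => \sum_(i <- r | P i) F i t).
Proof.
move=> cF; elim: r => [|i r IH].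
  by under eq_fun do rewrite big_nil; move=> t; exact: cvg_cst.
under eq_fun do rewrite big_cons.
by case: (P i) => //; apply: continuous_addR.
Qed.

(** Continuity goes through real and imaginary parts, so that only the topology of the reals is
    involved. *)
Definition ccont (f : T -> CC) : Prop :=
  continuous (fun t => complex.Re (f t) : RR) /\ continuous (fun t => complex.Im (f t) : RR).

Lemma ccont_cst c : ccont (fun=> c).
Proof. by split=> t; exact: cvg_cst. Qed.

Lemma ccont_mul f g : ccont f -> ccont g -> ccont (fun t => f t * g t).
Proof.
move=> [f1 f2] [g1 g2]; split.
  under eq_fun do rewrite cRe_mul.
  by apply: continuous_addR; [|apply: continuous_oppR]; apply: continuous_mulR.
under eq_fun do rewrite cIm_mul.
by apply: continuous_addR; apply: continuous_mulR.
Qed.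

Lemma ccont_sub f g : ccont f -> ccont g -> ccont (fun t => f t - g t).
Proof.
move=> [f1 f2] [g1 g2]; split.
  under eq_fun do rewrite raddfB.
  by apply: continuous_addR => //; apply: continuous_oppR.
under eq_fun do rewrite raddfB.
by apply: continuous_addR => //; apply: continuous_oppR.
Qed.

Lemma ccont_conj f : ccont f -> ccont (fun t => Num.conj (f t)).
Proof.
move=> [f1 f2]; split.
  by under eq_fun do rewrite cRe_conj.
by under eq_fun do rewrite cIm_conj; apply: continuous_oppR.
Qed.

Lemma ccont_sum I (r : seq I) (F : I -> T -> CC) :
  (forall i, ccont (F i)) -> ccont (fun t => \sum_(i <- r) F i t).
Proof.
move=> cF; split.
  by under eq_fun do rewrite cRe_sum; apply: continuous_sumR => i; case: (cF i).
by under eq_fun do rewrite cIm_sum; apply: continuous_sumR => i; case: (cF i).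
Qed.

Definition mxcont m n (F : T -> 'M[CC]_(m, n)) : Prop := forall i j, ccont (fun t => F t i j).

Lemma mxcont_mul m n k (F : T -> 'M[CC]_(m, n)) (G : T -> 'M[CC]_(n, k)) :
  mxcont F -> mxcont G -> mxcont (fun t => F t *m G t).
Proof.
move=> cF cG i j; under eq_fun do rewrite mxE.
by apply: ccont_sum => l; apply: ccont_mul.
Qed.

Lemma mxcont_sub m n (F G : T -> 'M[CC]_(m, n)) :
  mxcont F -> mxcont G -> mxcont (fun t => F t - G t).
Proof.
by move=> cF cG i j; under eq_fun do rewrite !mxE; apply: ccont_sub.
Qed.

Lemma mxcont_adj m n (F : T -> 'M[CC]_(m, n)) : mxcont F -> mxcont (fun t => adj (F t)).
Proof. by move=> cF i j; under eq_fun do rewrite adjE; apply: ccont_conj. Qed.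

Lemma mxcont_cst m n (A : 'M[CC]_(m, n)) : mxcont (fun=> A).
Proof. by move=> i j; exact: ccont_cst. Qed.

Lemma continuous_frob2 m n (F : T -> 'M[CC]_(m, n)) :
  mxcont F -> continuous (fun t => frob2 (F t) : RR).
Proof.
move=> cF; apply: continuous_sumR => i; apply: continuous_sumR => j.
under eq_fun do rewrite cabs2 !expr2.
by have [c1 c2] := cF i j; apply: continuous_addR; apply: continuous_mulR.
Qed.

End Continuity.

Section Procrustes.
Variable r : nat.

(** Complex r x r matrices as real row vectors of length 2 r^2, the form in which Heine-Borel and
    the extreme value theorem are applied to the unitary group. *)
Definition mx_of_coords (v : 'rV[RR]_(r * r + r * r)) : 'M[CC]_r :=
  \matrix_(i, j) Complex (v 0 (lshift (r * r) (mxvec_index i j)))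
                         (v 0 (rshift (r * r) (mxvec_index i j))).

Lemma mx_of_coords_surj (Q : 'M[CC]_r) : exists v, mx_of_coords v = Q.
Proof.
exists (row_mx (mxvec (map_mx (@complex.Re RR) Q)) (mxvec (map_mx (@complex.Im RR) Q))).
apply/matrixP => i j; rewrite mxE row_mxEl row_mxEr !mxvecE !mxE.
by case: (Q i j).
Qed.

Lemma mxcont_coords : mxcont mx_of_coords.
Proof.
by move=> i j; split; under eq_fun do rewrite mxE; exact: coord_continuous.
Qed.

Definition unitary_coords : set 'rV[RR]_(r * r + r * r) :=
  [set v | frob2 (adj (mx_of_coords v) *m mx_of_coords v - 1%:M) = 0].

Lemma unitary_coordsP v : unitary_coords v <-> adj (mx_of_coords v) *m mx_of_coords v = 1%:M.
Proof.
split=> [/frob2_eq0/eqP|e]; first by rewrite subr_eq0 => /eqP.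
by rewrite /unitary_coords /= e subrr frob20.
Qed.

Lemma unitary_entry (Q : 'M[CC]_r) i j : adj Q *m Q = 1%:M -> cabs (Q i j) <= 1.
Proof.
move=> /matrixP/(_ j j); rewrite !mxE eqxx => /(congr1 (@complex.Re RR)).
rewrite cRe_sum (bigD1 i) //= => h.
rewrite -(@ler_pXn2r _ 2) ?nnegrE ?cabs_ge0 // expr1n cabs2.
have e k : complex.Re (adj Q j k * Q k j) = cabs (Q k j) ^+ 2.
  by rewrite adjE mul_conj.
rewrite -cabs2 -e -[leRHS]/(1 : RR) -[X in _ <= X]h lerDl.
by apply: sumr_ge0 => k _; rewrite e sqr_ge0.
Qed.

Lemma compact_unitary : compact unitary_coords.
Proof.
apply: bounded_closed_compact.
  exists 1; split; first exact: num_real.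
  move=> x x1 v /unitary_coordsP hv; apply: le_trans (ltW x1).
  rewrite /Num.norm /= mx_normrE; apply/bigmax_leP; split=> // -[a k] _ /=.
  have bd (i j : 'I_r) := unitary_entry i j hv.
  rewrite (ord1 a); case: (split_ordP k) => l ->; case/mxvec_indexP: l => i j.
    have := bd i j; rewrite -(@ler_pXn2r _ 2) ?nnegrE ?cabs_ge0 // cabs2 mxE /= expr1n => h.
    rewrite -(@ler_pXn2r _ 2) ?nnegrE // expr1n real_normK ?num_real //.
    by apply: le_trans h; rewrite lerDl sqr_ge0.
  have := bd i j; rewrite -(@ler_pXn2r _ 2) ?nnegrE ?cabs_ge0 // cabs2 mxE /= expr1n => h.
  rewrite -(@ler_pXn2r _ 2) ?nnegrE // expr1n real_normK ?num_real //.
  by apply: le_trans h; rewrite lerDr sqr_ge0.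
rewrite (_ : unitary_coords = (fun v => frob2 (adj (mx_of_coords v) *m mx_of_coords v - 1%:M)) @^-1` [set x | x = 0])%classic //.
apply: preimage_closed; last exact: closed_eq.
move=> v _; apply: continuous_frob2; apply: mxcont_sub; last exact: mxcont_cst.
by apply: mxcont_mul; [apply: mxcont_adj|]; exact: mxcont_coords.
Qed.

Lemma unitary_argmin m1 m2 (L Ln : 'M[CC]_(m1, r)) (R Rn : 'M[CC]_(m2, r)) :
  exists2 Q : 'M[CC]_r, adj Q *m Q = 1%:M &
    forall Q' : 'M[CC]_r, adj Q' *m Q' = 1%:M ->
    frob2 (L - Ln *m Q) + frob2 (R - Rn *m Q) <= frob2 (L - Ln *m Q') + frob2 (R - Rn *m Q').
Proof.
pose f v := frob2 (L - Ln *m mx_of_coords v) + frob2 (R - Rn *m mx_of_coords v).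
have cf : continuous f.
  by apply: continuous_addR; apply: continuous_frob2; apply: mxcont_sub;
    [exact: mxcont_cst | apply: mxcont_mul; [exact: mxcont_cst | exact: mxcont_coords]
    |exact: mxcont_cst | apply: mxcont_mul; [exact: mxcont_cst | exact: mxcont_coords]].
have ne : (unitary_coords !=set0)%classic.
  have [v hv] := mx_of_coords_surj 1%:M; exists v; apply/unitary_coordsP.
  by rewrite hv adj_id mulmx1.
have [v vA vmin] := EVT_min_rV ne compact_unitary (continuous_subspaceT cf).
exists (mx_of_coords v); first by apply/unitary_coordsP; rewrite inE in vA.
move=> Q' hQ'; have [w hw] := mx_of_coords_surj Q'.
by have := vmin w; rewrite /f hw; apply; rewrite inE; apply/unitary_coordsP; rewrite hw.
Qed.

Lemma unitary_mulC (Q : 'M[CC]_r) : adj Q *m Q = 1%:M -> Q *m adj Q = 1%:M.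
Proof. exact: mulmx1C. Qed.

(** On the line of x, W acts as the scalar 1 - c |x|^2 = (1 + i t)/(1 - i t), the rational
    parametrisation of the unit circle; on the orthogonal complement it is the identity. *)
Lemma rotation_unitary (x : 'cV[CC]_r) (t : RR) : 0 < frob2 x ->
  let c := Complex (2 * t ^+ 2 / ((1 + t ^+ 2) * frob2 x)) (- (2 * t) / ((1 + t ^+ 2) * frob2 x)) in
  let W := 1%:M - c *: (x *m adj x) in adj W *m W = 1%:M.
Proof.
move=> x0 c W.
have xx : adj x *m x = (toC (frob2 x))%:M.
  apply/matrixP => i j; rewrite !ord1 [RHS]mxE eqxx mulr1n mxE.
  rewrite -vnorm2E /vnorm2 toC_sum; apply: eq_bigr => k _.
  by rewrite adjE mul_conj.
have PP : x *m adj x *m (x *m adj x) = toC (frob2 x) *: (x *m adj x).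
  by rewrite mulmxA -(mulmxA x) xx mul_mx_scalar -scalemxAl.
have PH : adj (x *m adj x) = x *m adj x by rewrite adjM adjK.
have -> : adj W = 1%:M - Num.conj c *: (x *m adj x).
  by rewrite /W adjB adj_scale PH adj_id.
rewrite /W mulmxBl mul1mx mulmxBr mulmx1 -scalemxAl -scalemxAr PP !scalerA.
rewrite -scalerBl -addrA -opprD -scalerDl.
have -> : c + (Num.conj c - Num.conj c * c * toC (frob2 x)) = 0.
  have t0 : 1 + t ^+ 2 != 0 by rewrite gt_eqF // ltr_pwDl // sqr_ge0.
  have n0 : frob2 x != 0 by rewrite gt_eqF.
  apply: complex_ext; rewrite !raddfD !raddfN /=.
    by field; apply/andP.
  by field; apply/andP.
by rewrite scale0r subr0.
Qed.

Lemma tr_mul_delta (A : 'M[CC]_r) a b : \tr (A *m delta_mx a b) = A b a.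
Proof.
rewrite /mxtrace (bigD1 b) //= big1 => [|i ib]; last first.
  rewrite mxE big1 // => l _; rewrite !mxE (negbTE ib) andbF mulr0 //.
rewrite addr0 mxE (bigD1 a) //= big1 => [|l la]; last by rewrite mxE (negbTE la) mulr0.
by rewrite mxE !eqxx mulr1 addr0.
Qed.

(* Rotating the minimiser by 1 - c x x^* with |1 - c |x|^2| = 1 forces x^* M x to be real. *)
Lemma argmax_real (M : 'M[CC]_r) (x : 'cV[CC]_r) :
  (forall W : 'M[CC]_r, adj W *m W = 1%:M -> rinner M W <= rinner M 1%:M) ->
  complex.Im (\tr (adj M *m (x *m adj x))) = 0.
Proof.
move=> hmax; set z := \tr _.
have [x0|xn] := eqVneq (frob2 x) 0.
  by rewrite /z (frob2_eq0 x0) mul0mx mulmx0 raddf0.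
have xp : 0 < frob2 x by rewrite lt_def xn frob2_ge0.
have key (t : RR) : 0 <= 2 * t ^+ 2 * complex.Re z + 2 * t * complex.Im z.
  have /hmax := rotation_unitary t xp.
  rewrite rinnerBr gerDl oppr_le0 /rinner -scalemxAr mxtraceZ -/z cRe_mul /=.
  have d0 : 0 < (1 + t ^+ 2) * frob2 x by rewrite mulr_gt0 // ltr_pwDl // sqr_ge0.
  rewrite (_ : _ - _ = (2 * t ^+ 2 * complex.Re z + 2 * t * complex.Im z) / ((1 + t ^+ 2) * frob2 x)).
    by rewrite pmulr_lge0 // invr_gt0.
  by ring.
move: (complex.Re z) (complex.Im z) key => a b key.
apply/eqP; apply/negPn/negP => bn.
have b2 : 0 < b ^+ 2 by rewrite lt_def sqrf_eq0 bn sqr_ge0.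
(* For t = - b d the expression 2 t^2 a + 2 t b equals 2 d b^2 (d a - 1), which is negative since d
   |a| < 1. *)
pose d := (2 * (`|a| + 1))^-1.
have d0 : 0 < d by rewrite invr_gt0 mulr_gt0 // ltr_wpDl.
have dE : d * (2 * (`|a| + 1)) = 1.
  by rewrite mulVf // gt_eqF // mulr_gt0 // ltr_wpDl.
have := key (- b * d) => h.
have ha : a <= `|a| by exact: ler_norm.
have e : 2 * (- b * d) ^+ 2 * a + 2 * (- b * d) * b = 2 * d * b ^+ 2 * (d * a - 1) by ring.
have db : 0 < 2 * d * b ^+ 2 by rewrite mulr_gt0 // mulr_gt0.
rewrite e (pmulr_rge0 _ db) subr_ge0 in h.
have : d * a <= d * `|a| by rewrite ler_pM2l.
have := mulr_ge0 (ltW d0) (normr_ge0 a); lra.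
Qed.

(** Polarisation: the reality of x^* M x at x = e_j, e_j + e_k and e_j + i e_k determines the
    relation between the entries (j, k) and (k, j). *)
Lemma argmax_hermitian (M : 'M[CC]_r) :
  (forall W : 'M[CC]_r, adj W *m W = 1%:M -> rinner M W <= rinner M 1%:M) ->
  adj M = M.
Proof.
move=> hmax.
have real x := argmax_real x hmax.
have dm (j k : 'I_r) (al : CC) : \tr (adj M *m ((delta_mx j 0 + al *: delta_mx k 0) *m adj (delta_mx j 0 + al *: delta_mx k (0 : 'I_1)))) =
    Num.conj (M j j) + Num.conj al * Num.conj (M j k) + al * Num.conj (M k j) + al * Num.conj al * Num.conj (M k k).
  have ad (l : 'I_r) : adj (delta_mx l (0 : 'I_1) : 'cV[CC]_r) = delta_mx 0 l.
    by apply/matrixP => u v; rewrite adjE !mxE andbC conjC_nat.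
  rewrite adjD adj_scale !ad mulmxDr !mulmxDl -!scalemxAl -!scalemxAr !mul_delta_mx.
  rewrite !(mulmxDr (adj M)) -!(scalemxAr _ (adj M)) 3!mxtraceD 4!mxtraceZ 4!tr_mul_delta 4!adjE.
  ring.
have h0 j : complex.Im (M j j) = 0.
  have := real (delta_mx j 0 + 0 *: delta_mx j 0); rewrite dm conjC0 !mul0r !addr0 cIm_conj.
  by move=> /eqP; rewrite oppr_eq0 => /eqP.
apply/matrixP => j k; rewrite adjE.
have h1 := real (delta_mx j 0 + 1 *: delta_mx k 0).
have hi := real (delta_mx j 0 + Complex 0 1 *: delta_mx k 0).
rewrite dm in h1; rewrite dm in hi; move: h1 hi (h0 j) (h0 k).
case: (M j j) (M j k) (M k j) (M k k) => [a1 b1] [a2 b2] [a3 b3] [a4 b4] /= h1 hi hb1 hb4.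
by apply: complex_ext => /=; lra.
Qed.

(** Right multiplication by a unitary keeps the norms of both ground-truth factors, so minimising
    the distance amounts to maximising a real inner product with the cross-Gram matrix. Of the
    optimality, only its first-order consequence, Hermitian symmetry, is kept. *)
Lemma procrustes m1 m2 (L Ln : 'M[CC]_(m1, r)) (R Rn : 'M[CC]_(m2, r)) :
  exists Q : 'M[CC]_r, [/\ adj Q *m Q = 1%:M,
    dist Ln Rn L R = Num.sqrt (frob2 (L - Ln *m Q) + frob2 (R - Rn *m Q)) &
    let M := adj (Ln *m Q) *m L + adj (Rn *m Q) *m R in adj M = M].
Proof.
have [Q QQ Qmin] := unitary_argmin L Ln R Rn.
exists Q; split=> //.
  rewrite /dist; congr Num.sqrt; apply/eqP; rewrite eq_le; apply/andP; split.
    apply: ge_inf; last by exists Q.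
    by exists 0 => y [Q' _ <-]; rewrite addr_ge0 ?frob2_ge0.
  apply: lb_le_inf; first by exists (frob2 (L - Ln *m Q) + frob2 (R - Rn *m Q)), Q.
  by move=> y [Q' hQ' <-]; apply: Qmin.
move=> M; apply: argmax_hermitian => W WW.
have QW : adj (Q *m W) *m (Q *m W) = 1%:M by rewrite adjM !mulmxA -(mulmxA _ (adj Q)) QQ mulmx1.
have nrm m (A : 'M[CC]_(m, r)) (Q' : 'M[CC]_r) : adj Q' *m Q' = 1%:M -> frob2 (A *m Q') = frob2 A.
  by move=> /unitary_mulC h; rewrite -[Q' in LHS]adjK frob2_Miso // adjK.
have := Qmin _ QW; rewrite !frob2B !mulmxA !(nrm _ _ W) // !(nrm _ _ Q) //.
have -> : rinner M W = rinner L (Ln *m Q *m W) + rinner R (Rn *m Q *m W).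
  by rewrite /M rinnerDl -!rinner_mull.
have -> : rinner M 1%:M = rinner L (Ln *m Q) + rinner R (Rn *m Q).
  by rewrite /M rinnerDl -!rinner_mull !mulmx1.
by gen_atoms; lra.
Qed.

End Procrustes.

(** * Gradients and projections *)

(** Along a line the loss is a polynomial of degree at most four, so its derivative at 0 is read off
    as the linear coefficient. *)
Lemma is_derive_quartic (a b c d e : RR) :
  is_derive (0 : RR^o) (1 : RR^o)
    (fun t : RR^o => a + t * b + t ^+ 2 * c + t ^+ 3 * d + t ^+ 4 * e : RR^o) b.
Proof.
pose P := Poly [:: a; b; c; d; e].
have -> : (fun t : RR^o => a + t * b + t ^+ 2 * c + t ^+ 3 * d + t ^+ 4 * e : RR^o) = horner P.
  by apply/funext => t; rewrite horner_Poly /=; ring.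
have := is_derive_poly P (0 : RR).
by rewrite horner_coef0 coef_deriv coef_Poly.
Qed.

Lemma grad_reorder1 (V : zmodType) (a b c d x : V) :
  a + c + (d + x) - b = a - b + (d + c) + x.
Proof.
rewrite -!addrA; congr (_ + _); rewrite [RHS]addrC -!addrA; exact: addrCA.
Qed.

Lemma grad_reorder2 (V : zmodType) (a b c d x : V) :
  a - (b + c + (d + x)) = a - b - (d + c) - x.
Proof. by rewrite !opprD !addrA (addrAC (a - b) (- c)). Qed.

Lemma frob2_quadratic m n (A B C : 'M[CC]_(m, n)) (t : RR) :
  frob2 (A + toC t *: B + toC (t ^+ 2) *: C) =
  frob2 A + t * (2 * rinner A B) + t ^+ 2 * (2 * rinner A C + frob2 B)
  + t ^+ 3 * (2 * rinner B C) + t ^+ 4 * frob2 C.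
Proof. by rewrite !frob2D !rinnerDl !rinnerZr !rinnerZl !frob2Z; ring. Qed.

Lemma is_derive_unique (f : RR -> RR) (a b : RR) :
  is_derive (0 : RR^o) (1 : RR^o) (f : RR^o -> RR^o) a ->
  is_derive (0 : RR^o) (1 : RR^o) (f : RR^o -> RR^o) b -> a = b.
Proof. by move=> ha hb; rewrite -(@derive_val _ _ _ _ _ _ _ ha) (@derive_val _ _ _ _ _ _ _ hb). Qed.

Lemma is_derive_frob2s m1 k1 m2 k2 m3 k3 (A1 B1 : 'M[CC]_(m1, k1)) (A2 B2 : 'M[CC]_(m2, k2))
    (A3 B3 C3 : 'M[CC]_(m3, k3)) (u v w : RR) :
  is_derive (0 : RR^o) (1 : RR^o) (fun t : RR^o =>
     u * frob2 (A1 + toC t *: B1) + v * frob2 (A2 + toC t *: B2)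
     + w * frob2 (A3 + toC t *: B3 + toC (t ^+ 2) *: C3) : RR^o)
    (2 * (u * rinner A1 B1 + v * rinner A2 B2 + w * rinner A3 B3)).
Proof.
have -> : (fun t : RR^o =>
     u * frob2 (A1 + toC t *: B1) + v * frob2 (A2 + toC t *: B2)
     + w * frob2 (A3 + toC t *: B3 + toC (t ^+ 2) *: C3) : RR^o) =
  (fun t : RR^o => (u * frob2 A1 + v * frob2 A2 + w * frob2 A3)
    + t * (2 * (u * rinner A1 B1 + v * rinner A2 B2 + w * rinner A3 B3))
    + t ^+ 2 * (u * frob2 B1 + v * frob2 B2 + w * (2 * rinner A3 C3 + frob2 B3))
    + t ^+ 3 * (w * (2 * rinner B3 C3)) + t ^+ 4 * (w * frob2 C3) : RR^o).
  by apply/funext => t; rewrite frob2_quadratic !frob2D !rinnerZr !frob2Z; ring.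
exact: is_derive_quartic.
Qed.

Section Gradient.
Variables n1 n2 : nat.
Hypotheses (n1_gt0 : (0 < n1)%N) (n2_gt0 : (0 < n2)%N).
Local Notation N := (n1 + n2).-1.
Implicit Types (x y : 'cV[CC]_N) (Om : {set 'I_N}).

Lemma PiOmD Om x y : PiOm n1 n2 Om (x + y) = PiOm n1 n2 Om x + PiOm n1 n2 Om y.
Proof. by apply/colP => i; rewrite !mxE; case: ifP; rewrite ?addr0. Qed.

Lemma PiOmZ Om c x : PiOm n1 n2 Om (c *: x) = c *: PiOm n1 n2 Om x.
Proof. by apply/colP => i; rewrite !mxE; case: ifP; rewrite ?mulr0. Qed.

Variables (r : nat) (p lam : RR) (Om : {set 'I_N}) (f s : 'cV[CC]_N).
Variables (L : 'M[CC]_(n1, r)) (R : 'M[CC]_(n2, r)).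

Definition residual : 'cV[CC]_N := PiOm n1 n2 Om (Gadj n1 n2 (L *m adj R) + s - f).
Definition imbalance : 'M[CC]_r := adj L *m L - adj R *m R.

Lemma residual_line (Z : 'M[CC]_(n1, n2)) t :
  PiOm n1 n2 Om (Gadj n1 n2 (L *m adj R + toC t *: Z) + s - f) =
  residual + toC t *: PiOm n1 n2 Om (Gadj n1 n2 Z).
Proof.
rewrite /residual GadjD GadjZ -PiOmZ -PiOmD; congr (PiOm _ _ _ _).
by rewrite -!addrA; congr (_ + _); rewrite addrC -addrA.
Qed.

Lemma nonhankel_line (Z : 'M[CC]_(n1, n2)) t :
  nonhankel (L *m adj R + toC t *: Z) = nonhankel (L *m adj R) + toC t *: nonhankel Z.
Proof. by rewrite nonhankelD // nonhankelZ. Qed.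

(** First variation of the loss when the product moves along Z and the imbalance along S. Gradients
    in L and in R are both expressed by it, and it is additive in (Z, S) jointly. *)
Definition dirderiv (Z : 'M[CC]_(n1, n2)) (S : 'M[CC]_r) : RR :=
  p^-1 * rinner residual (PiOm n1 n2 Om (Gadj n1 n2 Z))
  + rinner (nonhankel (L *m adj R)) (nonhankel Z) + lam / 2 * rinner imbalance S.

(** A gradient is specified through its directional derivatives only, so uniqueness of derivatives
    yields all its inner products without an explicit formula. *)
Lemma gradLE g : is_gradL (loss n1 n2 r p lam Om f s) L R g ->
  forall E, rinner g E = dirderiv (E *m adj R) (adj E *m L + adj L *m E).
Proof.
move=> hg E; have := hg E => h; apply: is_derive_unique h _.
rewrite /loss.
rewrite (_ : (fun t : RR^o => _) = (fun t : RR^o =>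
   (2 * p)^-1 * frob2 (residual + toC t *: PiOm n1 n2 Om (Gadj n1 n2 (E *m adj R)))
   + 2^-1 * frob2 (nonhankel (L *m adj R) + toC t *: nonhankel (E *m adj R))
   + lam / 4 * frob2 (imbalance + toC t *: (adj E *m L + adj L *m E) + toC (t ^+ 2) *: (adj E *m E)) : RR^o)).
  apply: is_derive_eq; first exact: is_derive_frob2s.
  rewrite /dirderiv invfM; move: (rinner _ _) (rinner _ _) (rinner _ _) (p^-1) => a b c q.
  by field.
apply/funext => t.
have e : (L + toC t *: E) *m adj R = L *m adj R + toC t *: (E *m adj R).
  by rewrite mulmxDl scalemxAl.
rewrite e residual_line vnorm2E -/(nonhankel (L *m adj R + toC t *: (E *m adj R))) nonhankel_line.
congr (_ + _ * frob2 _).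
rewrite /imbalance adjD adj_scale conj_toC mulmxDl !mulmxDr -!scalemxAl -!scalemxAr scalerA -toCM -expr2.
rewrite scalerDr; move: (adj L *m L) (adj R *m R) (toC t *: (adj L *m E)) (toC t *: (adj E *m L)) (toC (t ^+ 2) *: _) => a b c d x.
exact: grad_reorder1.
Qed.

Lemma gradRE g : is_gradR (loss n1 n2 r p lam Om f s) L R g ->
  forall E, rinner g E = dirderiv (L *m adj E) (- (adj E *m R + adj R *m E)).
Proof.
move=> hg E; have := hg E => h; apply: is_derive_unique h _.
rewrite /loss.
rewrite (_ : (fun t : RR^o => _) = (fun t : RR^o =>
   (2 * p)^-1 * frob2 (residual + toC t *: PiOm n1 n2 Om (Gadj n1 n2 (L *m adj E)))
   + 2^-1 * frob2 (nonhankel (L *m adj R) + toC t *: nonhankel (L *m adj E))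
   + lam / 4 * frob2 (imbalance + toC t *: (- (adj E *m R + adj R *m E)) + toC (t ^+ 2) *: (- (adj E *m E))) : RR^o)).
  apply: is_derive_eq; first exact: is_derive_frob2s.
  rewrite /dirderiv invfM; move: (rinner _ _) (rinner _ _) (rinner _ _) (p^-1) => a b c q.
  by field.
apply/funext => t.
have e : L *m adj (R + toC t *: E) = L *m adj R + toC t *: (L *m adj E).
  by rewrite adjD adj_scale conj_toC mulmxDr scalemxAr.
rewrite e residual_line vnorm2E -/(nonhankel (L *m adj R + toC t *: (L *m adj E))) nonhankel_line.
congr (_ + _ * frob2 _).
rewrite /imbalance adjD adj_scale conj_toC mulmxDl !mulmxDr -!scalemxAl -!scalemxAr scalerA -toCM -expr2.
rewrite !scalerN scalerDr; exact: grad_reorder2.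
Qed.

End Gradient.

Section Projection.
Variables (m k : nat) (B : RR).
Hypotheses (B0 : 0 <= B).
Implicit Types X Y Z : 'M[CC]_(m, k).

Lemma rowballP X : rowball B X <-> forall a, rown2 X a <= B.
Proof.
have sq a : Num.sqrt (rown2 X a) ^+ 2 = rown2 X a by rewrite sqr_sqrtr ?rown2_ge0.
have n0 : 0 <= norm2inf X by exact: bigmax_ge_id.
split=> [h a|h].
  apply: le_trans h; rewrite -sq lerXn2r ?nnegrE ?sqrtr_ge0 //.
  exact: (le_bigmax _ (fun a => Num.sqrt (rown2 X a))).
rewrite /rowball /= -(sqr_sqrtr B0) lerXn2r ?nnegrE ?sqrtr_ge0 //.
by apply/bigmax_leP; split=> [|a _]; [exact: sqrtr_ge0 | exact: ler_wsqrtr (h a)].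
Qed.

Lemma rown2_conv X Y (t : RR) a : 0 <= t <= 1 ->
  rown2 X a <= B -> rown2 Y a <= B -> rown2 (Y + toC t *: (X - Y)) a <= B.
Proof.
case/andP=> t0 t1 hX hY; have t1' : 0 <= 1 - t by rewrite subr_ge0.
have e : rown2 (Y + toC t *: (X - Y)) a <= t * rown2 X a + (1 - t) * rown2 Y a.
  rewrite /rown2 !mulr_sumr -big_split /=; apply: ler_sum => j _; rewrite !mxE.
  case: (X a j) (Y a j) => [x1 x2] [y1 y2]; rewrite !cabs2 /=.
  have : 0 <= t * (1 - t) * ((x1 - y1) ^+ 2 + (x2 - y2) ^+ 2).
    exact: mulr_ge0 (mulr_ge0 t0 t1') (addr_ge0 (sqr_ge0 _) (sqr_ge0 _)).
  lra.
apply: le_trans e _.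
by have := ler_wpM2l t0 hX; have := ler_wpM2l t1' hY; lra.
Qed.

(** Moving from Y towards Z stays in the convex set, which gives the variational inequality <X - Y,
    Z - Y> <= 0; the angle at Y being obtuse, X is farther from Z than Y is. *)
Lemma proj_nonexpansive X Y Z : is_proj (rowball B) X Y -> rowball B Z ->
  frob2 (Y - Z) <= frob2 (X - Z).
Proof.
move=> [hY hmin] hZ.
have hle (t : RR) : 0 < t <= 1 -> 2 * rinner (X - Y) (Z - Y) <= t * frob2 (Z - Y).
  move=> /andP[t0 t1].
  have hb : rowball B (Y + toC t *: (Z - Y)).
    apply/rowballP => a; apply: rown2_conv; first by rewrite (ltW t0).
      by move/rowballP: hZ; apply.
    by move/rowballP: hY; apply.
  have := hmin _ hb; rewrite opprD addrA [X in _ <= X]frob2B frob2Z rinnerZr => h.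
  have : t * (2 * rinner (X - Y) (Z - Y)) <= t * (t * frob2 (Z - Y)) by lra.
  by rewrite ler_pM2l.
have h0 : rinner (X - Y) (Z - Y) <= 0.
  rewrite leNgt; apply/negP => h.
  have F0 := frob2_ge0 (Z - Y).
  move: (rinner _ _) (frob2 (Z - Y)) h F0 hle => c F h F0 hle.
  (* At t = c/(c + F) the inequality [hle] would give 2 c <= t F <= c, which contradicts c > 0. *)
  have t0 : 0 < c / (c + F) by rewrite divr_gt0 // ltr_pwDl.
  have t1 : c / (c + F) <= 1 by rewrite ler_pdivrMr ?mul1r ?lerDl // ltr_pwDl.
  have := hle (c / (c + F)); rewrite t0 t1 => /(_ isT).
  have : c / (c + F) * F <= c.
    by rewrite mulrAC ler_pdivrMr ?ltr_pwDl // ler_wpM2l ?ltW //; lra.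
  lra.
have e : X - Z = (X - Y) - (Z - Y) by rewrite opprB addrA subrK.
have e2 : frob2 (Y - Z) = frob2 (Z - Y) by rewrite -frob2N opprB.
by rewrite e e2 [X in _ <= X]frob2B; have := frob2_ge0 (X - Y); lra.
Qed.

End Projection.

(** * Hard thresholding *)

(** S without T is no larger than T without S, and the maximum of F over the former is below every
    value of F on the latter. *)
Lemma matching_sum_le (I : finType) (S T : {set I}) (F : I -> RR) :
  (#|S| <= #|T|)%N -> (forall i, 0 <= F i) ->
  (forall i j, i \in T -> j \notin T -> F j <= F i) ->
  \sum_(i in S :\: T) F i <= \sum_(i in T :\: S) F i.
Proof.
move=> ST F0 hF.
have [i0 i0D|D0] := pickP (mem (S :\: T)); last first.
  by rewrite big_pred0 // sumr_ge0.
pose m := [arg max_(i > i0 in S :\: T) F i]%O.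
have [mD mmax] : m \in S :\: T /\ forall j, j \in S :\: T -> F j <= F m.
  by rewrite /m; case: arg_maxP => // i iD imax; split.
have cle : (#|S :\: T| <= #|T :\: S|)%N.
  by have := cardsID T S; have := cardsID S T; rewrite finset.setIC; lia.
apply: (@le_trans _ _ (\sum_(i in S :\: T) F m)); first exact: ler_sum.
rewrite sumr_const; apply: (@le_trans _ _ (F m *+ #|T :\: S|)).
  by rewrite -[leLHS]mulr_natl -[leRHS]mulr_natl ler_wpM2r ?F0 // ler_nat.
rewrite -sumr_const; apply: ler_sum => i; rewrite !inE => /andP[_ iT].
by apply: hF => //; move: mD; rewrite !inE => /andP[].
Qed.

Lemma cabs_sqrD_le (x y : CC) : cabs (x + y) ^+ 2 <= 2 * (cabs x ^+ 2 + cabs y ^+ 2).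
Proof.
case: x y => [a b] [c d]; rewrite !cabs2 /=.
have := sqr_ge0 (a - c); have := sqr_ge0 (b - d); nra.
Qed.

Lemma cabsN z : cabs (- z) = cabs z.
Proof. by apply/eqP; rewrite -(@eqrXn2 _ 2) ?cabs_ge0 // !cabs2 !raddfN /= !sqrrN. Qed.

Section Threshold.
Variables n1 n2 : nat.
Local Notation N := (n1 + n2).-1.
Variables (Om : {set 'I_N}) (u w s : 'cV[CC]_N) (al ga p : RR).
Hypotheses (ga12 : 1 <= ga <= 2) (al0 : 0 <= al) (p0 : 0 < p).

(** On T the threshold cancels the residual, so the correction is -u. On missed outliers it is -w,
    with |w|^2 <= 2 |w - u|^2 + 2 |u|^2. There the sum of |w - u|^2 is at most its sum over T
    outside S, where w = 0 and it reduces to |u|^2. Together this gives the factor 4. *)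
Lemma threshold_residual :
  #|[set i in Om | w i 0 != 0]|%:R <= al * p * N%:R ->
  is_hthr (ga * al * p) (PiOm n1 n2 Om (w - u)) s ->
  exists A : {set 'I_N}, exists xi : 'cV[CC]_N,
    [/\ #|A|%:R <= 3 * (al * p * N%:R),
        PiOm n1 n2 Om (u + s - w) = PiOm n1 n2 Om u + xi,
        (forall i, i \notin A -> xi i 0 = 0), A \subset Om &
        frob2 xi <= 4 * \sum_(i in A) cabs (u i 0) ^+ 2].
Proof.
case/andP: ga12 => g1 g2 hS [T [cT [hT ->]]].
set S := [set i in Om | w i 0 != 0] in hS.
set v := PiOm n1 n2 Om (w - u) in hT *.
have apN : 0 <= al * p * N%:R by rewrite !mulr_ge0 // ltW.
have gapN : 0 <= ga * al * p * N%:R by rewrite -!mulrA mulr_ge0 //; [lra | rewrite !mulrA].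
have ST : (#|S| <= #|T|)%N.
  rewrite cT leq_min; apply/andP; split.
    by rewrite -[leqRHS]card_ord max_card.
  rewrite truncn_ge_nat //; apply: le_trans hS _.
  by rewrite -!mulrA -[leLHS]mul1r ler_wpM2r // !mulrA.
have Tle : #|T|%:R <= 2 * (al * p * N%:R).
  have t1 : (#|T| <= Num.truncn (ga * al * p * N%:R))%N by rewrite cT geq_minr.
  apply: (@le_trans _ _ (ga * al * p * N%:R)).
    by apply: le_trans (_ : (Num.truncn (ga * al * p * N%:R))%:R <= _); rewrite ?ler_nat // truncn_le.
  by rewrite -!mulrA ler_wpM2r // !mulrA.
(* The size is at most gamma alpha p N + alpha p N, and gamma <= 2 gives the factor 3. *)
pose A := (T :|: S) :&: Om.
pose xi : 'cV[CC]_N := \col_i (if i \in Om then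
   (if i \in T then - u i 0 else - w i 0) else 0).
exists A, xi; split.
- apply: (@le_trans _ _ (#|T|%:R + #|S|%:R)); last by lra.
  rewrite -natrD ler_nat; apply: leq_trans (subset_leq_card (finset.subsetIl _ _)) _.
  by rewrite cardsU leq_subr.
- apply/colP => i; rewrite !mxE; case: ifP => iO; last by rewrite addr0.
  case: ifP => iT; last by rewrite addr0.
  by rewrite iO; ring.
- move=> i; rewrite !inE negb_and negb_or => h; rewrite mxE; case: ifP => // iO.
  move: h; rewrite iO /= orbF => /andP[/negbTE-> h].
  by move: h; rewrite negbK => /eqP->; rewrite oppr0.
- exact: finset.subsetIr.
have vE i : v i 0 = if i \in Om then w i 0 - u i 0 else 0 by rewrite !mxE.
have m := matching_sum_le ST (fun i => sqr_ge0 (cabs (v i 0))) _.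
have {}m : \sum_(i in S :\: T) cabs (v i 0) ^+ 2 <= \sum_(i in T :\: S) cabs (v i 0) ^+ 2.
  apply: m => i j iT jT; rewrite lerXn2r ?nnegrE ?cabs_ge0 //; exact: hT.
have e1 : \sum_(i in T :\: S) cabs (v i 0) ^+ 2 <= \sum_(i in A) cabs (u i 0) ^+ 2.
  rewrite big_mkcond [leRHS]big_mkcond; apply: ler_sum => i _; rewrite vE !inE.
  case: (i \in Om); rewrite /= ?andbT ?andbF; last by rewrite cabs0 expr0n; case: ifP.
  case: (i \in T) => /=; last by rewrite andbF; case: ifP => // _; rewrite sqr_ge0.
  rewrite andbT; case: eqP => [->|_] /=; last by rewrite sqr_ge0.
  by rewrite sub0r cabsN.
have e2 : frob2 xi <= \sum_(i in A) 2 * cabs (u i 0) ^+ 2 + 2 * \sum_(i in S :\: T) cabs (v i 0) ^+ 2.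
  rewrite -vnorm2E /vnorm2 mulr_sumr [X in _ <= X + _]big_mkcond [X in _ <= _ + X]big_mkcond -big_split /=.
  apply: ler_sum => i _; rewrite vE mxE !inE.
  case: (i \in Om); rewrite /= ?andbT ?andbF; last by rewrite cabs0 expr0n /=; lra.
  case: (i \in T) => /=; first by rewrite cabsN; have := sqr_ge0 (cabs (u i 0)); lra.
  case: eqP => [->|_] /=; first by rewrite oppr0 cabs0 expr0n /=; lra.
  rewrite cabsN; have := cabs_sqrD_le (w i 0 - u i 0) (u i 0); rewrite subrK; lra.
rewrite -mulr_sumr in e2; lra.
Qed.

End Threshold.

(** Expansion of |3 X + 5 B|^2 >= 0. The term in X - B is kept because, with X the full error and B
    its product part, X - B is the tangent part that must dominate sigma_r d^2. *)
Lemma rinner_self_add_ge m n (X B : 'M[CC]_(m, n)) :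
  1 / 2 * frob2 X + 1 / 8 * frob2 (X - B) - 5 / 4 * frob2 B <= rinner X (X + B).
Proof.
have := frob2_ge0 (toC 3 *: X + toC 5 *: B); have := frob2_ge0 B.
rewrite rinnerDr -frob2E frob2B frob2D !frob2Z rinnerZl rinnerZr.
have : 0 <= frob2 B by exact: frob2_ge0.
lra.
Qed.

Lemma cRe_inner_ge (u b : CC) :
  1 / 2 * cabs u ^+ 2 + 1 / 8 * cabs (u - b) ^+ 2 - 5 / 4 * cabs b ^+ 2 <=
  complex.Re (Num.conj u * (u + b)).
Proof.
rewrite cRe_mul cRe_conj cIm_conj !cabs2; case: u b => [u1 u2] [b1 b2] /=.
have := sqr_ge0 (3 * u1 + 5 * b1); have := sqr_ge0 (3 * u2 + 5 * b2).
have := sqr_ge0 b1; have := sqr_ge0 b2; lra.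
Qed.

(** The variant for the ends of [n]. There only the tangent part u - b is under control, so the loss
    is expressed by it and b does not appear alone; the gap is |u + b|^2 / 4. *)
Lemma cRe_edge_ge (u b : CC) :
  1 / 2 * cabs u ^+ 2 - 1 / 4 * cabs (u - b) ^+ 2 <= complex.Re (Num.conj u * (u + b)).
Proof.
rewrite cRe_mul cRe_conj cIm_conj !cabs2; case: u b => [u1 u2] [b1 b2] /=.
have := sqr_ge0 (u1 + b1); have := sqr_ge0 (u2 + b2).
have := sqr_ge0 u1; have := sqr_ge0 u2; lra.
Qed.

Lemma procrustes_real (a b x y z w : RR) : 0 <= x + y + 2 * z -> 0 <= w ->
  a + b <= a + 2 * z + b + 1 / 4 * (w + 2 * (x + y - 2 * z) + w).
Proof. by move=> *; lra. Qed.

(* With P = Ln^* dL + Rn^* dR Hermitian and A = Ln^* dL - Rn^* dR, the cross term of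
   |dL Rn^* + Ln dR^*|^2 equals |P|^2/2 + |A|^2/2 - |A + A^*|^2/4. *)
Lemma procrustes_lower m1 m2 r (Ln dL : 'M[CC]_(m1, r)) (Rn dR : 'M[CC]_(m2, r)) :
  let P := adj Ln *m dL + adj Rn *m dR in adj P = P ->
  frob2 (dL *m adj Rn) + frob2 (Ln *m adj dR) <=
  frob2 (dL *m adj Rn + Ln *m adj dR) +
  1 / 4 * frob2 (adj Ln *m dL + adj dL *m Ln - (adj Rn *m dR + adj dR *m Rn)).
Proof.
move=> P; rewrite /P adjD !adjM !adjK.
set X := adj Ln *m dL; set Y := adj Rn *m dR.
have eX : adj dL *m Ln = adj X by rewrite /X adjM adjK.
have eY : adj dR *m Rn = adj Y by rewrite /Y adjM adjK.
rewrite eX eY => hP.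
have ec : rinner (dL *m adj Rn) (Ln *m adj dR) = rinner X (adj Y).
  by rewrite rinner_mull mulmxA -rinner_mulr eY.
have eP : frob2 (X + Y) = rinner X (adj X) + rinner Y (adj Y) + 2 * rinner X (adj Y).
  rewrite frob2E -{2}hP rinnerDl !rinnerDr.
  have -> : rinner Y (adj X) = rinner X (adj Y) by rewrite rinnerC -[RHS]rinner_adj adjK.
  by gen_atoms; ring.
have eD : X + adj X - (Y + adj Y) = (X - Y) + adj (X - Y).
  by rewrite adjB opprD addrACA.
have eA : rinner (X - Y) (adj (X - Y)) = rinner X (adj X) + rinner Y (adj Y) - 2 * rinner X (adj Y).
  rewrite adjB !rinnerBl !rinnerBr.
  have -> : rinner Y (adj X) = rinner X (adj Y) by rewrite rinnerC -[RHS]rinner_adj adjK.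
  by gen_atoms; ring.
rewrite eD [frob2 (X - Y + _)]frob2D [frob2 (dL *m adj Rn + _)]frob2D frob2_adj eA ec.
have h1 := frob2_ge0 (X + Y); rewrite eP in h1.
exact: procrustes_real h1 (frob2_ge0 (X - Y)).
Qed.

(** * One descent step *)

Lemma prod_perturb m1 m2 r (Ln dL : 'M[CC]_(m1, r)) (Rn dR : 'M[CC]_(m2, r)) :
  (Ln + dL) *m adj (Rn + dR) - Ln *m adj Rn =
  (dL *m adj Rn + Ln *m adj dR) + dL *m adj dR.
Proof.
rewrite adjD !mulmxDl !mulmxDr.
by move: (Ln *m adj Rn) => X; rewrite -!addrA addrC -!addrA addNr addr0 addrCA.
Qed.

Lemma sampled_inner_real (q oU oT oe oi S gT T eT D2 : RR) :
  q * oe <= 1 / 100 * T -> q * oi <= 11 * D2 -> gT - eT <= q * oT ->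
  eT <= 1 / 50 * T -> 0 <= T -> 0 <= D2 -> 0 <= q ->
  1 / 2 * oU + 1 / 8 * oT - 3 / 8 * oe - 5 / 4 * oi <= S ->
  1 / 2 * (q * oU) + 1 / 8 * gT - 1 / 100 * T - 14 * D2 <= q * S.
Proof. by move=> h1 h2 h3 h4 h5 h6 q0 h; have := ler_wpM2l q0 h; lra. Qed.

Lemma rown2B_le m r (A B : 'M[CC]_(m, r)) a : rown2 (A - B) a <= 2 * (rown2 A a + rown2 B a).
Proof.
rewrite /rown2 -big_split mulr_sumr /=; apply: ler_sum => j _; rewrite !mxE.
by have := cabs_sqrD_le (A a j) (- B a j); rewrite cabsN.
Qed.

Lemma descent_real (oU q gT nT T D2 W D1 srD cd ca xi S : RR) :
  1 / 2 * oU + 1 / 8 * gT - 1 / 100 * T - 14 * D2 <= S ->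
  T = gT + nT -> srD <= T + 1 / 4 * D1 -> 0 <= D1 -> 0 <= D2 -> D2 <= cd * srD -> 0 <= T ->
  0 <= srD ->
  - (4 * ca * srD) <= xi ->
  1 / 2 * (oU + q) + 1 / 64 * W + (1 / 64 - 15 * cd - 4 * ca) * srD <=
  S + xi + (1 / 2 * q + 1 / 8 * nT - 5 / 16 * D2) + 1 / 32 * (1 / 2 * W + 1 / 8 * D1 - 5 / 2 * D2).
Proof. move=> *; lra. Qed.

Lemma balance_reorder (M : zmodType) (P a b c d : M) :
  P + a + b - (P + c + d) = (a - c) + (b - d).
Proof. by rewrite -[P + a + b]addrA -[P + c + d]addrA opprD addrACA subrr add0r opprD addrACA. Qed.

Lemma prod_perturb_l m1 m2 r (Ln L : 'M[CC]_(m1, r)) (Rn R : 'M[CC]_(m2, r)) :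
  (L - Ln) *m adj R + Ln *m adj (R - Rn) = L *m adj R - Ln *m adj Rn.
Proof. by rewrite adjB mulmxBl mulmxBr addrA subrK. Qed.

Lemma sym_perturb m r (Ln L : 'M[CC]_(m, r)) :
  let d := L - Ln in
  adj d *m L + adj L *m d = adj Ln *m d + adj d *m Ln + adj d *m d + adj d *m d.
Proof.
move=> d; have -> : L = Ln + d by rewrite addrC subrK.
rewrite adjD mulmxDr mulmxDl; move: (adj d *m d) (adj d *m Ln) (adj Ln *m d) => a b c.
by rewrite addrACA addrA [b + c]addrC.
Qed.

Lemma balance_reorder2 (M : zmodType) (a b c d : M) :
  a + b + b - (c + d + d) = a - c + (b - d) + (b - d).
Proof. by rewrite opprD addrACA; congr (_ + _); rewrite opprD addrACA. Qed.

Lemma rinner_le m n (A B : 'M[CC]_(m, n)) c : 0 < c ->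
  rinner A B <= c * frob2 A + (4 * c)^-1 * frob2 B.
Proof. by move=> c0; have := @rinner_ge _ _ A (- B) c c0; rewrite rinnerNr frob2N lerN2. Qed.

(** The Young weights 9 s1, 6 s1 and s1 leave at most h/6, h/6 and 4 h / 32 = h/8, whose sum stays
    below h/2. *)
Lemma dir_real (s1 oU q W ca srD x1 x2 x3 oZ nZ fS h : RR) : 0 < s1 ->
  x1 <= 9 * s1 * (2 * (oU + 8 * ca * srD)) + (4 * (9 * s1))^-1 * oZ ->
  x2 <= 6 * s1 * q + (4 * (6 * s1))^-1 * nZ ->
  x3 <= s1 * W + (4 * s1)^-1 * fS ->
  oZ <= 6 * s1 * h -> nZ <= 4 * s1 * h -> fS <= 16 * s1 * h -> 0 <= s1 * q -> 0 <= h ->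
  x1 + x2 + 1 / 16 / 2 * x3 <= 1 / 2 * h + s1 * (18 * (oU + q) + 1 / 32 * W + 144 * ca * srD).
Proof.
move=> s0 h1 h2 h3 hZ hN hS q0 h0.
have k1 : (4 * (9 * s1))^-1 * oZ <= 1 / 6 * h by rewrite ler_pdivrMl; lra.
have k2 : (4 * (6 * s1))^-1 * nZ <= 1 / 6 * h by rewrite ler_pdivrMl; lra.
have k3 : (4 * s1)^-1 * fS <= 4 * h by rewrite ler_pdivrMl; lra.
lra.
Qed.

(** The quadratic term of the step costs ct/s1 times ct X, with X = 72 oq + W/8 + 576 ca srD, and
    for ct <= 1/200 it is absorbed by twice the correlation. The coefficient 2/64 of srD thereby
    loses less than half of itself. *)
Lemma step_real (s1 ct cd ca oq W srD gL gR iL iR dL dR L' R' : RR) : 0 < s1 ->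
  0 < ct -> 200 * ct <= 1 -> 0 <= cd -> 50 * cd <= 1 / 100 -> 0 <= ca -> 50 * ca <= 1 / 100 ->
  0 <= oq -> 0 <= W -> 0 <= srD ->
  1 / 2 * oq + 1 / 64 * W + (1 / 64 - 15 * cd - 4 * ca) * srD <= iL + iR ->
  gL <= 1 / 2 * gL + s1 * (18 * oq + 1 / 32 * W + 144 * ca * srD) ->
  gR <= 1 / 2 * gR + s1 * (18 * oq + 1 / 32 * W + 144 * ca * srD) ->
  L' <= dL - 2 * (ct / s1 * iL) + (ct / s1) ^+ 2 * gL ->
  R' <= dR - 2 * (ct / s1 * iR) + (ct / s1) ^+ 2 * gR ->
  L' + R' <= dL + dR - ct / s1 * (1 / 64 * srD).
Proof.
move=> s10 ct0 ct1 cd0 cd1 ca0 ca1 oq0 W0 srD0 hI hL hR pL pR.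
set eta := ct / s1 in pL pR *; have eta0 : 0 < eta by rewrite divr_gt0.
pose X := 72 * oq + 1 / 8 * W + 576 * ca * srD.
have hg : gL + gR <= s1 * X by rewrite /X; lra.
have X0 : 0 <= X.
  by have := mulr_ge0 ca0 srD0; rewrite /X; lra.
have hq : eta ^+ 2 * (gL + gR) <= eta * (1 / 200 * X).
  apply: (@le_trans _ _ (eta ^+ 2 * (s1 * X))); first by rewrite ler_wpM2l ?sqr_ge0.
  have -> : eta ^+ 2 * (s1 * X) = eta * (ct * X).
    by rewrite /eta; field; rewrite gt_eqF.
  by rewrite ler_pM2l // ler_wpM2r //; lra.
have hi := ler_wpM2l (ltW eta0) hI.
have hz : 1 / 64 * srD <= 2 * (1 / 2 * oq + 1 / 64 * W + (1 / 64 - 15 * cd - 4 * ca) * srD) - 1 / 200 * X.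
  have := ler_wpM2r srD0 cd1; have := ler_wpM2r srD0 ca1; rewrite /X; lra.
by have := ler_wpM2l (ltW eta0) hz; lra.
Qed.

Lemma dirderivD n1 n2 r (n1_gt0 : (0 < n1)%N) (n2_gt0 : (0 < n2)%N) p lam Om f s
    (L : 'M[CC]_(n1, r)) (R : 'M[CC]_(n2, r)) Z Z' S S' :
  dirderiv p lam Om f s L R (Z + Z') (S + S') =
  dirderiv p lam Om f s L R Z S + dirderiv p lam Om f s L R Z' S'.
Proof.
rewrite /dirderiv GadjD PiOmD nonhankelD // !rinnerDr.
by move: (rinner _ _) (rinner _ _) (rinner _ _) (rinner _ _) (rinner _ _) (rinner _ _) => *; ring.
Qed.

Lemma edge_real (a b p tau nu s1 h X : RR) :
  a <= X -> b <= 6 * tau * (4 * (3 * nu * s1) * h) ->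
  12 * tau * nu * (s1 * h) <= p / 100 * (s1 * h) ->
  X <= p * (1 / 100 * (s1 * h)) -> 0 <= p * (s1 * h) ->
  a + b <= p * (1 / 10 * (s1 * h)).
Proof.
have -> : 12 * tau * nu * (s1 * h) = 12 * (tau * nu * s1 * h) by ring.
have -> : 6 * tau * (4 * (3 * nu * s1) * h) = 72 * (tau * nu * s1 * h) by ring.
by rewrite [p / 100 * _]mulrAC [p * (1 / 100 * _)]mulrCA; lra.
Qed.

Section Descent.
Variables (n1 n2 r : nat).
Hypotheses (n1_gt0 : (0 < n1)%N) (n2_gt0 : (0 < n2)%N).
Local Notation N := (n1 + n2).-1.
Variables (p nu s1 sr e tau cd ca : RR) (Om : {set 'I_N}) (x : 'cV[CC]_N).
Variables (U : 'M[CC]_(n1, r)) (V : 'M[CC]_(n2, r)).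
Variables (Ln L : 'M[CC]_(n1, r)) (Rn R : 'M[CC]_(n2, r)).
Hypotheses (p_gt0 : 0 < p) (sr_gt0 : 0 < sr) (sr_le : sr <= s1) (nu_ge0 : 0 <= nu).
Hypotheses (e_ge0 : 0 <= e) (e_le : 100 * e <= 1) (tau_ge0 : 0 <= tau).
Hypotheses (cd_ge0 : 0 <= cd) (cd_le : 50 * cd <= 1 / 100).
Hypotheses (ca_ge0 : 0 <= ca) (ca_le : 50 * ca <= 1 / 100).
Hypothesis balanced : adj Ln *m Ln = adj Rn *m Rn.
Hypothesis Ln_Rn : Ln *m adj Rn = hankel n1 n2 x.
Hypothesis tangent : forall (H : 'M[CC]_(n1, r)) (K : 'M[CC]_(n2, r)),
  PT U V (H *m adj Rn + Ln *m adj K) = H *m adj Rn + Ln *m adj K.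
Hypothesis Rn_up : forall H : 'M[CC]_(n1, r), frob2 (H *m adj Rn) <= s1 * frob2 H.
Hypothesis Rn_lo : forall H : 'M[CC]_(n1, r), sr * frob2 H <= frob2 (H *m adj Rn).
Hypothesis Ln_up : forall K : 'M[CC]_(n2, r), frob2 (Ln *m adj K) <= s1 * frob2 K.
Hypothesis Ln_lo : forall K : 'M[CC]_(n2, r), sr * frob2 K <= frob2 (Ln *m adj K).
Hypothesis Lnt_up : forall H : 'M[CC]_(n1, r), frob2 (adj Ln *m H) <= s1 * frob2 H.
Hypothesis Rnt_up : forall K : 'M[CC]_(n2, r), frob2 (adj Rn *m K) <= s1 * frob2 K.
Local Notation beta := (3 * nu * s1).
Hypotheses (Ln_row : forall a, rown2 Ln a <= beta) (Rn_row : forall b, rown2 Rn b <= beta).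
Hypotheses (L_row : forall a, rown2 L a <= beta) (R_row : forall b, rown2 R b <= beta).
Hypothesis aligned : adj (adj Ln *m L + adj Rn *m R) = adj Ln *m L + adj Rn *m R.
Hypothesis incoherent : forall T i, PT U V T = T ->
  cabs (Gadj n1 n2 T i 0) ^+ 2 <= 2 * nu * frob2 T.
Hypothesis rip : forall T, PT U V T = T ->
  `|\sum_i bw p Om i * cabs (Gadj n1 n2 T i 0) ^+ 2| <= 2 * e * frob2 T.
Hypothesis inner_bound : forall (H : 'M[CC]_(n1, r)) (K : 'M[CC]_(n2, r)),
  \sum_(i in Om | inner p tau i) cabs (Gadj n1 n2 (H *m adj K) i 0) ^+ 2 <=
  44 * p * (frob2 H * frob2 K).
Hypothesis edge_card : #|[set i in Om | ~~ inner p tau i]|%:R <= 6 * tau.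
Hypothesis edge_small : 12 * tau * nu <= p / 100.

Let dL := L - Ln.
Let dR := R - Rn.
Let D := frob2 dL + frob2 dR.
Hypothesis D_le : D <= cd * sr.

Local Notation G Z i := (Gadj n1 n2 Z i 0).
Let Um := L *m adj R - Ln *m adj Rn.
Let Tm := dL *m adj Rn + Ln *m adj dR.
Let Bm := dL *m adj dR.
Definition obs (Z : 'M[CC]_(n1, n2)) : RR := p^-1 * \sum_(i in Om) cabs (G Z i) ^+ 2.

Lemma LE : L = Ln + dL. Proof. by rewrite addrC subrK. Qed.
Lemma RE : R = Rn + dR. Proof. by rewrite addrC subrK. Qed.

Lemma UmE : Um = Tm + Bm.
Proof.
have := prod_perturb Ln dL Rn dR.
by rewrite /dL /dR ![_ + (_ - _)]addrC !subrK.
Qed.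

Lemma D_ge0 : 0 <= D. Proof. by rewrite addr_ge0 ?frob2_ge0. Qed.

Lemma sr1_gt0 : 0 < s1. Proof. exact: lt_le_trans sr_gt0 sr_le. Qed.

Lemma D_le_s1 : D <= s1.
Proof.
have cd1 : cd <= 1 by move: cd_le cd_ge0; lra.
apply: le_trans D_le _; apply: le_trans sr_le.
by rewrite ler_piMl ?(ltW sr_gt0).
Qed.

Lemma dLR_le : frob2 dL * frob2 dR <= D ^+ 2 / 4.
Proof. by rewrite /D; have := sqr_ge0 (frob2 dL - frob2 dR); gen_atoms; lra. Qed.

Lemma sum_split (F : 'I_N -> RR) :
  \sum_(i in Om) F i = \sum_(i in Om | inner p tau i) F i + \sum_(i in Om | ~~ inner p tau i) F i.
Proof. exact: bigID. Qed.

Lemma edge_sum_le (F : 'I_N -> RR) c : 0 <= c -> (forall i, F i <= c) ->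
  \sum_(i in Om | ~~ inner p tau i) F i <= 6 * tau * c.
Proof.
move=> c0 Fc; apply: (@le_trans _ _ (\sum_(i in [set i in Om | ~~ inner p tau i]) c)).
  rewrite (eq_bigl (fun i => i \in [set i in Om | ~~ inner p tau i])); last by move=> i; rewrite inE.
  by apply: ler_sum.
by rewrite sumr_const -[leLHS]mulr_natl ler_wpM2r.
Qed.

Lemma edge_tangent T : PT U V T = T ->
  p^-1 * \sum_(i in Om | ~~ inner p tau i) cabs (G T i) ^+ 2 <= 1 / 100 * frob2 T.
Proof.
move=> hT; have F0 := frob2_ge0 T.
have c0 : 0 <= 2 * nu * frob2 T by rewrite !mulr_ge0.
have h := edge_sum_le c0 (fun i => incoherent i hT).
have h2 := ler_wpM2r F0 edge_small.
have h3 : \sum_(i in Om | ~~ inner p tau i) cabs (G T i) ^+ 2 <= p * (1 / 100 * frob2 T).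
  by apply: le_trans h _; move: h2; gen_atoms; lra.
by rewrite ler_pdivrMl.
Qed.

Lemma bw_sum (F : 'I_N -> RR) : \sum_i bw p Om i * F i = p^-1 * \sum_(i in Om) F i - \sum_i F i.
Proof.
rewrite mulr_sumr [X in _ = X - _]big_mkcond -sumrB /=; apply: eq_bigr => i _.
by rewrite /bw; case: (i \in Om) => /=; ring.
Qed.

Lemma frob2_Gadj Z : \sum_i cabs (G Z i) ^+ 2 = frob2 (Gadj n1 n2 Z).
Proof. by rewrite -vnorm2E. Qed.

Lemma obs_tangent T : PT U V T = T ->
  frob2 (Gadj n1 n2 T) - 2 * e * frob2 T <= obs T <= frob2 (Gadj n1 n2 T) + 2 * e * frob2 T.
Proof.
move=> /rip; rewrite bw_sum frob2_Gadj -/(obs T) ler_norml => /andP[].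
by move: (obs T); gen_atoms; apply/andP; split; lra.
Qed.

Lemma inner_Bm : p^-1 * \sum_(i in Om | inner p tau i) cabs (G Bm i) ^+ 2 <= 11 * D ^+ 2.
Proof.
have := inner_bound dL dR; rewrite -/Bm => h.
have h2 := dLR_le.
rewrite ler_pdivrMl //; apply: le_trans h _.
by have := ler_wpM2l (ltW p_gt0) h2; move: (D ^+ 2); gen_atoms; lra.
Qed.

Lemma PT_Tm : PT U V Tm = Tm. Proof. exact: tangent. Qed.

(** The pointwise bounds are summed over Omega. On inner indices the product part has sampled energy
    at most 11 p D^2, and 5/4 of 11 is below 14. On edge indices the energy of the tangent part is
    at most 1/100 of |T|^2, by incoherence and the small number of samples there. *)
Lemma sampled_inner_ge :
  1 / 2 * obs Um + 1 / 8 * frob2 (Gadj n1 n2 Tm) - 1 / 100 * frob2 Tm - 14 * D ^+ 2 <=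
  p^-1 * \sum_(i in Om) complex.Re (Num.conj (G Um i) * (G Um i + G Bm i)).
Proof.
have ip : 0 <= p^-1 by rewrite invr_ge0 ltW.
have TE i : G Tm i = G Um i - G Bm i.
  have -> : G Um i = G Tm i + G Bm i by rewrite UmE GadjD [LHS]mxE.
  by rewrite addrK.
(* The edge coefficient 3/8 is 1/8 + 1/4: the term in |T|^2 is written over all of Omega and is
   repaid at the edge. *)
have pt : \sum_(i in Om) (1 / 2 * cabs (G Um i) ^+ 2 + 1 / 8 * cabs (G Tm i) ^+ 2)
   - 3 / 8 * \sum_(i in Om | ~~ inner p tau i) cabs (G Tm i) ^+ 2
   - 5 / 4 * \sum_(i in Om | inner p tau i) cabs (G Bm i) ^+ 2 <=
   \sum_(i in Om) complex.Re (Num.conj (G Um i) * (G Um i + G Bm i)).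
  rewrite !sum_split.
  have hin : \sum_(i in Om | inner p tau i) (1 / 2 * cabs (G Um i) ^+ 2 + 1 / 8 * cabs (G Tm i) ^+ 2) -
      5 / 4 * \sum_(i in Om | inner p tau i) cabs (G Bm i) ^+ 2 <=
      \sum_(i in Om | inner p tau i) complex.Re (Num.conj (G Um i) * (G Um i + G Bm i)).
    rewrite mulr_sumr -sumrB; apply: ler_sum => i _; rewrite TE; exact: cRe_inner_ge.
  have hout : \sum_(i in Om | ~~ inner p tau i) (1 / 2 * cabs (G Um i) ^+ 2 + 1 / 8 * cabs (G Tm i) ^+ 2) -
      3 / 8 * \sum_(i in Om | ~~ inner p tau i) cabs (G Tm i) ^+ 2 <=
      \sum_(i in Om | ~~ inner p tau i) complex.Re (Num.conj (G Um i) * (G Um i + G Bm i)).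
    rewrite mulr_sumr -sumrB; apply: ler_sum => i _; rewrite TE.
    by apply: le_trans (cRe_edge_ge _ _); lra.
  move: hin hout; move: (\sum_(i in Om | _) _) (\sum_(i in Om | _) _) (\sum_(i in Om | _) _)
    (\sum_(i in Om | _) _) (\sum_(i in Om | _) _) (\sum_(i in Om | _) _) => *; lra.
rewrite big_split /= -!mulr_sumr in pt.
have o1 := edge_tangent PT_Tm; have o2 := inner_Bm.
have := obs_tangent PT_Tm; rewrite /obs => /andP[lo _].
have hi : 2 * e * frob2 Tm <= 1 / 50 * frob2 Tm.
  apply: ler_wpM2r; first exact: frob2_ge0.
  by move: e_le e_ge0; lra.
exact: sampled_inner_real o1 o2 lo hi (frob2_ge0 _) (sqr_ge0 _) ip pt.
Qed.

Variables (A : {set 'I_N}) (xi f s : 'cV[CC]_N).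
Hypothesis xi_out : forall i, i \notin A -> xi i 0 = 0.
Hypothesis A_Om : A \subset Om.
Hypothesis xi_le : frob2 xi <= 4 * \sum_(i in A) cabs (G Um i) ^+ 2.
Hypothesis A_small : #|A|%:R * beta <= ca * sr * p.
Hypothesis residualE : residual Om f s L R = PiOm n1 n2 Om (Gadj n1 n2 Um) + xi.

(** On so few indices, pointwise bounds suffice: each summand has one factor with small rows, so
    every coordinate is at most beta times the squared norm of the other factor. *)
Lemma A_sum_le (H : 'M[CC]_(n1, r)) (K : 'M[CC]_(n2, r)) (L' : 'M[CC]_(n1, r)) (R' : 'M[CC]_(n2, r)) :
  (forall a, rown2 L' a <= beta) -> (forall b, rown2 R' b <= beta) ->
  \sum_(i in A) cabs (G (H *m adj R' + L' *m adj K) i) ^+ 2 <=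
  2 * (ca * sr * p * (frob2 H + frob2 K)).
Proof.
move=> L'b R'b.
apply: (@le_trans _ _ (\sum_(i in A) 2 * (beta * (frob2 H + frob2 K)))).
  apply: ler_sum => i _; rewrite GadjD mxE; apply: le_trans (cabs_sqrD_le _ _) _.
  by rewrite ler_pM2l // mulrDr lerD // ?Gadj_prod_le_l ?Gadj_prod_le_r.
have h := ler_wpM2r (addr_ge0 (frob2_ge0 H) (frob2_ge0 K)) A_small.
by rewrite sumr_const -[leLHS]mulr_natl mulrCA ler_pM2l // mulrA.
Qed.

Lemma dLE : dL *m adj R + Ln *m adj dR = Um.
Proof.
exact: prod_perturb_l.
Qed.

(** Differentiating the product L R^* along the error (dL, dR) gives Um + Bm and not Um; hence the
    inner products of Um with Um + Bm in the descent estimate. *)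
Lemma dRE : dL *m adj R + L *m adj dR = Um + Bm.
Proof.
have h : L *m adj dR = Ln *m adj dR + dL *m adj dR by rewrite -mulmxDl -LE.
by rewrite h addrA dLE.
Qed.

Lemma A_sum_Um : \sum_(i in A) cabs (G Um i) ^+ 2 <= 2 * (ca * sr * p * D).
Proof. by rewrite -dLE; exact: A_sum_le. Qed.

Lemma A_sum_Z : \sum_(i in A) cabs (G (Um + Bm) i) ^+ 2 <= 2 * (ca * sr * p * D).
Proof. by rewrite -dRE; exact: A_sum_le. Qed.

Lemma rinner_PiOm (v w : 'cV[CC]_N) :
  rinner (PiOm n1 n2 Om v) (PiOm n1 n2 Om w) =
  \sum_(i in Om) complex.Re (Num.conj (v i 0) * w i 0).
Proof.
rewrite rinnerE [RHS]big_mkcond; apply: eq_bigr => i _; rewrite big_ord1 !mxE.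
by case: ifP; rewrite ?mulr0.
Qed.

Lemma rinner_xi_ge (v : 'cV[CC]_N) :
  - (\sum_(i in A) cabs (v i 0) ^+ 2 + \sum_(i in A) cabs (G Um i) ^+ 2) <=
  rinner xi (PiOm n1 n2 Om v).
Proof.
pose vA : 'cV[CC]_N := \col_i (if i \in A then v i 0 else 0).
have -> : rinner xi (PiOm n1 n2 Om v) = rinner xi vA.
  rewrite !rinnerE; apply: eq_bigr => i _; rewrite !big_ord1 !mxE.
  case: (boolP (i \in A)) => [iA|/xi_out->]; last by rewrite conjC0 !mul0r.
  by rewrite (fintype.subsetP A_Om).
have -> : \sum_(i in A) cabs (v i 0) ^+ 2 = frob2 vA.
  rewrite -vnorm2E /vnorm2 big_mkcond; apply: eq_bigr => i _; rewrite mxE.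
  by case: ifP => // _; rewrite cabs0 expr0n.
have := @rinner_ge _ _ xi vA (1 / 4) ltac:(lra); move: xi_le.
move: (\sum_(i in A) _); gen_atoms; lra.
Qed.

Lemma sparse_ge : - (4 * ca * (sr * D)) <= p^-1 * rinner xi (PiOm n1 n2 Om (Gadj n1 n2 (Um + Bm))).
Proof.
rewrite ler_pdivlMl //; apply: le_trans (rinner_xi_ge _).
have := A_sum_Um; have := A_sum_Z.
by move: (\sum_(i in A) _) (\sum_(i in A) _) => a b; lra.
Qed.

Let W := imbalance L R.
Let D1 := adj Ln *m dL + adj dL *m Ln - (adj Rn *m dR + adj dR *m Rn).
Let D2 := adj dL *m dL - adj dR *m dR.
Let S := adj dL *m L + adj L *m dL - (adj dR *m R + adj R *m dR).
Let q := frob2 (nonhankel Um).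

Lemma WE : W = D1 + D2.
Proof.
rewrite /W /imbalance.
have hL : adj L *m L = adj Ln *m Ln + (adj Ln *m dL + adj dL *m Ln) + adj dL *m dL.
  by rewrite {1 2}LE adjD mulmxDl !mulmxDr !addrA.
have hR : adj R *m R = adj Ln *m Ln + (adj Rn *m dR + adj dR *m Rn) + adj dR *m dR.
  by rewrite balanced {1 2}RE adjD mulmxDl !mulmxDr !addrA.
rewrite hL hR /D1 /D2; exact: balance_reorder.
Qed.

(** As for the product, the derivative of the imbalance along the error counts the quadratic part
    twice, so the pair (W, D2) is treated like (Um, Bm). *)
Lemma SE : S = W + D2.
Proof.
rewrite /S.
have hL : adj dL *m L + adj L *m dL = adj Ln *m dL + adj dL *m Ln + adj dL *m dL + adj dL *m dL.
  exact: sym_perturb.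
have hR : adj dR *m R + adj R *m dR = adj Rn *m dR + adj dR *m Rn + adj dR *m dR + adj dR *m dR.
  exact: sym_perturb.
move: WE; rewrite /D1 /D2 => ->; rewrite hL hR; exact: balance_reorder2.
Qed.

Lemma D2_le : frob2 D2 <= 2 * D ^+ 2.
Proof.
apply: le_trans (frob2B_le _ _) _; rewrite ler_pM2l //.
have h1 := frob2M (adj dL) dL; have h2 := frob2M (adj dR) dR.
rewrite frob2_adj in h1; rewrite frob2_adj in h2.
by have := frob2_ge0 dL; have := frob2_ge0 dR; move: h1 h2; rewrite /D; gen_atoms; nra.
Qed.

Lemma Bm_le : frob2 (nonhankel Bm) <= 1 / 4 * D ^+ 2.
Proof.
have h1 := frob2M dL (adj dR); rewrite frob2_adj in h1.
have h2 := frob2_ge0 (Gadj n1 n2 Bm); have h3 := dLR_le.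
by rewrite frob2_nonhankel // /Bm; move: h1 h2 h3; rewrite /Bm; move: (D ^+ 2); gen_atoms; lra.
Qed.

Lemma tangent_lower : sr * D <= frob2 Tm + 1 / 4 * frob2 D1.
Proof.
have h : adj (adj Ln *m dL + adj Rn *m dR) = adj Ln *m dL + adj Rn *m dR.
  rewrite /dL /dR !mulmxBr addrACA -opprD [LHS]adjB aligned; congr (_ - _).
  by rewrite adjD !adjM !adjK.
have := procrustes_lower h; have := Rn_lo dL; have := Ln_lo dR.
by rewrite -/Tm -/D1 /D; gen_atoms; lra.
Qed.

Lemma nonhankel_LR : nonhankel (L *m adj R) = nonhankel Um.
Proof. by rewrite /Um Ln_Rn nonhankelD // nonhankelN // nonhankel_hankel // oppr0 addr0. Qed.

Lemma Gadj_UBm i : G (Um + Bm) i = G Um i + G Bm i.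
Proof. by rewrite GadjD [LHS]mxE. Qed.

(** The Hankel and non-Hankel energies of the tangent part appear with weight 1/8 each and recombine
    to |Tm|^2 / 8. The balancing term has weight lam/2 = 1/32, hence 1/256 for |D1|^2, which is
    exactly what 1/64 of [tangent_lower] asks for. All terms of order D^2 total at most 15 D^2 <= 15
    cd sr D. *)
Lemma descent_inner :
  1 / 2 * (obs Um + q) + 1 / 64 * frob2 W + (1 / 64 - 15 * cd - 4 * ca) * (sr * D) <=
  dirderiv p (1 / 16) Om f s L R (Um + Bm) S.
Proof.
have h1 := sampled_inner_ge; have h2 := tangent_lower; have h3 := sparse_ge.
have h4 := rinner_self_add_ge (nonhankel Um) (nonhankel Bm).
have h5 := rinner_self_add_ge W D2.
have nT : nonhankel Um - nonhankel Bm = nonhankel Tm.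
  by rewrite UmE nonhankelD // addrK.
have nW : W - D2 = D1 by rewrite WE addrK.
have nG := frob2_nonhankel n1_gt0 n2_gt0 Tm.
have DD : D ^+ 2 <= cd * (sr * D) by rewrite expr2 mulrA ler_wpM2r ?D_ge0.
have h6 := frob2_ge0 D1; have h7 := frob2_ge0 Tm; have h8 := Bm_le; have h9 := D2_le.
have h10 : 0 <= sr * D by rewrite mulr_ge0 ?D_ge0 // ltW.
rewrite nT in h4; rewrite nW in h5.
rewrite /dirderiv residualE nonhankel_LR [nonhankel (Um + Bm)]nonhankelD // SE rinnerDl rinner_PiOm [p^-1 * (_ + _)]mulrDr.
rewrite (eq_bigr (fun i => complex.Re (Num.conj (G Um i) * (G Um i + G Bm i)))); last first.
  by move=> i _; rewrite Gadj_UBm.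
apply: le_trans (@descent_real _ q _ (frob2 (nonhankel Tm)) _ _ (frob2 W) _ _ _ _ _ _ h1 _ h2 h6 (sqr_ge0 D) DD h7 h10 h3) _.
  by rewrite nG addrC subrK.
move: h4 h5 h8 h9; rewrite -/q; move: (p^-1 * _) (p^-1 * _) (D ^+ 2) => a b c; gen_atoms; lra.
Qed.

Lemma obs_ge0 Z : 0 <= obs Z.
Proof. by rewrite mulr_ge0 ?invr_ge0 ?sumr_ge0 // ?ltW // => i _; exact: sqr_ge0. Qed.

Lemma residual_sq_le : p^-1 * frob2 (PiOm n1 n2 Om (Gadj n1 n2 Um) + xi) <= 2 * (obs Um + 8 * ca * (sr * D)).
Proof.
have e1 : frob2 (PiOm n1 n2 Om (Gadj n1 n2 Um)) = \sum_(i in Om) cabs (G Um i) ^+ 2.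
  rewrite -vnorm2E /vnorm2 [RHS]big_mkcond; apply: eq_bigr => i _; rewrite mxE.
  by case: ifP => // _; rewrite cabs0 expr0n.
have h := frob2D_le (PiOm n1 n2 Om (Gadj n1 n2 Um)) xi; rewrite e1 in h.
have h2 := A_sum_Um; have h3 := xi_le.
rewrite ler_pdivrMl //; apply: le_trans h _.
have -> : p * (2 * (obs Um + 8 * ca * (sr * D))) =
  2 * \sum_(i in Om) cabs (G Um i) ^+ 2 + 16 * (ca * sr * p * D).
  by rewrite /obs; move: (\sum_(i in Om) _) => a; field; rewrite gt_eqF.
by move: h2 h3; move: (\sum_(i in Om) _) (\sum_(i in A) _) (ca * sr * p * D); gen_atoms; lra.
Qed.

Lemma dir_bound (Z : 'M[CC]_(n1, n2)) (S' : 'M[CC]_r) h : 0 <= h ->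
  obs Z <= 6 * s1 * h -> frob2 Z <= 4 * s1 * h -> frob2 S' <= 16 * s1 * h ->
  dirderiv p (1 / 16) Om f s L R Z S' <=
  1 / 2 * h + s1 * (18 * (obs Um + q) + 1 / 32 * frob2 W + 144 * ca * (sr * D)).
Proof.
move=> h0 hZ fZ fS; have s10 := sr1_gt0.
have o1 : p^-1 * rinner (PiOm n1 n2 Om (Gadj n1 n2 Um) + xi) (PiOm n1 n2 Om (Gadj n1 n2 Z)) <=
    9 * s1 * (2 * (obs Um + 8 * ca * (sr * D))) + (4 * (9 * s1))^-1 * obs Z.
  apply: (@le_trans _ _ (9 * s1 * (p^-1 * frob2 (PiOm n1 n2 Om (Gadj n1 n2 Um) + xi)) + (4 * (9 * s1))^-1 * obs Z)).
    have := @rinner_le _ _ (PiOm n1 n2 Om (Gadj n1 n2 Um) + xi) (PiOm n1 n2 Om (Gadj n1 n2 Z)) (9 * s1) ltac:(lra).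
    have -> : frob2 (PiOm n1 n2 Om (Gadj n1 n2 Z)) = \sum_(i in Om) cabs (G Z i) ^+ 2.
      rewrite -vnorm2E /vnorm2 [RHS]big_mkcond; apply: eq_bigr => i _; rewrite mxE.
      by case: ifP => // _; rewrite cabs0 expr0n.
    have ip : 0 <= p^-1 by rewrite invr_ge0 ltW.
    by move=> /(ler_wpM2l ip); rewrite /obs mulrDr !(mulrCA p^-1).
  by rewrite lerD2r ler_pM2l ?residual_sq_le //; lra.
have o2 := @rinner_le _ _ (nonhankel Um) (nonhankel Z) (6 * s1) ltac:(lra).
have o3 := @rinner_le _ _ W S' s1 s10.
have nZ : frob2 (nonhankel Z) <= 4 * s1 * h.
  by rewrite frob2_nonhankel //; have := frob2_ge0 (Gadj n1 n2 Z); lra.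
rewrite /dirderiv residualE nonhankel_LR -/W.
apply: dir_real s10 o1 o2 o3 hZ nZ fS _ h0.
exact: mulr_ge0 (ltW sr1_gt0) (frob2_ge0 _).
Qed.

Lemma small_sq h : 0 <= h -> 2 * (s1 * h + h * D) <= 4 * s1 * h.
Proof. by move=> h0; have := ler_wpM2r h0 D_le_s1; move: (D) => d; lra. Qed.

Lemma dLR_bounds : frob2 dL <= D /\ frob2 dR <= D.
Proof. by rewrite /D; have := frob2_ge0 dL; have := frob2_ge0 dR; gen_atoms; lra. Qed.

(** X is the tangent part, whose sampled energy the isometry controls. Y is a product with one
    factor error: the window count bounds it on inner indices with a factor D much smaller than s1,
    and row bounds handle it at the edge. *)
Lemma obs_split_le (X Y : 'M[CC]_(n1, n2)) h : 0 <= h -> PT U V X = X ->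
  frob2 X <= s1 * h ->
  \sum_(i in Om | inner p tau i) cabs (G Y i) ^+ 2 <= 44 * p * (h * D) ->
  (forall i, cabs (G Y i) ^+ 2 <= 4 * beta * h) ->
  obs (X + Y) <= 6 * s1 * h.
Proof.
move=> h0 hX fX inY eY; have ip : 0 <= p^-1 by rewrite invr_ge0 ltW.
have /andP[_ oX] := obs_tangent hX.
have nX : frob2 (Gadj n1 n2 X) <= frob2 X.
  by have := frob2_nonhankel n1_gt0 n2_gt0 X; have := frob2_ge0 (nonhankel X); lra.
have eX : 2 * e * frob2 X <= 1 / 50 * frob2 X.
  by apply: ler_wpM2r; [exact: frob2_ge0 | move: e_le e_ge0; lra].
have b0 : 0 <= 4 * beta * h by rewrite !mulr_ge0 // ltW // sr1_gt0.
have oY : obs Y <= 1 / 10 * (s1 * h).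
  rewrite /obs sum_split ler_pdivrMl //.
  have h1 := edge_sum_le b0 eY.
  have h2 := ler_wpM2r (mulr_ge0 (ltW sr1_gt0) h0) edge_small.
  have h3 : 44 * p * (h * D) <= p * (1 / 100 * (s1 * h)).
    have d1 : 50 * D <= 1 / 100 * s1.
      have := ler_wpM2r (ltW sr_gt0) cd_le; have := D_le; move: sr_le; move: (D) => d; lra.
    by have := ler_wpM2l (mulr_ge0 (ltW p_gt0) h0) d1; have := D_ge0; have := mulr_ge0 (mulr_ge0 (ltW p_gt0) h0) D_ge0; move: (D) => d; lra.
  have h4 : 0 <= p * (s1 * h) by rewrite !mulr_ge0 // ltW // sr1_gt0.
  exact: edge_real inY h1 h2 h3 h4.
have : obs (X + Y) <= 2 * (obs X + obs Y).
  rewrite /obs -mulrDr mulrCA ler_wpM2l // mulrDr !mulr_sumr -big_split /=.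
  by apply: ler_sum => i _; rewrite GadjD mxE -mulrDr cabs_sqrD_le.
have := mulr_ge0 (ltW sr1_gt0) h0.
by move: oX nX eX oY fX; move: (obs _) (obs _) (obs _); gen_atoms; lra.
Qed.

(** Taken at H equal to the gradient, the left side is |H|^2. The term |H|^2 / 2 is then absorbed,
    and the squared gradient is at most s1 times the energies that [descent_inner] provides. *)
Lemma dir_bound_l (H : 'M[CC]_(n1, r)) :
  dirderiv p (1 / 16) Om f s L R (H *m adj R) (adj H *m L + adj L *m H) <=
  1 / 2 * frob2 H + s1 * (18 * (obs Um + q) + 1 / 32 * frob2 W + 144 * ca * (sr * D)).
Proof.
have [bL bR] := dLR_bounds; have h0 := frob2_ge0 H.
have eR : H *m adj R = H *m adj Rn + H *m adj dR by rewrite -mulmxDr -adjD -RE.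
have eL : adj L *m H = adj Ln *m H + adj dL *m H by rewrite -mulmxDl -adjD -LE.
have HdR : frob2 (H *m adj dR) <= frob2 H * D.
  by apply: le_trans (frob2M _ _) _; rewrite frob2_adj ler_wpM2l.
have HdL : frob2 (adj dL *m H) <= frob2 H * D.
  by apply: le_trans (frob2M _ _) _; rewrite frob2_adj mulrC ler_wpM2l.
have LH : frob2 (adj L *m H) <= 4 * s1 * frob2 H.
  rewrite eL; apply: le_trans (frob2D_le _ _) _; apply: le_trans (small_sq h0).
  by rewrite ler_pM2l // lerD.
apply: dir_bound => //.
- rewrite eR; apply: obs_split_le => //.
  + by have := tangent H 0; rewrite adj0 mulmx0 addr0.
  + apply: le_trans (inner_bound _ _) _; apply: ler_wpM2l; first by rewrite mulr_ge0 // ltW.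
    exact: ler_wpM2l.
  + move=> i; apply: Gadj_prod_le_l => // b.
    by apply: le_trans (rown2B_le _ _ _) _; have := R_row b; have := Rn_row b; lra.
- rewrite eR; apply: le_trans (frob2D_le _ _) _; apply: le_trans (small_sq h0).
  by rewrite ler_pM2l // lerD.
- apply: le_trans (frob2D_le _ _) _.
  have -> : frob2 (adj H *m L) = frob2 (adj L *m H) by rewrite -frob2_adj adjM adjK.
  by move: LH; gen_atoms; lra.
Qed.

Lemma dir_bound_r (K : 'M[CC]_(n2, r)) :
  dirderiv p (1 / 16) Om f s L R (L *m adj K) (- (adj K *m R + adj R *m K)) <=
  1 / 2 * frob2 K + s1 * (18 * (obs Um + q) + 1 / 32 * frob2 W + 144 * ca * (sr * D)).
Proof.
have [bL bR] := dLR_bounds; have h0 := frob2_ge0 K.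
have eL : L *m adj K = Ln *m adj K + dL *m adj K by rewrite -mulmxDl -LE.
have eR : adj R *m K = adj Rn *m K + adj dR *m K by rewrite -mulmxDl -adjD -RE.
have KdL : frob2 (dL *m adj K) <= frob2 K * D.
  by apply: le_trans (frob2M _ _) _; rewrite frob2_adj mulrC ler_wpM2l.
have KdR : frob2 (adj dR *m K) <= frob2 K * D.
  by apply: le_trans (frob2M _ _) _; rewrite frob2_adj mulrC ler_wpM2l.
have RK : frob2 (adj R *m K) <= 4 * s1 * frob2 K.
  rewrite eR; apply: le_trans (frob2D_le _ _) _; apply: le_trans (small_sq h0).
  by rewrite ler_pM2l // lerD.
apply: dir_bound => //.
- rewrite eL; apply: obs_split_le => //.
  + by have := tangent 0 K; rewrite mul0mx add0r.
  + apply: le_trans (inner_bound _ _) _; apply: ler_wpM2l; first by rewrite mulr_ge0 // ltW.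
    by rewrite mulrC; exact: ler_wpM2l.
  + move=> i; apply: Gadj_prod_le_r => // b.
    by apply: le_trans (rown2B_le _ _ _) _; have := L_row b; have := Ln_row b; lra.
- rewrite eL; apply: le_trans (frob2D_le _ _) _; apply: le_trans (small_sq h0).
  by rewrite ler_pM2l // lerD.
- rewrite frob2N; apply: le_trans (frob2D_le _ _) _.
  have -> : frob2 (adj K *m R) = frob2 (adj R *m K) by rewrite -frob2_adj adjM adjK.
  by move: RK; gen_atoms; lra.
Qed.

Variables (ct BL BR : RR) (gL L' : 'M[CC]_(n1, r)) (gR R' : 'M[CC]_(n2, r)).
Hypotheses (ct_gt0 : 0 < ct) (ct_le : 200 * ct <= 1).
Hypotheses (BL_ge0 : 0 <= BL) (BR_ge0 : 0 <= BR).
Hypotheses (Ln_ball : rowball BL Ln) (Rn_ball : rowball BR Rn).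
Hypothesis gL_grad : is_gradL (loss n1 n2 r p (1 / 16) Om f s) L R gL.
Hypothesis gR_grad : is_gradR (loss n1 n2 r p (1 / 16) Om f s) L R gR.
Hypothesis L'_proj : is_proj (rowball BL) (L - toC (ct / s1) *: gL) L'.
Hypothesis R'_proj : is_proj (rowball BR) (R - toC (ct / s1) *: gR) R'.

(** The projection does not increase the distance to the truth, which lies in both balls. Expanding
    the squared distance after the plain gradient step leaves twice the correlation minus the
    squared gradient, compared in [step_real]. *)
Lemma descent_step :
  frob2 (L' - Ln) + frob2 (R' - Rn) <= (1 - ct / s1 * sr / 64) * D.
Proof.
have s10 := sr1_gt0.
have gl := gradLE n1_gt0 n2_gt0 gL_grad; have gr := gradRE n1_gt0 n2_gt0 gR_grad.
have hL := dir_bound_l gL; rewrite -gl -frob2E in hL.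
have hR := dir_bound_r gR; rewrite -gr -frob2E in hR.
have hI := descent_inner.
have eI : dirderiv p (1 / 16) Om f s L R (Um + Bm) S = rinner gL dL + rinner gR dR.
  by rewrite gl gr -dRE /S -[in RHS]dirderivD.
rewrite eI in hI.
have pL := proj_nonexpansive BL_ge0 L'_proj Ln_ball.
have pR := proj_nonexpansive BR_ge0 R'_proj Rn_ball.
have eL : L - toC (ct / s1) *: gL - Ln = dL - toC (ct / s1) *: gL by rewrite addrAC.
have eR : R - toC (ct / s1) *: gR - Rn = dR - toC (ct / s1) *: gR by rewrite addrAC.
rewrite eL [frob2 (dL - _)]frob2B frob2Z rinnerZr [rinner dL _]rinnerC in pL.
rewrite eR [frob2 (dR - _)]frob2B frob2Z rinnerZr [rinner dR _]rinnerC in pR.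
have hs : 0 <= sr * D by rewrite mulr_ge0 ?D_ge0 // ltW.
have := step_real s10 ct_gt0 ct_le cd_ge0 cd_le ca_ge0 ca_le (addr_ge0 (obs_ge0 Um) (frob2_ge0 (nonhankel Um))) (frob2_ge0 W) hs hI hL hR pL pR.
by rewrite /D; gen_atoms; lra.
Qed.

End Descent.

(** * Factors and singular values *)

Lemma mul_diagr m r (A : 'M[CC]_(m, r)) s i k : (A *m diagr r r s) i k = A i k * toC (s k).
Proof.
rewrite mxE (bigD1 k) //= mxE eqxx big1 ?addr0 // => j jk.
by rewrite mxE ifN ?mulr0.
Qed.

Lemma adj_diagr r s : adj (diagr r r s) = diagr r r s.
Proof.
apply/matrixP => i j; rewrite adjE !mxE eq_sym; case: eqP => [->|_]; last by rewrite conjC0.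
exact: conj_toC.
Qed.

Lemma cabs_toC_sqr x : cabs (toC x) ^+ 2 = x ^+ 2.
Proof. by rewrite cabs2 /= expr0n addr0. Qed.

Lemma frob2_mul_diagr m r (A : 'M[CC]_(m, r)) s :
  frob2 (A *m diagr r r s) = \sum_i \sum_j cabs (A i j) ^+ 2 * s j ^+ 2.
Proof.
apply: eq_bigr => i _; apply: eq_bigr => j _.
by rewrite mul_diagr cabsM exprMn cabs_toC_sqr.
Qed.

Lemma frob2_mul_diagr_le m r (A : 'M[CC]_(m, r)) (s : nat -> RR) c :
  (forall k : 'I_r, s k ^+ 2 <= c) -> frob2 (A *m diagr r r s) <= c * frob2 A.
Proof.
move=> h; rewrite frob2_mul_diagr /frob2 mulr_sumr; apply: ler_sum => i _.
by rewrite mulr_sumr; apply: ler_sum => j _; rewrite mulrC ler_wpM2r ?sqr_ge0.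
Qed.

Lemma frob2_mul_diagr_ge m r (A : 'M[CC]_(m, r)) (s : nat -> RR) c :
  (forall k : 'I_r, c <= s k ^+ 2) -> c * frob2 A <= frob2 (A *m diagr r r s).
Proof.
move=> h; rewrite frob2_mul_diagr /frob2 mulr_sumr; apply: ler_sum => i _.
by rewrite mulr_sumr; apply: ler_sum => j _; rewrite mulrC ler_wpM2l ?sqr_ge0.
Qed.

Lemma rown2_row m r (A : 'M[CC]_(m, r)) a : rown2 A a = frob2 (row a A).
Proof. by rewrite /frob2 big_ord1; apply: eq_bigr => j _; rewrite mxE. Qed.

Lemma frob2_mul_iso_le k m r (A : 'M[CC]_(k, m)) (U : 'M[CC]_(m, r)) :
  adj U *m U = 1%:M -> frob2 (A *m U) <= frob2 A.
Proof.
move=> UU; have := frob2_ge0 (A - A *m U *m adj U).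
by rewrite frob2B frob2_Miso // rinner_mulr adjK -frob2E; gen_atoms; lra.
Qed.

Section Factor.
Variables (m r : nat) (U : 'M[CC]_(m, r)) (Q : 'M[CC]_r) (sig : nat -> RR) (sr s1 : RR).
Hypotheses (UU : adj U *m U = 1%:M) (QQ : adj Q *m Q = 1%:M).
Hypotheses (sr_gt0 : 0 < sr) (sig_bd : forall k : 'I_r, sr <= sig k <= s1).
Local Notation D := (diagr r r (sqrtf sig)).
Let F := U *m D *m Q.

Lemma sqrtf_bd (k : 'I_r) : sr <= sqrtf sig k ^+ 2 <= s1.
Proof.
have /andP[h1 h2] := sig_bd k.
by rewrite /sqrtf sqr_sqrtr ?h1 // (le_trans (ltW sr_gt0)).
Qed.

Lemma frob2_mul_unitary k (A : 'M[CC]_(k, r)) : frob2 (A *m Q) = frob2 A.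
Proof. by rewrite -[Q]adjK frob2_Miso // adjK; exact: unitary_mulC. Qed.

Lemma factor_adj k (H : 'M[CC]_(k, r)) : H *m adj F = H *m adj Q *m D *m adj U.
Proof. by rewrite /F !adjM adj_diagr !mulmxA. Qed.

Lemma factor_up k (H : 'M[CC]_(k, r)) : frob2 (H *m adj F) <= s1 * frob2 H.
Proof.
rewrite factor_adj frob2_Miso //; apply: le_trans (_ : _ <= s1 * frob2 (H *m adj Q)) _.
  by apply: frob2_mul_diagr_le => j; have /andP[] := sqrtf_bd j.
by rewrite frob2_Miso.
Qed.

Lemma factor_lo k (H : 'M[CC]_(k, r)) : sr * frob2 H <= frob2 (H *m adj F).
Proof.
rewrite factor_adj frob2_Miso // -(frob2_Miso H QQ).
by apply: frob2_mul_diagr_ge => j; have /andP[] := sqrtf_bd j.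
Qed.

Lemma factor_adj_up k (H : 'M[CC]_(m, k)) : 0 <= s1 -> frob2 (adj F *m H) <= s1 * frob2 H.
Proof.
move=> s10; rewrite -frob2_adj adjM adjK /F !mulmxA frob2_mul_unitary.
apply: le_trans (_ : _ <= s1 * frob2 (adj H *m U)) _.
  by apply: frob2_mul_diagr_le => j; have /andP[] := sqrtf_bd j.
by rewrite ler_wpM2l // -[leRHS]frob2_adj frob2_mul_iso_le.
Qed.

Lemma factor_row nu a : 0 <= s1 -> rown2 U a <= nu -> rown2 F a <= s1 * nu.
Proof.
move=> s10 h; rewrite rown2_row /F !row_mul frob2_mul_unitary.
apply: le_trans (_ : _ <= s1 * frob2 (row a U)) _.
  by apply: frob2_mul_diagr_le => j; have /andP[] := sqrtf_bd j.
by rewrite -rown2_row ler_wpM2l.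
Qed.

Lemma diagr_sqrtf : D *m D = diagr r r sig.
Proof.
apply/matrixP => i k; rewrite mul_diagr !mxE; case: eqP => [->|_]; last by rewrite mul0r.
have /andP[h1 _] := sig_bd k.
by rewrite -toCM /sqrtf -expr2 sqr_sqrtr // (le_trans (ltW sr_gt0)).
Qed.

Lemma factor_gram : adj F *m F = adj Q *m diagr r r sig *m Q.
Proof.
rewrite /F !adjM adj_diagr -!mulmxA; congr (_ *m _).
by rewrite (mulmxA (adj U)) UU mul1mx mulmxA diagr_sqrtf.
Qed.

End Factor.

Lemma frob2_diagr_mul_le m1 m2 k (B : 'M[CC]_(m2, k)) (s : nat -> RR) (c : RR) : 0 <= c ->
  (forall i : 'I_m1, 0 <= s i <= c) -> frob2 (diagr m1 m2 s *m B) <= c ^+ 2 * frob2 B.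
Proof.
move=> c0 h.
apply: (@le_trans _ _ (\sum_(i < m1) \sum_(j < k) \sum_(l < m2 | i == l :> nat) c ^+ 2 * cabs (B l j) ^+ 2 : RR)).
  apply: ler_sum => i _; apply: ler_sum => j _; rewrite mxE.
  have [l il|no] := pickP (fun l : 'I_m2 => i == l :> nat); last first.
    rewrite big1 ?cabs0 ?expr0n ?sumr_ge0 // => [l _|l _]; last by rewrite mxE no mul0r.
    by rewrite mulr_ge0 ?sqr_ge0.
  have hl l' : l' != l -> (i == l' :> nat) = false.
    by move=> n; apply/negbTE; apply: contra n => /eqP e; apply/eqP/val_inj; rewrite /= -e (eqP il).
  rewrite (bigD1 l) //= big1 ?addr0; last by move=> l' n; rewrite mxE hl // mul0r.
  rewrite [leRHS](bigD1 l) //= [X in _ + X]big1 ?addr0; last by move=> l' /andP[e n]; rewrite hl in e.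
  rewrite mxE il cabsM exprMn cabs_toC_sqr ler_wpM2r ?sqr_ge0 //.
  by have /andP[h0 h1] := h i; rewrite lerXn2r ?nnegrE.
rewrite (eq_bigr (fun i : 'I_m1 => \sum_(l < m2 | i == l :> nat) \sum_j c ^+ 2 * cabs (B l j) ^+ 2)); last first.
  by move=> i _; rewrite exchange_big.
rewrite (exchange_big_dep xpredT) //= /frob2 mulr_sumr; apply: ler_sum => l _.
rewrite -mulr_sumr sumr_const -[leLHS]mulr_natl -[leRHS]mul1r ler_wpM2r //.
  by rewrite mulr_ge0 ?sqr_ge0 ?sumr_ge0 // => j _; exact: sqr_ge0.
rewrite lern1; apply/card_le1P => i ii i'; rewrite !inE.
by apply/idP/eqP => [h'|->//]; apply: val_inj; rewrite /= (eqP h') (eqP ii).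
Qed.

Section SvdForm.
Variables (m1 m2 r1 r2 : nat) (U : 'M[CC]_(m1, r1)) (V : 'M[CC]_(m2, r2)) (s : nat -> RR).
Hypotheses (UU : adj U *m U = 1%:M) (VV : adj V *m V = 1%:M).
Local Notation M := (U *m diagr r1 r2 s *m adj V).

Lemma rinner_svd (u : 'cV[CC]_m1) (v : 'cV[CC]_m2) :
  rinner (u *m adj v) M = rinner (adj U *m u) (diagr r1 r2 s *m (adj V *m v)).
Proof.
have e : adj v *m V = adj (adj V *m v) by rewrite adjM adjK.
by rewrite rinner_mulr adjK -mulmxA e -rinner_mulr -mulmxA rinner_mull.
Qed.

Lemma svd_form_le (c : RR) (u : 'cV[CC]_m1) (v : 'cV[CC]_m2) : 0 <= c -> (forall i : 'I_r1, 0 <= s i <= c) ->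
  rinner (u *m adj v) M <= c * Num.sqrt (frob2 u) * Num.sqrt (frob2 v).
Proof.
move=> c0 h; rewrite rinner_svd; apply: le_trans (rinner_le_sqrt _ _) _.
have iso k l (W : 'M[CC]_(k, l)) (w : 'cV[CC]_k) : adj W *m W = 1%:M -> frob2 (adj W *m w) <= frob2 w.
  by move=> WW; rewrite -frob2_adj adjM adjK -[leRHS]frob2_adj frob2_mul_iso_le.
rewrite [c * _]mulrC -mulrA; apply: ler_pM; rewrite ?sqrtr_ge0 ?ler_wsqrtr ?iso //.
have -> : c * Num.sqrt (frob2 v) = Num.sqrt (c ^+ 2 * frob2 v).
  by rewrite sqrtrM ?sqr_ge0 // sqrtr_sqr ger0_norm.
apply: ler_wsqrtr; apply: le_trans (frob2_diagr_mul_le _ c0 h) _.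
by rewrite ler_wpM2l ?sqr_ge0 ?iso.
Qed.

Lemma svd_form_top : (0 < r1)%N -> (0 < r2)%N ->
  exists u : 'cV[CC]_m1, exists v : 'cV[CC]_m2,
    [/\ frob2 u = 1, frob2 v = 1 & rinner (u *m adj v) M = s 0%N].
Proof.
move=> r10 r20; pose i : 'I_r1 := Ordinal r10; pose j : 'I_r2 := Ordinal r20.
have fd k (l : 'I_k) : frob2 (delta_mx l 0 : 'cV[CC]_k) = 1.
  rewrite -vnorm2E /vnorm2 (bigD1 l) //= big1 ?addr0 => [|l' n]; rewrite mxE ?eqxx ?(negbTE n) /=.
    by rewrite (cabs_toC ler01) expr1n.
  by rewrite cabs0 expr0n.
exists (U *m delta_mx i 0), (V *m delta_mx j 0); rewrite !frob2_isoM // !fd; split=> //.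
rewrite rinner_svd (mulmxA (adj U)) UU (mulmxA (adj V)) VV !mul1mx -colE.
rewrite rinnerE (bigD1 i) //= [X in _ + X]big1 ?addr0 => [|l n].
  rewrite big_ord1 !mxE !eqxx /=. ring.
by rewrite big_ord1 !mxE (negbTE n) /= conjC0 mul0r.
Qed.

End SvdForm.

(** Weyl's inequality for the largest singular value: the bilinear forms are tested at the top
    singular vectors of the first matrix. In this form only bilinear bounds on the perturbation are
    required. *)
Lemma svd_top_perturb m1 m2 r1 r2 r1' r2'
    (U : 'M[CC]_(m1, r1)) (V : 'M[CC]_(m2, r2)) (s : nat -> RR)
    (U' : 'M[CC]_(m1, r1')) (V' : 'M[CC]_(m2, r2')) (s' : nat -> RR) (d : RR) :
  adj U *m U = 1%:M -> adj V *m V = 1%:M -> adj U' *m U' = 1%:M -> adj V' *m V' = 1%:M ->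
  (0 < r1)%N -> (0 < r2)%N -> (forall i : 'I_r1', 0 <= s' i <= s' 0%N) -> 0 <= s' 0%N ->
  (forall (u : 'cV[CC]_m1) (v : 'cV[CC]_m2),
     rinner (u *m adj v) (U *m diagr r1 r2 s *m adj V - U' *m diagr r1' r2' s' *m adj V') <=
     d * Num.sqrt (frob2 u) * Num.sqrt (frob2 v)) ->
  s 0%N <= s' 0%N + d.
Proof.
move=> UU VV UU' VV' r10 r20 hs s0 hE.
have [u [v [fu fv e]]] := svd_form_top s UU VV r10 r20.
have := hE u v; have := svd_form_le UU' VV' u v s0 hs.
by rewrite rinnerBr e fu fv sqrtr1; move: (rinner _ _) => x; lra.
Qed.

Lemma specnorm_factor m r (U : 'M[CC]_(m, r)) (sig : nat -> RR) : (0 < r)%N ->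
  adj U *m U = 1%:M -> (forall i, 0 <= sig i) -> (forall i, sig i <= sig 0%N) ->
  specnorm (U *m diagr r r (sqrtf sig)) ^+ 2 = sig 0%N.
Proof.
move=> r0 UU s0 sle; pose i : 'I_r := Ordinal r0.
suff -> : specnorm (U *m diagr r r (sqrtf sig)) = Num.sqrt (sig 0%N) by rewrite sqr_sqrtr.
have ub : ubound [set Num.sqrt (vnorm2 (U *m diagr r r (sqrtf sig) *m (v : 'cV[CC]_r))) | v in [set v : 'cV[CC]_r | vnorm2 v = 1]]
    (Num.sqrt (sig 0%N)).
  move=> _ [v /= v1 <-]; apply: ler_wsqrtr; rewrite vnorm2E -mulmxA frob2_isoM //.
  apply: le_trans (frob2_diagr_mul_le (c := Num.sqrt (sig 0%N)) _ _ _) _; first exact: sqrtr_ge0.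
    by move=> k; rewrite /sqrtf sqrtr_ge0 ler_wsqrtr.
  by rewrite -vnorm2E v1 mulr1 sqr_sqrtr.
have mem : [set Num.sqrt (vnorm2 (U *m diagr r r (sqrtf sig) *m (v : 'cV[CC]_r))) | v in [set v : 'cV[CC]_r | vnorm2 v = 1]]%classic
    (Num.sqrt (sig 0%N)).
  exists (delta_mx i 0) => /=.
    rewrite /vnorm2 (bigD1 i) //= big1 ?addr0 => [|l' n]; rewrite mxE ?eqxx ?(negbTE n) /=.
      by rewrite (cabs_toC ler01) expr1n.
    by rewrite cabs0 expr0n.
  rewrite vnorm2E -mulmxA frob2_isoM // -vnorm2E /vnorm2 (bigD1 i) //= big1 ?addr0 => [|l n].
    by rewrite -colE !mxE eqxx cabs_toC_sqr /sqrtf sqr_sqrtr.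
  have nn : ((l : nat) == i) = false by apply: contraNF n => /eqP e; apply/eqP/val_inj.
  by rewrite -colE !mxE nn cabs0 expr0n.
apply/eqP; rewrite eq_le; apply/andP; split.
  by apply: ge_sup => //; exists (Num.sqrt (sig 0%N)).
by apply: ub_le_sup => //; exists (Num.sqrt (sig 0%N)).
Qed.

(** Columns are matched by index with those of the full unitary factors, so r <= m1 and r <= m2
    ensure that every column of U and V is tied to one of them. *)
Lemma trunc_svd_iso m1 m2 r (M : 'M[CC]_(m1, m2)) (U : 'M[CC]_(m1, r)) (V : 'M[CC]_(m2, r)) s :
  (r <= m1)%N -> (r <= m2)%N -> trunc_svd M U V s ->
  adj U *m U = 1%:M /\ adj V *m V = 1%:M.
Proof.
have iso m (W : 'M[CC]_(m, r)) (Wf : 'M[CC]_m) : (r <= m)%N -> adj Wf *m Wf = 1%:M ->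
    (forall i (k : 'I_r) (k' : 'I_m), (k : nat) = k' -> W i k = Wf i k') -> adj W *m W = 1%:M.
  move=> rm WW h; apply/matrixP => k l.
  have := congr1 (fun A : 'M[CC]_m => A (widen_ord rm k) (widen_ord rm l)) WW.
  have e : (widen_ord rm k == widen_ord rm l) = (k == l) by [].
  rewrite !mxE e => <-; apply: eq_bigr => i _.
  by rewrite !adjE (h _ k (widen_ord rm k)) // (h _ l (widen_ord rm l)).
move=> r1 r2 [Uf [Vf [[UU [VV _]] [hU hV]]]]; split.
  exact: iso r1 UU hU.
exact: iso r2 VV hV.
Qed.

(** * Initialization *)

Section Init.
Variables n1 n2 : nat.
Hypotheses (n1_gt0 : (0 < n1)%N) (n2_gt0 : (0 < n2)%N).
Local Notation N := (n1 + n2).-1.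
Local Notation onanti i := (fun ab : 'I_n1 * 'I_n2 => (ab.1 + ab.2 == i :> nat)%N).

Lemma antidiag_form_le (u : 'cV[CC]_n1) (v : 'cV[CC]_n2) (i : 'I_N) :
  cabs (\sum_(ab | onanti i ab) (u *m adj v) ab.1 ab.2) <=
  Num.sqrt (frob2 u) * Num.sqrt (frob2 v).
Proof.
rewrite -sqrtrM ?frob2_ge0 // -(ger0_norm (cabs_ge0 _)) -sqrtr_sqr ler_wsqrtr //.
rewrite (eq_bigr (fun ab : 'I_n1 * 'I_n2 => u ab.1 0 * Num.conj (v ab.2 0))); last first.
  by move=> ab _; rewrite mxE big_ord1 adjE.
apply: le_trans (cabs_sum_CS _ _ _) _.
have sq m (w : 'cV[CC]_m) : frob2 w = \sum_a cabs (w a 0) ^+ 2 by rewrite -vnorm2E.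
apply: ler_pM; [by apply: sumr_ge0 => ab _; exact: sqr_ge0|by apply: sumr_ge0 => ab _; exact: sqr_ge0| |].
  rewrite sq; apply: (sum_le_inj (P := xpredT) (F := fun a => cabs (u a 0) ^+ 2)) => //.
    by move=> a; exact: sqr_ge0.
  exact: onanti_inj1.
rewrite sq; under eq_bigr do rewrite cabs_conj.
apply: (sum_le_inj (P := xpredT) (F := fun a => cabs (v a 0) ^+ 2)) => //.
  by move=> a; exact: sqr_ge0.
exact: onanti_inj2.
Qed.

(** Each antidiagonal is a partial permutation matrix, of norm at most one, so the Hankel norm is at
    most the l1 norm of the entries. *)
Lemma hankel_form_le (z : 'cV[CC]_N) (u : 'cV[CC]_n1) (v : 'cV[CC]_n2) :
  rinner (u *m adj v) (hankel n1 n2 z) <=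
  (\sum_i cabs (z i 0)) * Num.sqrt (frob2 u) * Num.sqrt (frob2 v).
Proof.
rewrite rinnerC rinner_hankel // -mulrA mulr_suml; apply: ler_sum => i _.
apply: le_trans (Re_le_cabs _) _; rewrite cabsM cabs_conj.
by rewrite ler_wpM2l ?cabs_ge0 ?antidiag_form_le.
Qed.

Lemma PiOm_Dop Om (z : 'cV[CC]_N) : PiOm n1 n2 Om (Dop n1 n2 z) = Dop n1 n2 (PiOm n1 n2 Om z).
Proof. by apply/colP => i; rewrite !mxE; case: ifP; rewrite ?mulr0. Qed.

Lemma DopD (x y : 'cV[CC]_N) : Dop n1 n2 (x + y) = Dop n1 n2 x + Dop n1 n2 y.
Proof. by apply/colP => i; rewrite !mxE mulrDr. Qed.

Lemma DopN (x : 'cV[CC]_N) : Dop n1 n2 (- x) = - Dop n1 n2 x.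
Proof. by apply/colP => i; rewrite !mxE mulrN. Qed.

Variables (Om : {set 'I_N}) (x wn w : 'cV[CC]_N) (al p xmax : RR).
Hypotheses (al_ge0 : 0 <= al) (p_gt0 : 0 < p).
Hypothesis x_le : forall i, cabs (x i 0) <= xmax.
Hypothesis outliers : #|[set i in Om | wn i 0 != 0]|%:R <= al * p * N%:R.
Hypothesis w_thr : is_hthr (al * p) (PiOm n1 n2 Om (x + wn)) w.

Let zeta := PiOm n1 n2 Om wn - w.

(** On the sampled indices of T the leftover is -x. On a missed outlier it is v - x with v the
    thresholded data. Either way it is at most 2 xmax, on at most 2 alpha p N indices. *)
Lemma zeta_sum : \sum_i cabs (zeta i 0) <= 4 * (al * p * N%:R) * xmax.
Proof.
have apN : 0 <= al * p * N%:R by rewrite !mulr_ge0 // ltW.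
case: w_thr => T [cT [hT wE]].
have outl := outliers; set S := [set i in Om | wn i 0 != 0] in outl.
set v := PiOm n1 n2 Om (x + wn) in hT wE.
have ST : (#|S| <= #|T|)%N.
  rewrite cT leq_min; apply/andP; split; first by rewrite -[leqRHS]card_ord max_card.
  by rewrite truncn_ge_nat.
have Tle : #|T|%:R <= al * p * N%:R.
  apply: le_trans (_ : (Num.truncn (al * p * N%:R))%:R <= _); last by rewrite truncn_le.
  by rewrite ler_nat cT geq_minr.
have xm0 (i : 'I_N) : 0 <= xmax by exact: le_trans (cabs_ge0 _) (x_le i).
have vE i : v i 0 = if i \in Om then x i 0 + wn i 0 else 0 by rewrite !mxE.
have inT i : i \in T -> cabs (zeta i 0) <= xmax.
  move=> iT; rewrite /zeta wE !mxE iT; case: ifP => iO; last by rewrite subrr cabs0 xm0.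
  by rewrite opprD addrCA subrr addr0 cabsN.
have out i : i \notin T -> i \notin S -> zeta i 0 = 0.
  move=> /negbTE iT; rewrite /zeta wE !mxE iT inE; case: (i \in Om) => /=; last by rewrite subr0.
  by rewrite negbK => /eqP->; rewrite subr0.
have inS i : i \in S -> i \notin T -> cabs (zeta i 0) <= 2 * xmax.
  move=> iS iT.
  (* A kept index j that is no outlier carries the value x_j or 0, and it dominates the missed v_i.
     Such j exists, for otherwise T would be a proper subset of S, against |S| <= |T|. *)
  have [j /andP[jT jS]|no] := pickP (fun j => (j \in T) && (j \notin S)); last first.
    have sub : T \subset S by apply/fintype.subsetP => j jT; have := no j; rewrite jT => /negbFE.
    have : (#|T| < #|S|)%N by apply: proper_card; apply/properP; split=> //; exists i.
    by rewrite ltnNge ST.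
  have hv : cabs (v i 0) <= xmax.
    apply: le_trans (hT j i jT iT) _; rewrite vE; case: ifP => jO; last by rewrite cabs0 xm0.
    by move: jS; rewrite inE jO /= negbK => /eqP->; rewrite addr0.
  have iO : i \in Om by move: iS; rewrite inE => /andP[].
  have -> : zeta i 0 = v i 0 - x i 0.
    by rewrite /zeta wE vE iO !mxE (negbTE iT) iO subr0 addrC addKr.
  by apply: le_trans (cabsD _ _) _; rewrite cabsN mulr_natl mulr2n lerD.
apply: (@le_trans _ _ (\sum_(i in T :|: S) 2 * xmax)).
  rewrite [leRHS]big_mkcond; apply: ler_sum => i _; rewrite finset.in_setU.
  case: (boolP (i \in T)) => iT /=; first by rewrite mulr_natl mulr2n -[leLHS]addr0 lerD ?inT ?xm0.
  case: (boolP (i \in S)) => iS; first exact: inS.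
  by rewrite out // cabs0.
have cU : #|T :|: S|%:R <= 2 * (al * p * N%:R).
  apply: (@le_trans _ _ (#|T|%:R + #|S|%:R)); last by rewrite mulr_natl mulr2n lerD.
  by rewrite -natrD ler_nat cardsU leq_subr.
have xm := xm0 (Ordinal (ord_sumP n1_gt0 n2_gt0 (Ordinal n1_gt0) (Ordinal n2_gt0))).
have := ler_wpM2r xm cU.
have -> : 4 * (al * p * N%:R) * xmax = 2 * (2 * (al * p * N%:R) * xmax) by ring.
by move=> h; rewrite sumr_const -[leLHS]mulr_natl [leLHS]mulrCA ler_pM2l.
Qed.

(** The initial matrix minus the truth is the Hankel matrix of the sampling error plus 1/p times
    that of the leftover outliers; the factor p in the l1 bound cancels 1/p. *)
Lemma init_form (e : RR) (u : 'cV[CC]_n1) (v : 'cV[CC]_n2) :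
  (forall (u : 'cV[CC]_n1) (v : 'cV[CC]_n2),
    rinner (u *m adj v) (hankel n1 n2 (reweighted x p Om)) <=
    e * Num.sqrt (frob2 u) * Num.sqrt (frob2 v)) ->
  rinner (u *m adj v)
    (toC p^-1 *: Gop n1 n2 (PiOm n1 n2 Om (Dop n1 n2 x + Dop n1 n2 wn) - Dop n1 n2 w)
     - hankel n1 n2 x) <=
  (e + 4 * (al * N%:R) * xmax) * Num.sqrt (frob2 u) * Num.sqrt (frob2 v).
Proof.
move=> hx.
have e1 : toC p^-1 *: Gop n1 n2 (PiOm n1 n2 Om (Dop n1 n2 x + Dop n1 n2 wn) - Dop n1 n2 w)
     - hankel n1 n2 x = hankel n1 n2 (reweighted x p Om) + toC p^-1 *: hankel n1 n2 zeta.
  rewrite -DopD PiOm_Dop -DopN -DopD Gop_Dop // -!hankelZ // -[hankel n1 n2 x]scale1r.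
  rewrite -scaleNr -!hankelZ // -!hankelD //; congr (hankel _ _ _).
  apply/colP => i; rewrite /zeta /reweighted /bw !mxE.
  case: ifP => iO /=.
    by rewrite toCD toCN mul1r; move: (toC _) => q; rewrite (_ : toC 1 = 1) //; ring.
  by rewrite mul0r (sub0r (1 : RR)) toCN (_ : toC 1 = 1) //; ring.
rewrite e1 rinnerDr rinnerZr.
have h1 := hx u v; have h2 := hankel_form_le zeta u v.
have ip : 0 <= p^-1 by rewrite invr_ge0 ltW.
set U := Num.sqrt (frob2 u) in h1 h2 *; set V := Num.sqrt (frob2 v) in h1 h2 *.
have U0 : 0 <= U by exact: sqrtr_ge0.
have V0 : 0 <= V by exact: sqrtr_ge0.
have h3 : p^-1 * rinner (u *m adj v) (hankel n1 n2 zeta) <= 4 * (al * N%:R) * xmax * U * V.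
  rewrite ler_pdivrMl //; apply: le_trans h2 _.
  have -> : p * (4 * (al * N%:R) * xmax * U * V) = 4 * (al * p * N%:R) * xmax * U * V by ring.
  by rewrite !ler_wpM2r // zeta_sum.
by have := lerD h1 h3; rewrite -!mulrDl.
Qed.

End Init.

Lemma init_top n1 n2 r (n1_gt0 : (0 < n1)%N) (n2_gt0 : (0 < n2)%N)
    (U : 'M[CC]_(n1, r)) (V : 'M[CC]_(n2, r)) (M H : 'M[CC]_(n1, n2)) (sig : nat -> RR)
    Uf Vf (s0 : nat -> RR) (d : RR) : (0 < r)%N ->
  compact_svd H U V sig -> full_svd M Uf Vf s0 ->
  (forall (u : 'cV[CC]_n1) (v : 'cV[CC]_n2), rinner (u *m adj v) (M - H) <=
     d * Num.sqrt (frob2 u) * Num.sqrt (frob2 v)) ->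
  sig 0%N - d <= s0 0%N <= sig 0%N + d.
Proof.
move=> r0 [UU [VV [sp [sm HE]]]] [UfU [VfV [tp [tm ME]]]] h.
rewrite ME HE in h.
have b1 (i : 'I_r) : 0 <= sig i <= sig 0%N by rewrite (ltW (sp i _)) //= sm //=.
have b2 (i : 'I_n1) : 0 <= s0 i <= s0 0%N by rewrite tp tm.
apply/andP; split; last first.
  exact: (svd_top_perturb UfU VfV UU VV n1_gt0 n2_gt0 b1 (ltW (sp _ r0)) h).
rewrite lerBlDr; apply: (svd_top_perturb UU VV UfU VfV r0 r0 b2 (tp _)) => u v.
(* Replacing u by -u reverses the difference, so a one-sided bound serves both directions. *)
have := h (- u) v; rewrite mulNmx rinnerNl frob2N -rinnerNr opprB //.
Qed.

(** * Contraction *)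

(** The squared row norms of U sum to r >= 1, which gives m nu >= 1. Positivity follows as well:
    [Num.sqrt] of a negative number is 0, so nu <= 0 would make all rows vanish. *)
Lemma norm2inf_row m r (U : 'M[CC]_(m, r)) (nu : RR) : (0 < m)%N -> (0 < r)%N ->
  adj U *m U = 1%:M -> norm2inf U <= Num.sqrt nu ->
  [/\ 0 < nu, forall a, rown2 U a <= nu & 1 <= m%:R * nu].
Proof.
move=> m0 r0 UU h.
have row a : rown2 U a <= Num.sqrt nu ^+ 2.
  rewrite -[leLHS]sqr_sqrtr ?rown2_ge0 // lerXn2r ?nnegrE ?sqrtr_ge0 //.
  apply: le_trans h; exact: (le_bigmax _ (fun a => Num.sqrt (rown2 U a))).
have fU : frob2 U = r%:R.
  have e : r%:R = toC r%:R :> CC by rewrite toC_is_real rmorph_nat.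
  by rewrite frob2E /rinner UU mxtrace1 e.
have r1 : 1 <= r%:R :> RR by rewrite ler1n.
have total : 1 <= m%:R * Num.sqrt nu ^+ 2.
  apply: le_trans r1 _; rewrite -fU /frob2 mulr_natl.
  by apply: le_trans (ler_sum _ (fun a _ => row a)) _; rewrite sumr_const card_ord.
have nu0 : 0 < nu.
  rewrite ltNge; apply/negP => nu0; move: total.
  by rewrite ler0_sqrtr // expr0n mulr0 ler10.
have e : Num.sqrt nu ^+ 2 = nu by rewrite sqr_sqrtr // ltW.
by rewrite e in total; split=> // a; have := row a; rewrite e.
Qed.

Lemma antidiag_split n1 n2 (i : 'I_(n1 + n2).-1) : (0 < n1)%N -> (0 < n2)%N ->
  exists a : 'I_n1, exists b : 'I_n2, (a + b = i :> nat)%N.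
Proof.
move=> h1 h2; have hi := ltn_ord i.
have ha : (minn i n1.-1 < n1)%N by lia.
have hb : (i - minn i n1.-1 < n2)%N by lia.
by exists (Ordinal ha), (Ordinal hb) => /=; lia.
Qed.

Lemma hankel_entry_le n1 n2 r (U : 'M[CC]_(n1, r)) (V : 'M[CC]_(n2, r)) x (sig : nat -> RR) (s1 nu : RR) i :
  (0 < n1)%N -> (0 < n2)%N -> 0 <= s1 -> 0 <= nu ->
  hankel n1 n2 x = U *m diagr r r sig *m adj V ->
  (forall k : 'I_r, 0 <= sig k <= s1) ->
  (forall a, rown2 U a <= nu) -> (forall b, rown2 V b <= nu) ->
  cabs (x i 0) <= s1 * nu.
Proof.
move=> n1_gt0 n2_gt0 s10 nu0 hE hs hU hV.
have [a [b ab]] := antidiag_split i n1_gt0 n2_gt0.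
have -> : x i 0 = (U *m diagr r r sig *m adj V) a b.
  by rewrite -hE hankelE //; congr (x _ _); apply: val_inj.
rewrite -(@ler_pXn2r _ 2) ?nnegrE ?cabs_ge0 ?mulr_ge0 //.
apply: le_trans (prod_entry_le _ _ _ _) _.
have h1 : rown2 (U *m diagr r r sig) a <= s1 ^+ 2 * nu.
  rewrite rown2_row row_mul; apply: le_trans (_ : _ <= s1 ^+ 2 * frob2 (row a U)) _.
    by apply: frob2_mul_diagr_le => k; have /andP[h0 h1] := hs k; rewrite lerXn2r ?nnegrE.
  by rewrite -rown2_row ler_wpM2l ?sqr_ge0.
apply: le_trans (ler_pM (rown2_ge0 _ _) (rown2_ge0 _ _) h1 (hV b)) _.
by rewrite exprMn -mulrA -expr2.
Qed.

Lemma dist_sqr_le m1 m2 r (Ln L : 'M[CC]_(m1, r)) (Rn R : 'M[CC]_(m2, r)) Q :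
  adj Q *m Q = 1%:M ->
  dist Ln Rn L R ^+ 2 <= frob2 (L - Ln *m Q) + frob2 (R - Rn *m Q).
Proof.
move=> QQ; have f0 : 0 <= frob2 (L - Ln *m Q) + frob2 (R - Rn *m Q).
  by rewrite addr_ge0 ?frob2_ge0.
rewrite -[leRHS](sqr_sqrtr f0) lerXn2r ?nnegrE ?sqrtr_ge0 // ler_wsqrtr //.
apply: ge_inf; last by exists Q.
by exists 0 => _ [Q' _ <-]; rewrite addr_ge0 ?frob2_ge0.
Qed.

Lemma sparse_real (a al p N nu s1 sr ca : RR) :
  9 * (al * (N * nu) * s1) * p <= ca * sr * p ->
  a * (3 * nu * s1) <= 3 * (al * p * N) * (3 * nu * s1) ->
  a * (3 * nu * s1) <= ca * sr * p.
Proof.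
move=> h1 h2; apply: le_trans h2 _; apply: le_trans h1.
by rewrite [leLHS](_ : _ = 9 * (al * (N * nu) * s1) * p) //; ring.
Qed.

Lemma rate_real (ct z : RR) : 0 <= z -> z <= ct -> 200 * ct <= 1 -> 0 <= 1 - z / 64 <= 1.
Proof. by move=> *; apply/andP; split; lra. Qed.

(** The middle term is the radius of the balls. Its lower bound keeps the rotated ground-truth
    factors inside, and its upper bound is the row bound used for the iterates. *)
Lemma init_real (s1 sr nu e ca al N s0 : RR) : 0 < s1 -> 0 <= nu ->
  100 * e <= 1 -> 50 * ca <= 1 / 100 -> sr <= s1 ->
  9 * (al * (N * nu) * s1) <= ca * sr -> 0 <= ca ->
  s1 - (s1 * e + 4 * (al * N) * (s1 * nu)) <= s0 <= s1 + (s1 * e + 4 * (al * N) * (s1 * nu)) ->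
  nu * s1 <= 2 * nu * s0 <= 3 * nu * s1.
Proof.
move=> s10 nu0 he hca hs hal ca0 /andP[h1 h2].
have k1 : ca * sr <= ca * s1 by rewrite ler_wpM2l.
have k2 := ler_wpM2r (ltW s10) hca; have k3 := ler_wpM2r (ltW s10) he.
have k4 : 4 * (al * N) * (s1 * nu) <= 1 / 4 * s1 by lra.
have k5 : 1 / 2 * s1 <= s0 by lra.
have k6 : s0 <= 3 / 2 * s1 by lra.
have := ler_wpM2l nu0 k5; have := ler_wpM2l nu0 k6.
by move=> *; apply/andP; split; lra.
Qed.

Section Contraction.
Variables (n1 n2 r : nat).
Hypotheses (n1_gt0 : (0 < n1)%N) (n2_gt0 : (0 < n2)%N) (r_gt0 : (0 < r)%N).
Local Notation N := (n1 + n2).-1.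
Variables (x wn : 'cV[CC]_N) (Un : 'M[CC]_(n1, r)) (Vn : 'M[CC]_(n2, r)) (sig : nat -> RR).
Variables (p al nu e tau cd ca ct : RR) (Om : {set 'I_N}).
Hypothesis csvd : compact_svd (hankel n1 n2 x) Un Vn sig.
Hypotheses (p_gt0 : 0 < p) (al_ge0 : 0 <= al) (nu_ge0 : 0 <= nu).
Hypotheses (e_ge0 : 0 <= e) (e_le : 100 * e <= 1) (tau_ge0 : 0 <= tau).
Hypotheses (cd_ge0 : 0 <= cd) (cd_le : 50 * cd <= 1 / 100).
Hypotheses (ca_ge0 : 0 <= ca) (ca_le : 50 * ca <= 1 / 100).
Hypotheses (ct_gt0 : 0 < ct) (ct_le : 200 * ct <= 1).
Hypotheses (U_row : forall a, rown2 Un a <= nu) (V_row : forall b, rown2 Vn b <= nu).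
Local Notation s1 := (sig 0%N).
Local Notation sr := (sig r.-1).
Hypothesis rip : forall T, PT Un Vn T = T ->
  `|\sum_i bw p Om i * cabs (Gadj n1 n2 T i 0) ^+ 2| <= 2 * e * frob2 T.
Hypothesis counts : forall l u : nat, (l <= u)%N ->
  #|[set i in Om | (l <= i < u)%N]|%:R <= 2 * p * (u - l)%:R + tau.
Hypothesis tau_le : tau <= p * (minn n1 n2)%:R.
Hypothesis edge_small : 12 * tau * nu <= p / 100.
Hypothesis al_small : 9 * (al * (N%:R * nu) * s1) <= ca * sr.
Hypothesis outliers : #|[set i in Om | wn i 0 != 0]|%:R <= al * p * N%:R.

Local Notation f := (Dop n1 n2 x + Dop n1 n2 wn).
Local Notation Ln := (Un *m diagr r r (sqrtf sig)).
Local Notation Rn := (Vn *m diagr r r (sqrtf sig)).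

Lemma sr_gt0 : 0 < sr.
Proof. by case: csvd => _ [_ [h _]]; apply: h; rewrite prednK. Qed.

Lemma sig_bounds (k : 'I_r) : sr <= sig k <= s1.
Proof.
case: csvd => _ [_ [_ [h _]]]; have hk := ltn_ord k.
have hk' : (k <= r.-1)%N by rewrite -ltnS prednK.
have rr : (r.-1 < r)%N by rewrite ltn_predL.
by apply/andP; split; apply: h; rewrite ?hk' ?hk ?rr.
Qed.

Lemma sr_le_s1 : sr <= s1.
Proof. by have /andP[h1 h2] := sig_bounds (Ordinal r_gt0). Qed.

Section Step.
Variables (L L' gL : 'M[CC]_(n1, r)) (R R' gR : 'M[CC]_(n2, r)) (s : 'cV[CC]_N) (ga B : RR).
Hypotheses (ga12 : 1 <= ga <= 2) (B_ge : nu * s1 <= B) (B_le : B <= 3 * nu * s1).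
Hypotheses (L_ball : rowball B L) (R_ball : rowball B R).
Hypothesis s_thr : is_hthr (ga * al * p) (PiOm n1 n2 Om (f - Gadj n1 n2 (L *m adj R))) s.
Hypothesis gL_grad : is_gradL (loss n1 n2 r p (1 / 16) Om f s) L R gL.
Hypothesis gR_grad : is_gradR (loss n1 n2 r p (1 / 16) Om f s) L R gR.
Hypothesis L'_proj : is_proj (rowball B) (L - toC (ct / s1) *: gL) L'.
Hypothesis R'_proj : is_proj (rowball B) (R - toC (ct / s1) *: gR) R'.
Hypothesis close : dist Ln Rn L R ^+ 2 <= cd * sr.

(** The ground truth is replaced by its rotation by the optimal Q, which preserves the product, the
    equality of Gram matrices, the singular values and the row norms. The distance before the step
    is then exact, and the one after is bounded with the same Q. *)
Lemma hsgd_step : dist Ln Rn L' R' ^+ 2 <= (1 - ct / s1 * sr / 64) * dist Ln Rn L R ^+ 2.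
Proof.
have sr0 := sr_gt0; have srs1 := sr_le_s1; have s10 : 0 < s1 := lt_le_trans sr0 srs1.
have [UU [VV [sp [sm HE]]]] := csvd.
have [Q [QQ dE aligned]] := procrustes L Ln R Rn.
have B0 : 0 <= B by apply: le_trans B_ge; rewrite mulr_ge0 // ltW.
have D0 : 0 <= frob2 (L - Ln *m Q) + frob2 (R - Rn *m Q) by rewrite addr_ge0 ?frob2_ge0.
have d2 : dist Ln Rn L R ^+ 2 = frob2 (L - Ln *m Q) + frob2 (R - Rn *m Q).
  by rewrite dE sqr_sqrtr.
apply: le_trans (dist_sqr_le _ _ _ _ QQ) _.
have cl := close; rewrite d2 in cl *.
set Lq := Ln *m Q in aligned cl D0 *; set Rq := Rn *m Q in aligned cl D0 *.
have LqRq : Lq *m adj Rq = hankel n1 n2 x.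
  rewrite /Lq /Rq adjM mulmxA -(mulmxA Ln) (unitary_mulC QQ) mulmx1 adjM adj_diagr HE.
  by rewrite mulmxA -(mulmxA Un) (diagr_sqrtf sr0 sig_bounds).
pose u := Gadj n1 n2 (L *m adj R - Lq *m adj Rq).
have uE : f - Gadj n1 n2 (L *m adj R) = Dop n1 n2 wn - u.
  rewrite /u LqRq GadjB // -(Gop_Dop n1_gt0 n2_gt0 x) Gadj_Gop // opprB addrA.
  by congr (_ - _); rewrite addrC.
have outl : #|[set i in Om | Dop n1 n2 wn i 0 != 0]|%:R <= al * p * N%:R.
  rewrite (_ : [set i in Om | _] = [set i in Om | wn i 0 != 0]) //.
  by apply/setP => i; rewrite !inE mxE mulf_eq0 negb_or sqvs_neq0.
have thr := s_thr; rewrite uE in thr.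
have [A [xi [cA resE xi_out A_Om xi_le]]] := threshold_residual ga12 al_ge0 p_gt0 outl thr.
have resid : residual Om f s L R = PiOm n1 n2 Om u + xi.
  rewrite -resE /residual; congr (PiOm _ _ _ _).
  rewrite /u LqRq GadjB // -(Gop_Dop n1_gt0 n2_gt0 x) Gadj_Gop //.
  by rewrite opprD addrA; congr (_ - _); rewrite addrAC.
have row3 nu' : nu' <= s1 * nu -> nu' <= 3 * nu * s1.
  by move=> h; apply: le_trans h _; rewrite mulrC -mulrA ler_peMl ?mulr_ge0 ?(ltW s10) //; lra.
have A_small : #|A|%:R * (3 * nu * s1) <= ca * sr * p.
  have := ler_wpM2r (mulr_ge0 (mulr_ge0 (ler0n _ 3) nu_ge0) (ltW s10)) cA.
  have := ler_wpM2r (ltW p_gt0) al_small; exact: sparse_real.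
have inB m (Z : 'M[CC]_(m, r)) : rowball B Z -> forall a, rown2 Z a <= 3 * nu * s1.
  by move=> /(rowballP B0) h a; apply: le_trans (h a) B_le.
have Lq_row a : rown2 Lq a <= s1 * nu by exact: (factor_row QQ sr0 sig_bounds (ltW s10)).
have Rq_row a : rown2 Rq a <= s1 * nu by exact: (factor_row QQ sr0 sig_bounds (ltW s10)).
have swap m k (F : 'M[CC]_(m, r)) (K : 'M[CC]_(k, r)) : frob2 (F *m adj K) = frob2 (K *m adj F).
  by rewrite -frob2_adj adjM adjK.
have ball m (F : 'M[CC]_(m, r)) : (forall a, rown2 F a <= s1 * nu) -> rowball B F.
  by move=> h; apply/rowballP => // a; apply: le_trans (h a) _; rewrite mulrC.
have tan (H : 'M[CC]_(n1, r)) (K : 'M[CC]_(n2, r)) :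
    PT Un Vn (H *m adj Rq + Lq *m adj K) = H *m adj Rq + Lq *m adj K.
  have -> : Lq *m adj K = Un *m adj (K *m adj Q *m diagr r r (sqrtf sig)).
    by rewrite /Lq !adjM adjK adj_diagr !mulmxA.
  by rewrite (factor_adj Vn Q sig) PT_tangent.
have tN : tau <= p * N%:R.
  apply: le_trans tau_le _; rewrite ler_pM2l // ler_nat.
  by move: n1_gt0 n2_gt0; clear; lia.
have := (descent_step n1_gt0 n2_gt0 p_gt0 sr0 srs1 nu_ge0 e_ge0 e_le cd_ge0 cd_le ca_ge0 ca_le
  (etrans (factor_gram Q UU sr0 sig_bounds) (esym (factor_gram Q VV sr0 sig_bounds)))
  LqRq tan
  (fun H => factor_up VV QQ sr0 sig_bounds H) (fun H => factor_lo VV QQ sr0 sig_bounds H)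
  (fun K => eq_ind_r (fun t => t <= _) (factor_up UU QQ sr0 sig_bounds K) (swap _ _ _ _))
  (fun K => eq_ind_r (fun t => _ <= t) (factor_lo UU QQ sr0 sig_bounds K) (swap _ _ _ _))
  (fun H => factor_adj_up UU QQ sr0 sig_bounds H (ltW s10))
  (fun H => factor_adj_up VV QQ sr0 sig_bounds H (ltW s10))
  (fun a => row3 _ (Lq_row a)) (fun a => row3 _ (Rq_row a)) (inB _ _ L_ball) (inB _ _ R_ball)
  aligned (fun T i => cabs_Gadj_le n1_gt0 n2_gt0 UU VV U_row V_row i)
  rip (fun H K => Gadj_prod_inner n1_gt0 n2_gt0 p_gt0 tau_ge0 counts tau_le H K)
  (card_edge n1_gt0 n2_gt0 p_gt0 tau_ge0 counts tau_le tN) edge_small cl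
  xi_out A_Om xi_le A_small resid ct_gt0 ct_le B0 B0 (ball _ _ Lq_row) (ball _ _ Rq_row)
  gL_grad gR_grad L'_proj R'_proj).
move=> h; exact: h.
Qed.

End Step.

Section Iterate.
Variables (L : nat -> 'M[CC]_(n1, r)) (R : nat -> 'M[CC]_(n2, r)) (s : nat -> 'cV[CC]_N).
Variables (gamma : nat -> RR) (B : RR).
Hypotheses (gamma_bd : forall k, 1 <= gamma k <= 2).
Hypotheses (B_ge : nu * s1 <= B) (B_le : B <= 3 * nu * s1).
Hypotheses (L0_ball : rowball B (L 0%N)) (R0_ball : rowball B (R 0%N)).
Hypothesis steps : forall k,
  is_hthr (gamma k * al * p) (PiOm n1 n2 Om (f - Gadj n1 n2 (L k *m adj (R k)))) (s k.+1) /\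
  exists gL gR,
    is_gradL (loss n1 n2 r p (1 / 16) Om f (s k.+1)) (L k) (R k) gL /\
    is_gradR (loss n1 n2 r p (1 / 16) Om f (s k.+1)) (L k) (R k) gR /\
    is_proj (rowball B) (L k - toC (ct / s1) *: gL) (L k.+1) /\
    is_proj (rowball B) (R k - toC (ct / s1) *: gR) (R k.+1).
Hypothesis close0 : dist Ln Rn (L 0%N) (R 0%N) ^+ 2 <= cd * sr.
Let q := 1 - ct / s1 * sr / 64.

Lemma rate_bounds : 0 <= q <= 1.
Proof.
have sr0 := sr_gt0; have srs1 := sr_le_s1; have s10 : 0 < s1 := lt_le_trans sr0 srs1.
have h0 : 0 <= ct / s1 * sr by rewrite !mulr_ge0 ?invr_ge0 // ltW.
have h1 : ct / s1 * sr <= ct.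
  by rewrite mulrAC ler_pdivrMr // ler_pM2l.
exact: rate_real h0 h1 ct_le.
Qed.

Lemma hsgd_iterate k :
  [/\ rowball B (L k), rowball B (R k) &
      dist Ln Rn (L k) (R k) ^+ 2 <= q ^+ k * dist Ln Rn (L 0%N) (R 0%N) ^+ 2].
Proof.
have /andP[q0 q1] := rate_bounds.
elim: k => [|k [hL hR hd]]; first by rewrite expr0 mul1r.
have [thr [gL [gR [gLg [gRg [pL pR]]]]]] := steps k.
have cl : dist Ln Rn (L k) (R k) ^+ 2 <= cd * sr.
  apply: le_trans hd _; apply: le_trans close0.
  by rewrite ler_piMl ?sqr_ge0 // exprn_ile1.
have st := hsgd_step (gamma_bd k) B_ge B_le hL hR thr gLg gRg pL pR cl.
split; [by case: pL | by case: pR |].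
by apply: le_trans st _; rewrite -/q [q ^+ k.+1]exprS -mulrA; exact: ler_wpM2l.
Qed.

(** The iteration yields the exponent k + 1; one power of q <= 1 is given up to match the stated
    form. *)
Lemma hsgd_rate k :
  dist Ln Rn (L k.+1) (R k.+1) ^+ 2 <= q ^+ k * dist Ln Rn (L 0%N) (R 0%N) ^+ 2.
Proof.
have /andP[q0 q1] := rate_bounds; have [_ _ h] := hsgd_iterate k.+1.
apply: le_trans h _; rewrite ler_wpM2r ?sqr_ge0 // exprS.
by rewrite ler_piMl ?exprn_ge0.
Qed.

End Iterate.

End Contraction.

Lemma hsgd_contraction n1 n2 r (x wn : 'cV[CC]_(n1 + n2).-1) (Un : 'M[CC]_(n1, r))
    (Vn : 'M[CC]_(n2, r)) (sig gamma : nat -> RR) (p al mu nu e tau cd ca ct : RR)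
    (Om : {set 'I_(n1 + n2).-1}) (L : nat -> 'M[CC]_(n1, r)) (R : nat -> 'M[CC]_(n2, r)) s :
  (0 < n1)%N -> (0 < n2)%N -> (0 < r)%N -> (r <= n1)%N -> (r <= n2)%N ->
  compact_svd (hankel n1 n2 x) Un Vn sig ->
  nu = mu * c_s n1 n2 * r%:R / (n1 + n2).-1%:R ->
  0 < p -> 0 <= al -> 0 <= nu -> 0 <= e -> 100 * e <= 1 -> 0 <= tau ->
  0 <= cd -> 50 * cd <= 1 / 100 -> 0 <= ca -> 50 * ca <= 1 / 100 ->
  0 < ct -> 200 * ct <= 1 ->
  (forall a, rown2 Un a <= nu) -> (forall b, rown2 Vn b <= nu) ->
  (forall T, PT Un Vn T = T ->
    `|\sum_i bw p Om i * cabs (Gadj n1 n2 T i 0) ^+ 2| <= 2 * e * frob2 T) ->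
  (forall (u : 'cV[CC]_n1) (v : 'cV[CC]_n2),
    rinner (u *m adj v) (hankel n1 n2 (reweighted x p Om)) <=
    sig 0%N * e * Num.sqrt (frob2 u) * Num.sqrt (frob2 v)) ->
  (forall l u : nat, (l <= u)%N ->
    #|[set i in Om | (l <= i < u)%N]|%:R <= 2 * p * (u - l)%:R + tau) ->
  tau <= p * (minn n1 n2)%:R -> 12 * tau * nu <= p / 100 ->
  9 * (al * ((n1 + n2).-1%:R * nu) * sig 0%N) <= ca * sig r.-1 ->
  (forall k, 1 <= gamma k <= 2) ->
  #|[set i in Om | wn i 0 != 0]|%:R <= al * p * (n1 + n2).-1%:R ->
  let f := Dop n1 n2 x + Dop n1 n2 wn in
  let Ln := Un *m diagr r r (sqrtf sig) in
  let Rn := Vn *m diagr r r (sqrtf sig) in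
  hsgd_run p al (1 / 16) (ct / sig 0%N) mu gamma Om f L R s ->
  dist Ln Rn (L 0%N) (R 0%N) ^+ 2 <= cd * sig r.-1 ->
  forall k, dist Ln Rn (L k.+1) (R k.+1) ^+ 2 <=
    (1 - ct / sig 0%N * sig r.-1 / 64) ^+ k * dist Ln Rn (L 0%N) (R 0%N) ^+ 2.
Proof.
move=> n1_gt0 n2_gt0 r_gt0 rn1 rn2 csvd nuE p0 al0 nu0 e0 e1 tau0 cd0 cd1 ca0 ca1 ct0 ct1.
move=> U_row V_row rip spec counts tau_le edge al_small gam outl f Ln Rn.
move=> [[w [w_thr s0E]] [U0 [V0 [sig0 [tsvd [pL [pR steps]]]]]]] close k.
have sr0 := sr_gt0 r_gt0 csvd; have srs1 := sr_le_s1 r_gt0 csvd.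
have s10 : 0 < sig 0%N := lt_le_trans sr0 srs1.
have [UU0 VV0] := trunc_svd_iso rn1 rn2 tsvd.
have [Uf [Vf [fsvd _]]] := tsvd.
have [_ [_ [t0 [tm _]]]] := fsvd.
have specL := specnorm_factor r_gt0 UU0 t0 (fun i => tm _ _ (leq0n i)).
have specR := specnorm_factor r_gt0 VV0 t0 (fun i => tm _ _ (leq0n i)).
have x_le i : cabs (x i 0) <= sig 0%N * nu.
  have [_ [_ [sp [_ HE]]]] := csvd.
  apply: (hankel_entry_le i n1_gt0 n2_gt0 (ltW s10) nu0 HE) => // j.
  by have /andP[h1 h2] := sig_bounds r_gt0 csvd j; rewrite h2 (le_trans (ltW sr0)).
have w_thr' : is_hthr (al * p) (PiOm n1 n2 Om (x + wn)) w.
  by move: w_thr; rewrite /f -DopD PiOm_Dop DopK.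
rewrite s0E in fsvd.
have hform u v := init_form n1_gt0 n2_gt0 al0 p0 x_le outl w_thr' u v spec.
have hs := init_top n1_gt0 n2_gt0 r_gt0 csvd fsvd hform.
rewrite specL in pL steps; rewrite specR in pR steps.
have BE : 2 * mu * r%:R * c_s n1 n2 / (n1 + n2).-1%:R * sig0 0%N = 2 * nu * sig0 0%N.
  by rewrite nuE; ring.
rewrite BE in pL pR steps.
have /andP[hB1 hB2] := init_real s10 nu0 e1 ca1 srs1 al_small ca0 hs.
exact: (hsgd_rate n1_gt0 n2_gt0 r_gt0 csvd p0 al0 nu0 e0 e1 tau0 cd0 cd1 ca0 ca1 ct0 ct1
  U_row V_row rip counts tau_le edge al_small outl gam hB1 hB2 (proj1 pL) (proj1 pR) steps close).
Qed.

(** * Choice of the constants and the final theorem *)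

Lemma bern_prob_ge0 n (p : RR) (E : {set 'I_n} -> Prop) : 0 < p <= 1 -> 0 <= bern_prob p E.
Proof.
case/andP=> p0 p1; apply: sumr_ge0 => Om _.
rewrite !mulr_ge0 ?exprn_ge0 ?subr_ge0 //; first exact: ltW.
by case: ifP.
Qed.

Lemma dominate_rate (Cp N nu L p m : RR) :
  0 <= Cp -> 0 <= L -> 0 <= nu -> 1 <= m -> 1 <= N * nu -> Cp * (N * nu ^+ 2 * L) <= p ->
  Cp * L * (nu * m) <= p * m.
Proof.
move=> C0 L0 nu0 m1 Nnu hp.
have m0 : 0 <= m by apply: le_trans m1.
have CL : 0 <= Cp * L * nu by rewrite !mulr_ge0.
have h := ler_wpM2l CL Nnu.
rewrite mulrA ler_wpM2r //; apply: le_trans hp.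
by move: h; rewrite mulr1 (_ : Cp * L * nu * (N * nu) = Cp * (N * nu ^+ 2 * L)) //; ring.
Qed.

Lemma sparsity_real (al X s1 sr Ca : RR) : 0 < sr -> sr <= s1 -> 0 <= al -> 0 < X ->
  al <= Ca / (X * (s1 / sr) ^+ 2) -> al * X * s1 <= Ca * sr.
Proof.
move=> sr0 srs al0 X0; have s10 := lt_le_trans sr0 srs.
have k1 : 1 <= s1 / sr by rewrite ler_pdivlMr ?mul1r.
have k0 : 0 < s1 / sr by rewrite divr_gt0.
have Y0 : 0 < X * (s1 / sr) ^+ 2 by rewrite mulr_gt0 // exprn_gt0.
rewrite ler_pdivlMr // => h.
have h2 : al * X * (s1 / sr) <= Ca.
  apply: le_trans h; move: (s1 / sr) k0 k1 => t k0 k1.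
  rewrite (_ : al * (X * t ^+ 2) = al * X * t * t); last by ring.
  by rewrite ler_peMr // !mulr_ge0 // ltW.
have := ler_wpM2r (ltW sr0) h2.
by rewrite -[al * X * (s1 / sr) * sr]mulrA divfK // gt_eqF.
Qed.

Lemma edge_bound (l nu p : RR) : 0 < l * nu ->
  32 * (100 * 100) * l * nu <= p -> 12 * (12 * l) * nu <= p / 100.
Proof. by move=> *; rewrite ler_pdivlMr //; lra. Qed.

Lemma sparsity_scale (z ca sr : RR) : z <= ca / 9 * sr -> 9 * z <= ca * sr.
Proof. by move=> *; lra. Qed.

Lemma step_size_real (ct : RR) : ct <= 1 / 200 -> 200 * ct <= 1.
Proof. by move=> *; lra. Qed.

Theorem theorem1 :
  forall b0 : RR, 1 <= b0 ->
  exists Cp Calpha Cd c0 : RR,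
    0 < Cp /\ 0 < Calpha /\ 0 < Cd /\ 0 < c0 /\
    forall (n1 n2 r : nat)
      (xn wn : 'cV[CC]_((n1 + n2).-1))
      (Un : 'M[CC]_(n1, r)) (Vn : 'M[CC]_(n2, r)) (sig : nat -> RR)
      (mu p alpha ct : RR) (gamma : nat -> RR),
    (0 < n1)%N -> (0 < n2)%N -> (0 < r)%N ->
    \rank (hankel n1 n2 xn) = r ->
    compact_svd (hankel n1 n2 xn) Un Vn sig ->
    let n := (n1 + n2).-1 in
    let cs := c_s n1 n2 in
    norm2inf Un <= Num.sqrt (mu * cs * r%:R / n%:R) ->
    norm2inf Vn <= Num.sqrt (mu * cs * r%:R / n%:R) ->
    0 < p <= 1 -> 0 <= alpha ->
    let kappa := sig 0%N / sig r.-1 in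
    Cp * (cs ^+ 2 * mu ^+ 2 * r%:R ^+ 2 * ln n%:R / n%:R) <= p ->
    alpha <= Calpha / (cs * mu * r%:R * kappa ^+ 2) ->
    (forall k, 1 + 1 / b0 <= gamma k <= 2) ->
    0 < ct <= c0 ->
    let lam : RR := 1 / 16 in
    let eta := ct / sig 0%N in
    let f := Dop n1 n2 xn + Dop n1 n2 wn in
    let Ln := Un *m diagr r r (sqrtf sig) in
    let Rn := Vn *m diagr r r (sqrtf sig) in
    1 - 6 / n%:R ^+ 2 <=
    bern_prob p (fun Om =>
      forall (L : nat -> 'M[CC]_(n1, r)) (R : nat -> 'M[CC]_(n2, r))
             (s : nat -> 'cV[CC]_n),
        #|[set i in Om | wn i 0 != 0]|%:R <= alpha * p * n%:R ->
        hsgd_run p alpha lam eta mu gamma Om f L R s ->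
        dist Ln Rn (L 0%N) (R 0%N) <= Cd * Num.sqrt (sig r.-1 / kappa) ->
        forall k : nat,
          dist Ln Rn (L k.+1) (R k.+1) ^+ 2
            <= (1 - eta * sig r.-1 / 64) ^+ k * dist Ln Rn (L 0%N) (R 0%N) ^+ 2).
Proof.
move=> b0 b01; pose e : RR := 1 / 100; pose ca : RR := 1 / 100 * (1 / 50).
pose Cp : RR := 32 * (100 * 100).
(* The 9 is the 3 of |A| <= 3 alpha p n times the 3 of the row bound 3 nu s1. The initial radius
   1/100 enters squared, as the bound cd on d^2 / sigma_r. *)
exists Cp, (ca / 9), (1 / 100), (1 / 200).
have Cp0 : 0 < Cp by rewrite /Cp !mulr_gt0.
have ca0 : 0 < ca by rewrite /ca; lra.
have e01 : 0 < e <= 1 by apply/andP; rewrite /e; split; lra.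
have e100 : 100 * e <= 1 by rewrite /e; lra.
have Cpe : 32 <= Cp * e ^+ 2 by rewrite /Cp /e; lra.
have Cp12 : 12 <= Cp by rewrite /Cp; lra.
have cd_le : 50 * (1 / 100) ^+ 2 <= 1 / 100 :> RR by lra.
have ca_le : 50 * ca <= 1 / 100 by rewrite /ca; lra.
split; first exact: Cp0.
split; first by rewrite divr_gt0.
split; first by rewrite divr_gt0.
split; first by rewrite divr_gt0.
move=> n1 n2 r xn wn Un Vn sig mu p al ct gamma n1_gt0 n2_gt0 r_gt0 rk csvd n cs hU hV.
move=> p01 al0 kappa hp hal gam ct01; lazy zeta; have /andP[ct0 ct1] := ct01.
have [UU [VV [_ [_ HE]]]] := csvd.
have [nu0 U_row n1nu] := norm2inf_row n1_gt0 r_gt0 UU hU.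
have [_ V_row n2nu] := norm2inf_row n2_gt0 r_gt0 VV hV.
set nu := mu * cs * r%:R / n%:R in nu0 U_row n1nu V_row n2nu.
(* For n = 1 the logarithm vanishes and the sampling assumption is empty, but the claimed
   probability is negative. *)
have [N2|N1] := leqP 2 n; last first.
  have n1E : n = 1%N.
    by move: N1 n1_gt0 n2_gt0; rewrite /n; clear; lia.
  by apply: le_trans (bern_prob_ge0 _ p01); rewrite n1E expr1n; lra.
have sr0 := sr_gt0 r_gt0 csvd; have srs1 := sr_le_s1 r_gt0 csvd.
have s10 : 0 < sig 0%N := lt_le_trans sr0 srs1.
have p0 : 0 < p by case/andP: p01.
have nR : n%:R != 0 :> RR by rewrite pnatr_eq0 -lt0n ltnW.
have Nnu : 1 <= n%:R * nu.
  apply: le_trans n1nu _; rewrite ler_wpM2r ?(ltW nu0) // ler_nat.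
  by move: n1_gt0 n2_gt0; rewrite /n; clear; lia.
have Lp : 0 < ln n%:R :> RR by apply: ln_gt0; rewrite ltr1n.
have hp' : Cp * (n%:R * nu ^+ 2 * ln n%:R) <= p.
  rewrite (_ : n%:R * nu ^+ 2 * ln n%:R = cs ^+ 2 * mu ^+ 2 * r%:R ^+ 2 * ln n%:R / n%:R) //.
  by rewrite /nu; field.
have x_le i : cabs (xn i 0) <= sig 0%N * nu.
  apply: (hankel_entry_le i n1_gt0 n2_gt0 (ltW s10) (ltW nu0) HE) => // j.
  by have /andP[h1 h2] := sig_bounds r_gt0 csvd j; rewrite h2 (le_trans (ltW sr0)).
apply: (good_prob n1_gt0 n2_gt0 UU VV U_row V_row x_le s10 p01 nu0 N2 Nnu Cp0 e01 Cpe hp').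
move=> Om [rip spec counts] L R s outl run close.
(* Both U and V have r orthonormal columns, so nu is at least 1/n1 and 1/n2. This lets the sampling
   rate dominate tau = 12 log n on windows as long as the shorter side. *)
have minnu : 1 <= nu * (minn n1 n2)%:R.
  by rewrite mulrC /minn; case: ifP.
have m1 : 1 <= (minn n1 n2)%:R :> RR by rewrite ler1n leq_min n1_gt0.
have C12 : 12 * ln n%:R <= Cp * ln n%:R.
  by rewrite ler_wpM2r // ltW.
have tau_le : 12 * ln n%:R <= p * (minn n1 n2)%:R.
  apply: le_trans (dominate_rate (ltW Cp0) (ltW Lp) (ltW nu0) m1 Nnu hp').
  by apply: le_trans C12 _; rewrite ler_peMr // mulr_ge0 // ltW.
have edge : 12 * (12 * ln n%:R) * nu <= p / 100.
  have := dominate_rate (ltW Cp0) (ltW Lp) (ltW nu0) (lexx 1) Nnu hp'.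
  by rewrite !mulr1; apply: edge_bound; rewrite mulr_gt0.
have al_small : 9 * (al * (n%:R * nu) * sig 0%N) <= ca * sig r.-1.
  have XE : cs * mu * r%:R = n%:R * nu by rewrite /nu; field.
  rewrite XE in hal.
  have := sparsity_real sr0 srs1 al0 _ hal; rewrite mulr_gt0 ?ltr0n ?(ltnW N2) // => /(_ isT).
  exact: sparsity_scale.
have gam' k : 1 <= gamma k <= 2.
  have /andP[g1 ->] := gam k; rewrite andbT; apply: le_trans g1.
  by rewrite lerDl divr_ge0 // (le_trans ler01).
have cl : dist (Un *m diagr r r (sqrtf sig)) (Vn *m diagr r r (sqrtf sig)) (L 0%N) (R 0%N) ^+ 2 <= (1 / 100) ^+ 2 * sig r.-1.
  have k1 : 1 <= kappa by rewrite /kappa ler_pdivlMr ?mul1r.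
  have k0 : 0 < kappa by apply: lt_le_trans k1.
  have sk : 0 <= sig r.-1 / kappa by rewrite divr_ge0 // ltW.
  apply: (@le_trans _ _ ((1 / 100 * Num.sqrt (sig r.-1 / kappa)) ^+ 2)).
    by rewrite lerXn2r ?nnegrE ?sqrtr_ge0 // mulr_ge0 ?sqrtr_ge0.
  rewrite exprMn sqr_sqrtr // ler_wpM2l ?sqr_ge0 // ler_pdivrMr // ler_peMr // ltW //.
have rn1 : (r <= n1)%N by rewrite -rk rank_leq_row.
have rn2 : (r <= n2)%N by rewrite -rk rank_leq_col.
apply: (hsgd_contraction (mu := mu) (gamma := gamma) n1_gt0 n2_gt0 r_gt0 rn1 rn2 csvd (erefl nu) p0 al0 (ltW nu0)
  _ e100 _ _ cd_le (ltW ca0) ca_le ct0 _ U_row V_row rip spec counts tau_le edge al_small gam' outl run cl).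
- by case/andP: e01 => /ltW.
- by rewrite mulr_ge0 // ltW.
- exact: sqr_ge0.
- exact: step_size_real.
Qed.
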